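(* The elements $\mathrm{Str}\,\widehat{F}^{2k}$, $k\ge1$, generate (as an algebra) the center $\mathcal{Z}(\mathfrak{osp}_{2m+1|2n})$ of the universal enveloping algebra $\mathrm{U}(\mathfrak{osp}_{2m+1|2n})$.
   Context: Everything is over $\mathbb{C}$. Put $M=2m+1$ and $V=\mathbb{C}^{M|2n}$ with homogeneous basis $e_1,\dots,e_{M+2n}$, where the parity $|i|$ of $e_i$ is $\bar0$ iff $n<i\le M+n$. Put $i'=M+2n+1-i$, $\varepsilon_i=1$ for $i\le M+n$ and $\varepsilon_i=-1$ for $i>M+n$. Let $e_{ij}$ be the matrix units of $\mathrm{End}(V)$. $\mathfrak{g}=\mathfrak{osp}_{M|2n}$ is the span in $\mathrm{End}(V)$ of $F_{ij}=e_{ij}-(-1)^{|j|(|i|+|j|)}\varepsilon_i\varepsilon_je_{j'i'}$ (parity $|i|+|j|$), with the supercommutator. Regarding the $F_{ij}$ as elements of $\mathrm{U}(\mathfrak{g})$, put $$\widehat{F}=\sum_{i,j}(-1)^{|i||j|+|i|+|j|}e_{ij}\otimes F_{ij}\in\mathrm{End}(V)\otimes\mathrm{U}(\mathfrak{g}),$$ where the tensor product superalgebra has multiplication $(a_1\otimes b_1)(a_2\otimes b_2)=(-1)^{|a_2||b_1|}a_1a_2\otimes b_1b_2$. $\mathrm{Str}\colon\mathrm{End}(V)\otimes\mathrm{U}(\mathfrak{g})\to\mathrm{U}(\mathfrak{g})$ is the supertrace $e_{ij}\mapsto(-1)^{|i|}\delta_{ij}$ applied to the first factor. $\mathcal{Z}(\mathfrak{g})=\mathrm{U}(\mathfrak{g})^{\mathfrak{g}}$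 is the (super)center. *)

(* Defs.v *)
From HB Require Import structures.
From mathcomp Require Import all_boot all_order all_algebra.
From mathcomp Require Import boolp reals ring zify.
From mathcomp Require Import complex.
From mathcomp Require Import finmap.
From mathcomp.multinomials Require Import monalg.

Set Implicit Arguments.
Unset Strict Implicit.
Unset Printing Implicit Defensive.

Import Order.TTheory GRing.Theory Num.Theory.

Local Open Scope ring_scope.
Local Open Scope quotient_scope.

(* A Z/2-grading is encoded by its parity automorphism x |-> (-1)^|x| x, an
   involution; over a field of characteristic 0 the homogeneous elements of
   parity p are those with lpar x = (-1)^p x. *)
HB.mixin Record Lmodule_isLieSuperalgebra (K : numFieldType) L
    of GRing.Lmodule K L := {
  lpar : L -> L;
  lbr : L -> L -> L;
  lpar_linear : forall a x y, lpar (a *: x + y) = a *: lpar x + lpar y;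
  lparK : involutive lpar;
  lpar_lbr : forall x y, lpar (lbr x y) = lbr (lpar x) (lpar y);
  lbr_linearl : forall a x y z, lbr (a *: x + y) z = a *: lbr x z + lbr y z;
  lbr_linearr : forall a x y z, lbr x (a *: y + z) = a *: lbr x y + lbr x z;
  lbr_anti : forall (p q : bool) x y,
    lpar x = (-1) ^+ p *: x -> lpar y = (-1) ^+ q *: y ->
    lbr x y = - ((-1) ^+ (p && q) *: lbr y x);
  lbr_jacobi : forall (p q : bool) x y z,
    lpar x = (-1) ^+ p *: x -> lpar y = (-1) ^+ q *: y ->
    lbr x (lbr y z) = lbr (lbr x y) z + (-1) ^+ (p && q) *: lbr y (lbr x z)
}.

#[short(type="lieSuperalgType")]
HB.structure Definition LieSuperalgebra (K : numFieldType) :=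
  {L of GRing.Lmodule K L & Lmodule_isLieSuperalgebra K L}.

Definition homog (K : numFieldType) (L : lieSuperalgType K) (p : bool) (x : L)
  : Prop := lpar x = (-1) ^+ p *: x.

Inductive two_sided_ideal (A : nzRingType) (S : A -> Prop) : A -> Prop :=
| ideal_zero : two_sided_ideal S 0
| ideal_add x y :
    two_sided_ideal S x -> two_sided_ideal S y -> two_sided_ideal S (x + y)
| ideal_mul a r b : S r -> two_sided_ideal S (a * r * b).

Lemma ideal_incl (A : nzRingType) (S : A -> Prop) r :
  S r -> two_sided_ideal S r.
Proof. by move=> /(ideal_mul 1 1); rewrite mul1r mulr1. Qed.

Inductive subalg_gen (K : nzRingType) (A : algType K) (S : A -> Prop)
  : A -> Prop :=
| subalg_incl x : S x -> subalg_gen S x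
| subalg_one : subalg_gen S 1
| subalg_lin a x y :
    subalg_gen S x -> subalg_gen S y -> subalg_gen S (a *: x + y)
| subalg_mul x y : subalg_gen S x -> subalg_gen S y -> subalg_gen S (x * y).

Lemma malg_scaleU (R : nzRingType) (I : choiceType) (a b : R) (u : I) :
  a *: << b *g u >> = << a * b *g u >> :> {malg R[I]}.
Proof. by apply/malgP => w; rewrite mcoeffZ 2!mcoeffU mulrnAr. Qed.

Section FreeAlgebra.
Variables (K : comNzRingType) (I : choiceType).

Definition freeAlg : Type := {malg K[{fmonom I}]}.

HB.instance Definition _ := GRing.Lalgebra.on freeAlg.

Lemma free_scalerAr (a : K) (x y : freeAlg) : a *: (x * y) = x * (a *: y).
Proof.
rewrite malgME (malgMEw (fsubset_refl (msupp x)) (msuppZ_le a y)) scaler_sumr.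
apply: eq_bigr => u _; rewrite scaler_sumr; apply: eq_bigr => v _.
by rewrite mcoeffZ (mulrCA _ a) malg_scaleU.
Qed.

HB.instance Definition _ :=
  GRing.Lalgebra_isAlgebra.Build K freeAlg free_scalerAr.

End FreeAlgebra.

HB.lock Definition fgen (K : comNzRingType) (I : choiceType) (x : I)
  : freeAlg K I := << fmu x >>.

Arguments fgen {K I} x.

Section FreeLift.
Variables (K : comNzRingType) (I : choiceType) (A : algType K) (f : I -> A).
Local Notation freeAlg := (freeAlg K I).

Definition word_val (w : {fmonom I}) : A := \prod_(x <- w : seq I) f x.

Lemma word_val_morph : mmorphism word_val.
Proof.
split; last by rewrite /word_val fm1 big_nil.
by move=> u v; rewrite /word_val fmM big_cat.
Qed.

HB.instance Definition _ :=
  isMultiplicative.Build {fmonom I} A word_val word_val_morph.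

Definition free_lift (t : freeAlg) : A := mmap (in_alg A) word_val t.

Lemma free_liftB : zmod_morphism free_lift.
Proof. exact: (raddfB (mmap (in_alg A) word_val)). Qed.

HB.instance Definition _ :=
  GRing.isZmodMorphism.Build freeAlg A free_lift free_liftB.

Lemma free_liftM : monoid_morphism free_lift.
Proof.
have [|h1 h2] := @commr_mmap_is_multiplicative _ _ _ (in_alg A) word_val.
  by move=> g u v; rewrite /GRing.comm /= mulr_algl mulr_algr.
by split.
Qed.

HB.instance Definition _ :=
  GRing.isMonoidMorphism.Build freeAlg A free_lift free_liftM.

Lemma free_liftZ : scalable free_lift.
Proof. by move=> c t; rewrite /free_lift mmapZ /= mulr_algl. Qed.

HB.instance Definition _ :=
  GRing.isScalable.Build K freeAlg A _ free_lift free_liftZ.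

Lemma free_lift_gen x : free_lift (fgen x) = f x.
Proof.
by rewrite unlock /free_lift mmapU /= scale1r mul1r /word_val fmuE big_seq1.
Qed.

End FreeLift.

(* The constants introduced with HB.lock are locked because unification would
   otherwise unfold products of the free algebra. *)

Section Enveloping.
Variables (K : numFieldType) (L : lieSuperalgType K).

Local Notation T := (freeAlg K L).

(* U(L) is the free associative algebra on the set L modulo linearity of the
   generators (which gives the tensor algebra T(L)) and the relations
   xy - (-1)^{|x||y|} yx = [x, y] for homogeneous x and y. *)
Inductive env_rel : T -> Prop :=
| rel_linear a x y : env_rel (fgen (a *: x + y) - (a *: fgen x + fgen y))
| rel_bracket p q x y : homog p x -> homog q y ->
    env_rel (fgen x * fgen y - (-1) ^+ (p && q) *: (fgen y * fgen x)
             - fgen (lbr x y)).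

Definition env_ideal : {pred T} := fun t => `[< two_sided_ideal env_rel t >].

Lemma env_idealP t : reflect (two_sided_ideal env_rel t) (t \in env_ideal).
Proof. exact: asboolP. Qed.

Lemma env_ideal_zmod : zmod_closed env_ideal.
Proof.
split; first by apply/env_idealP; exact: ideal_zero.
move=> x y /env_idealP hx /env_idealP hy; apply/env_idealP/ideal_add => //.
elim: hy => [|u v _ hu _ hv|a r b hr].
- by rewrite oppr0; exact: ideal_zero.
- by rewrite opprD; exact: ideal_add.
- by rewrite -!mulNr; exact: ideal_mul.
Qed.

HB.instance Definition _ := GRing.isZmodClosed.Build T env_ideal env_ideal_zmod.

Lemma env_idealMl a x : x \in env_ideal -> a * x \in env_ideal.
Proof.
move=> /env_idealP h; apply/env_idealP.
elim: h => [|u v _ hu _ hv|c r b hr].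
- by rewrite mulr0; exact: ideal_zero.
- by rewrite mulrDr; exact: ideal_add.
- by rewrite !mulrA; exact: ideal_mul.
Qed.

Lemma env_idealMr a x : x \in env_ideal -> x * a \in env_ideal.
Proof.
move=> /env_idealP h; apply/env_idealP.
elim: h => [|u v _ hu _ hv|c r b hr].
- by rewrite mul0r; exact: ideal_zero.
- by rewrite mulrDl; exact: ideal_add.
- by rewrite -(mulrA _ b); exact: ideal_mul.
Qed.

Section Lift.
Variables (A : algType K) (f : L -> A).

Definition enveloping_map : Prop :=
  (forall a x y, f (a *: x + y) = a *: f x + f y) /\
  (forall p q x y, homog p x -> homog q y ->
     f x * f y - (-1) ^+ (p && q) *: (f y * f x) = f (lbr x y)).

Lemma free_lift_ideal t : enveloping_map -> t \in env_ideal -> free_lift f t = 0.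
Proof.
move=> [flin fbr] /env_idealP; elim=> [|x y _ hx _ hy|a r b hr].
- exact: raddf0.
- by rewrite raddfD /= hx hy addr0.
suff -> : free_lift f (a * r * b) = free_lift f a * 0 * free_lift f b.
  by rewrite mulr0 mul0r.
have fD (u v : T) : free_lift f (u + v) = free_lift f u + free_lift f v.
  exact: raddfD.
have fB (u v : T) : free_lift f (u - v) = free_lift f u - free_lift f v.
  exact: raddfB.
have fM (u v : T) : free_lift f (u * v) = free_lift f u * free_lift f v.
  exact: rmorphM.
have fZ c (u : T) : free_lift f (c *: u) = c *: free_lift f u by exact: linearZ.
rewrite !fM; congr (_ * _ * _).
case: hr => [c x y|p q x y hx hy].
  by rewrite fB fD fZ !free_lift_gen flin subrr.
have key (t1 t2 t3 : T) : free_lift f t1 = f x * f y ->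
    free_lift f t2 = f y * f x -> free_lift f t3 = f (lbr x y) ->
    free_lift f (t1 - (-1) ^+ (p && q) *: t2 - t3) = 0.
  by move=> e1 e2 e3; rewrite !fB fZ e1 e2 e3 (fbr p q) // subrr.
by apply: key; [rewrite fM !free_lift_gen|rewrite fM !free_lift_gen|
                exact: free_lift_gen].
Qed.

End Lift.

Definition Uenv : Type := Quotient.quot env_ideal.

HB.instance Definition _ := GRing.Zmodule.on Uenv.
HB.instance Definition _ : EqQuotient T (Quotient.equiv env_ideal) Uenv :=
  EqQuotient.on Uenv.

Definition upi (t : T) : Uenv := \pi_Uenv t.

Lemma upi_eq x y : (upi x == upi y) = (x - y \in env_ideal).
Proof. by rewrite Quotient.idealrBE. Qed.

Lemma upi_eqP x y : x - y \in env_ideal -> upi x = upi y.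
Proof. by rewrite -upi_eq => /eqP. Qed.

Lemma upi_repr (u : Uenv) : upi (repr u) = u.
Proof. exact: reprK. Qed.

Lemma repr_upi t : repr (upi t) - t \in env_ideal.
Proof. by rewrite -upi_eq upi_repr. Qed.

Lemma upiB : zmod_morphism upi.
Proof. by move=> x y; exact: (raddfB \pi_Uenv). Qed.

HB.instance Definition _ := GRing.isZmodMorphism.Build T Uenv upi upiB.

Definition uone : Uenv := upi 1.

End Enveloping.

HB.lock Definition umul (K : numFieldType) (L : lieSuperalgType K)
  (u v : Uenv L) : Uenv L := upi (repr u * repr v).

HB.lock Definition uscale (K : numFieldType) (L : lieSuperalgType K) (c : K)
  (u : Uenv L) : Uenv L := upi (c *: repr u).

Section EnvelopingAlgebra.
Variables (K : numFieldType) (L : lieSuperalgType K).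
Local Notation T := (freeAlg K L).
Local Notation Uenv := (Uenv L).
Local Notation upi := (@upi K L).
Local Notation uone := (@uone K L).
Local Notation umul := (@umul K L).
Local Notation uscale := (@uscale K L).

Lemma umulE x y : umul (upi x) (upi y) = upi (x * y).
Proof.
rewrite unlock; apply: upi_eqP.
have -> : repr (upi x) * repr (upi y) - x * y =
  (repr (upi x) - x) * repr (upi y) + x * (repr (upi y) - y).
  by rewrite mulrBl mulrBr addrA subrK.
by apply: rpredD; [apply: env_idealMr|apply: env_idealMl]; exact: repr_upi.
Qed.

Lemma uscaleE c x : uscale c (upi x) = upi (c *: x).
Proof.
rewrite unlock; apply: upi_eqP; rewrite -scalerBr -[X in _ *: X]mul1r scalerAl.
by rewrite env_idealMl ?repr_upi.
Qed.

Lemma umulA : associative umul.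
Proof.
move=> u v w; rewrite -(upi_repr u) -(upi_repr v) -(upi_repr w).
by rewrite !umulE mulrA.
Qed.

Lemma umul1 : left_id uone umul.
Proof. by move=> u; rewrite -(upi_repr u) umulE mul1r. Qed.

Lemma umulr1 : right_id uone umul.
Proof. by move=> u; rewrite -(upi_repr u) umulE mulr1. Qed.

Lemma umulDl : left_distributive umul +%R.
Proof.
move=> u v w; rewrite -(upi_repr u) -(upi_repr v) -(upi_repr w).
by rewrite -raddfD !umulE mulrDl raddfD.
Qed.

Lemma umulDr : right_distributive umul +%R.
Proof.
move=> u v w; rewrite -(upi_repr u) -(upi_repr v) -(upi_repr w).
by rewrite -raddfD !umulE mulrDr raddfD.
Qed.

Lemma uone_neq0 : uone != 0.
Proof.
rewrite -(raddf0 upi) upi_eq subr0; apply/negP.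
move=> /(@free_lift_ideal K L K^o (fun=> 0)) h.
have /h : enveloping_map (fun _ : L => 0 : K^o).
  by split=> *; rewrite ?scaler0 ?addr0 ?mul0r ?scaler0 ?subr0.
by rewrite rmorph1; apply/eqP; rewrite oner_eq0.
Qed.

HB.instance Definition _ := GRing.Zmodule_isNzRing.Build Uenv
  umulA umul1 umulr1 umulDl umulDr uone_neq0.

Lemma uscaleA a b u : uscale a (uscale b u) = uscale (a * b) u.
Proof. by rewrite -(upi_repr u) !uscaleE scalerA. Qed.

Lemma uscale1 : left_id 1 uscale.
Proof. by move=> u; rewrite -(upi_repr u) uscaleE scale1r. Qed.

Lemma uscaleDr : right_distributive uscale +%R.
Proof.
move=> a u v; rewrite -(upi_repr u) -(upi_repr v).
by rewrite -raddfD !uscaleE scalerDr raddfD.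
Qed.

Lemma uscaleDl u : {morph uscale^~ u : a b / a + b}.
Proof.
by move=> a b; rewrite -(upi_repr u) !uscaleE scalerDl raddfD.
Qed.

HB.instance Definition _ := GRing.Zmodule_isLmodule.Build K Uenv
  uscaleA uscale1 uscaleDr uscaleDl.

Lemma uscaleAl (a : K) (u v : Uenv) : a *: (u * v) = (a *: u) * v.
Proof.
rewrite -(upi_repr u) -(upi_repr v).
by rewrite /GRing.scale /GRing.mul /= !(umulE, uscaleE) scalerAl.
Qed.

HB.instance Definition _ := GRing.Lmodule_isLalgebra.Build K Uenv uscaleAl.

Lemma uscaleAr (a : K) (u v : Uenv) : a *: (u * v) = u * (a *: v).
Proof.
rewrite -(upi_repr u) -(upi_repr v).
by rewrite /GRing.scale /GRing.mul /= !(umulE, uscaleE) scalerAr.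
Qed.

HB.instance Definition _ := GRing.Lalgebra_isAlgebra.Build K Uenv uscaleAr.

Lemma upi_monoid_morphism : monoid_morphism upi.
Proof. by split=> [|x y]; [exact: erefl|exact: esym (umulE x y)]. Qed.

HB.instance Definition _ :=
  GRing.isMonoidMorphism.Build T Uenv upi upi_monoid_morphism.

Lemma upiZ : scalable upi.
Proof. by move=> c x; rewrite -uscaleE. Qed.

HB.instance Definition _ := GRing.isScalable.Build K T Uenv _ upi upiZ.

End EnvelopingAlgebra.

HB.lock Definition uin (K : numFieldType) (L : lieSuperalgType K) (x : L)
  : Uenv L := upi (fgen x).

HB.lock Definition ulift (K : numFieldType) (L : lieSuperalgType K)
  (A : algType K) (f : L -> A) (u : Uenv L) : A := free_lift f (repr u).

Section EnvelopingTheory.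
Variables (K : numFieldType) (L : lieSuperalgType K).
Local Notation T := (freeAlg K L).
Local Notation Uenv := (Uenv L).
Local Notation upi := (@upi K L).
Local Notation uin := (@uin K L).

Lemma uin_enveloping : enveloping_map uin.
Proof.
split=> [a x y|p q x y hx hy].
- rewrite unlock -linearP; apply: upi_eqP.
  by apply/env_idealP/ideal_incl; exact: rel_linear.
- rewrite unlock -!rmorphM -linearZ -raddfB; apply: upi_eqP.
  by apply/env_idealP/ideal_incl; exact: rel_bracket.
Qed.

Lemma uliftE (A : algType K) (f : L -> A) t :
  enveloping_map f -> ulift f (upi t) = free_lift f t.
Proof.
rewrite unlock => hf; have := free_lift_ideal hf (repr_upi t).
by rewrite raddfB => /eqP; rewrite subr_eq0 => /eqP.
Qed.

Lemma ulift_uin (A : algType K) (f : L -> A) x :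
  enveloping_map f -> ulift f (uin x) = f x.
Proof. by move=> hf; rewrite uin.unlock uliftE // free_lift_gen. Qed.

Lemma ulift_linear (A : algType K) (f : L -> A) a u v :
  enveloping_map f -> ulift f (a *: u + v) = a *: ulift f u + ulift f v.
Proof.
move=> hf; rewrite -(upi_repr u) -(upi_repr v) -linearP !uliftE //.
by rewrite linearP.
Qed.

Lemma ulift1 (A : algType K) (f : L -> A) : enveloping_map f -> ulift f 1 = 1.
Proof. by move=> hf; rewrite -(rmorph1 upi) uliftE // rmorph1. Qed.

Lemma uliftM (A : algType K) (f : L -> A) u v :
  enveloping_map f -> ulift f (u * v) = ulift f u * ulift f v.
Proof.
move=> hf; rewrite -(upi_repr u) -(upi_repr v) -rmorphM !uliftE //.
by rewrite rmorphM.
Qed.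

(* The parity automorphism of the superalgebra U(L). *)
Definition upar : Uenv -> Uenv := ulift (uin \o lpar).

Lemma uin_lpar_enveloping : enveloping_map (uin \o lpar).
Proof.
have [ulin ubr] := uin_enveloping; split=> [a x y|p q x y hx hy] /=.
  by rewrite lpar_linear ulin.
have homog_lpar r z : homog r z -> homog r (lpar z : L).
  move=> hz; rewrite /homog {1}hz -[X in lpar X]addr0 lpar_linear.
  have -> : lpar 0 = 0 :> L; last by rewrite addr0.
  by rewrite -{1}(subrr (0 : L)) -scaleN1r addrC lpar_linear scaleN1r addNr.
by rewrite lpar_lbr (ubr p q) //; exact: homog_lpar.
Qed.

Lemma upar_uin x : upar (uin x) = uin (lpar x).
Proof. exact: (ulift_uin _ uin_lpar_enveloping). Qed.

Lemma upar1 : upar 1 = 1.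
Proof. exact: (ulift1 uin_lpar_enveloping). Qed.

Lemma uparM u v : upar (u * v) = upar u * upar v.
Proof. exact: (uliftM _ _ uin_lpar_enveloping). Qed.

Lemma upar_linear a u v : upar (a *: u + v) = a *: upar u + upar v.
Proof. exact: (ulift_linear _ _ _ uin_lpar_enveloping). Qed.

(* For u homogeneous, utwist p u = (-1)^{p |u|} u. *)
Definition utwist (p : bool) (u : Uenv) : Uenv := if p then upar u else u.

(* The adjoint action x u - (-1)^{|x||u|} u x of x homogeneous of parity p. *)
Definition uad (p : bool) (x : L) (u : Uenv) : Uenv :=
  uin x * u - utwist p u * uin x.

Definition supercenter (u : Uenv) : Prop :=
  forall p x, homog p x -> uad p x u = 0.

End EnvelopingTheory.

Section SuperMatrices.
Variables (K : numFieldType) (L : lieSuperalgType K) (N : nat).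
Variable pr : 'I_N -> bool.

(* End(V) (x) U(L), with \sum_{i,j} e_ij (x) a_ij written as the matrix of the
   a_ij: since (e_ij (x) a)(e_jl (x) b) = (-1)^{|e_jl||a|} e_il (x) ab, the
   product is not the product of matrices over U(L). *)
Definition tens_mul (A B : 'M[Uenv L]_N) : 'M[Uenv L]_N :=
  \matrix_(i, l) \sum_j utwist (pr j (+) pr l) (A i j) * B j l.

Definition tens_exp (A : 'M[Uenv L]_N) (k : nat) : 'M[Uenv L]_N :=
  iter k (tens_mul A) 1%:M.

Definition tens_str (A : 'M[Uenv L]_N) : Uenv L :=
  \sum_i (-1) ^+ pr i * A i i.

End SuperMatrices.

Section SuperCommutator.
Variables (K : numFieldType) (N : nat) (pr : 'I_N -> bool).
Implicit Types X Y Z : 'M[K]_N.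

Definition mx_par (X : 'M[K]_N) : 'M[K]_N :=
  \matrix_(i, j) ((-1) ^+ (pr i (+) pr j) * X i j).

(* The bilinear extension of [X, Y] = XY - (-1)^{|X||Y|} YX. *)
Definition scomm (X Y : 'M[K]_N) : 'M[K]_N :=
  \matrix_(i, l) \sum_j (X i j * Y j l
     - (-1) ^+ ((pr i (+) pr j) && (pr j (+) pr l)) * (Y i j * X j l)).

Lemma signb_eq (b c : bool) (x : K) :
  (-1) ^+ b * x = (-1) ^+ c * x -> b != c -> x = 0.
Proof.
have h2 (y : K) : y = - y -> y = 0.
  by move/eqP; rewrite -subr_eq0 opprK -mulr2n mulrn_eq0 => /eqP.
case: b c => [] [] //=; rewrite !expr1 !expr0 mulN1r mul1r => e _; apply: h2.
  by rewrite e.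
by rewrite -e.
Qed.

Lemma scommE (p q : bool) X Y :
  mx_par X = (-1) ^+ p *: X -> mx_par Y = (-1) ^+ q *: Y ->
  scomm X Y = X *m Y - (-1) ^+ (p && q) *: (Y *m X).
Proof.
move=> hX hY; apply/matrixP=> i l; rewrite !mxE mulr_sumr -sumrB.
apply: eq_bigr => j _; congr (_ - _).
have /matrixP/(_ i j) := hY; have /matrixP/(_ j l) := hX; rewrite !mxE.
move=> /signb_eq eX /signb_eq eY.
have [ej|/eY ->] := eqVneq (pr i (+) pr j) q; last by rewrite !(mul0r, mulr0).
have [el|/eX ->] := eqVneq (pr j (+) pr l) p; last by rewrite !mulr0.
by rewrite ej el andbC.
Qed.

Lemma mx_par_is_linear : linear mx_par.
Proof.
by move=> a X Y; apply/matrixP=> i j; rewrite !mxE mulrDr mulrCA.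
Qed.

HB.instance Definition _ := GRing.isLinear.Build K _ _ _ mx_par mx_par_is_linear.

Lemma mx_parK : involutive mx_par.
Proof. by move=> X; apply/matrixP=> i j; rewrite !mxE mulrA -expr2 sqrr_sign mul1r. Qed.

Lemma scomm_linearl Z : linear (scomm^~ Z).
Proof.
move=> a X Y; apply/matrixP=> i j; rewrite !mxE mulr_sumr -big_split /=.
by apply: eq_bigr => k _; rewrite !mxE; ring.
Qed.

Lemma scomm_linearr X : linear (scomm X).
Proof.
move=> a Y Z; apply/matrixP=> i j; rewrite !mxE mulr_sumr -big_split /=.
by apply: eq_bigr => k _; rewrite !mxE; ring.
Qed.

Lemma mx_par_scomm X Y : mx_par (scomm X Y) = scomm (mx_par X) (mx_par Y).
Proof.
apply/matrixP=> i j; rewrite !mxE mulr_sumr; apply: eq_bigr => k _; rewrite !mxE.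
by case: (pr i) (pr j) (pr k) => [] [] [] /=; ring.
Qed.

Lemma scomm_anti (p q : bool) X Y :
  mx_par X = (-1) ^+ p *: X -> mx_par Y = (-1) ^+ q *: Y ->
  scomm X Y = - ((-1) ^+ (p && q) *: scomm Y X).
Proof.
move=> hX hY; rewrite (scommE hX hY) (scommE hY hX) [q && p]andbC.
by rewrite scalerBr opprB scalerA -expr2 sqrr_sign scale1r.
Qed.


Lemma mx_parM X Y : mx_par (X *m Y) = mx_par X *m mx_par Y.
Proof.
apply/matrixP=> i l; rewrite !mxE mulr_sumr; apply: eq_bigr => j _; rewrite !mxE.
by case: (pr i) (pr j) (pr l) => [] [] [] /=; ring.
Qed.

Lemma mx_par_scomm_homog (p q : bool) X Y :
  mx_par X = (-1) ^+ p *: X -> mx_par Y = (-1) ^+ q *: Y ->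
  mx_par (scomm X Y) = (-1) ^+ (p (+) q) *: scomm X Y.
Proof.
move=> hX hY; rewrite (scommE hX hY) linearB linearZ /= !mx_parM hX hY.
rewrite -!scalemxAl -!scalemxAr !scalerA scalerBr scalerA !signr_addb.
by congr (_ - _ *: _); ring.
Qed.

Definition mx_twist (p : bool) (X : 'M[K]_N) := if p then mx_par X else X.

Lemma scommEl (p : bool) X Y :
  mx_par X = (-1) ^+ p *: X -> scomm X Y = X *m Y - mx_twist p Y *m X.
Proof.
move=> hX; apply/matrixP=> i l; rewrite !mxE -sumrB.
apply: eq_bigr => j _; congr (_ - _).
have /matrixP/(_ j l) := hX; rewrite !mxE => /signb_eq eX.
have [el|/eX ->] := eqVneq (pr j (+) pr l) p; last by rewrite !mulr0.
by rewrite mulrA el andbC; case: (p); rewrite ?mxE ?mul1r.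
Qed.

Lemma scomm_jacobi (p q : bool) X Y Z :
  mx_par X = (-1) ^+ p *: X -> mx_par Y = (-1) ^+ q *: Y ->
  scomm X (scomm Y Z) =
  scomm (scomm X Y) Z + (-1) ^+ (p && q) *: scomm Y (scomm X Z).
Proof.
move=> hX hY; rewrite (scommEl Z (mx_par_scomm_homog hX hY)) (scommE hX hY).
rewrite !(scommEl _ hX) !(scommEl _ hY).
have twB r (U W : 'M[K]_N) : mx_twist r (U - W) = mx_twist r U - mx_twist r W.
  by case: r => //=; rewrite linearB.
have twM r (U W : 'M[K]_N) : mx_twist r (U *m W) = mx_twist r U *m mx_twist r W.
  by case: r => //=; rewrite mx_parM.
have twD r r' (U : 'M[K]_N) : mx_twist r (mx_twist r' U) = mx_twist (r (+) r') U.
  by case: r r' => [] [] //=; rewrite mx_parK.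
have twX r : mx_twist r X = (-1) ^+ (r && p) *: X.
  by case: r => //=; rewrite scale1r.
have twY r : mx_twist r Y = (-1) ^+ (r && q) *: Y.
  by case: r => //=; rewrite scale1r.
rewrite !twB !twM !twD twX twY [q (+) p]addbC [q && p]andbC.
move: (mx_twist (p (+) q) Z) (mx_twist p Z) (mx_twist q Z) => Z0 Z1 Z2.
rewrite !mulmxBl !mulmxBr -!scalemxAl -!scalemxAr -!scalemxAl !mulmxA.
rewrite !scalerBr !scalerA -!signr_addb !addbb !expr0 !scale1r.
move: (X *m Y *m Z) (X *m Z2 *m Y) (Y *m Z1 *m X) (Z0 *m Y *m X) (Y *m X *m Z)
  (Z0 *m X *m Y) => A1 A2 A3 A4 A5 A6.
by apply/matrixP=> i j; rewrite !mxE; ring.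
Qed.

End SuperCommutator.

Section Osp.
Variables (K : numFieldType) (M n : nat).

Local Notation N := (M + 2 * n)%N.
Implicit Types X Y : 'M[K]_N.

(* Indices start at 0: the even basis vectors are those with n <= i < M + n,
   and i' is rev_ord i. *)
Definition par (i : 'I_N) : bool := ~~ (n <= i < M + n)%N.

Definition eps (i : 'I_N) : K := if (i < M + n)%N then 1 else -1.

Definition osp_sign (i j : 'I_N) : K :=
  (-1) ^+ (par j * (par i + par j))%N * eps i * eps j.

Definition Fmx (i j : 'I_N) : 'M[K]_N :=
  delta_mx i j - osp_sign i j *: delta_mx (rev_ord j) (rev_ord i).

Definition osp_space : {vspace 'M[K]_N} :=
  <<[seq Fmx ij.1 ij.2 | ij : 'I_N * 'I_N]>>%VS.

Lemma Fmx_mem i j : Fmx i j \in osp_space.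
Proof. by apply: memv_span; apply: (map_f _ (mem_enum _ (i, j))). Qed.

(* The map e_ij |-> (-1)^{|j|(|i|+|j|)} eps_i eps_j e_j'i'; osp is its
   eigenspace of eigenvalue -1. *)
Definition theta X : 'M[K]_N :=
  \matrix_(a, b) (osp_sign (rev_ord b) (rev_ord a) * X (rev_ord b) (rev_ord a)).

Lemma par_rev i : par (rev_ord i) = par i.
Proof. by rewrite /par /=; case: i => i /= hi; congr negb; lia. Qed.

Lemma eps_rev i : eps (rev_ord i) = (-1) ^+ par i * eps i.
Proof.
rewrite /eps /par /=; case: i => i /= hi.
case: (ltnP i n) => h1; case: (ltnP i (M + n)) => h2 /=;
  case: (ltnP (M + 2 * n - i.+1) (M + n)) => h3;
  rewrite ?expr0 ?expr1 ?mul1r ?mulN1r ?opprK //; exfalso; lia.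
Qed.

Lemma sqr_eps i : eps i * eps i = 1.
Proof. by rewrite /eps; case: ifP; rewrite ?mulrNN mul1r. Qed.

Lemma osp_sign_rev i j :
  osp_sign i j * osp_sign (rev_ord j) (rev_ord i) = 1.
Proof.
rewrite /osp_sign !eps_rev !par_rev.
have := sqr_eps i; have := sqr_eps j.
move: (eps i) (eps j) => a b hb ha.
transitivity ((a * a) * (b * b)); last by rewrite ha hb mul1r.
by case: (par i) (par j) => [] [] /=; ring.
Qed.

Lemma osp_sign_comp i j l :
  osp_sign i j * osp_sign j l =
  (-1) ^+ ((par i (+) par j) && (par j (+) par l)) * osp_sign i l.
Proof.
rewrite /osp_sign.
have := sqr_eps j.
move: (eps i) (eps j) (eps l) => a b c hb.
rewrite -[RHS]mul1r -[X in _ = X * _]hb.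
by case: (par i) (par j) (par l) => [] [] [] /=; ring.
Qed.

Lemma theta_is_linear : linear theta.
Proof. by move=> a X Y; apply/matrixP=> i j; rewrite !mxE mulrDr mulrCA. Qed.

HB.instance Definition _ :=
  GRing.isLinear.Build K 'M[K]_N 'M[K]_N _ theta theta_is_linear.

Lemma thetaK : involutive theta.
Proof.
move=> X; apply/matrixP=> i j; rewrite !mxE !rev_ordK mulrA.
rewrite [X in X * _]mulrC; have := osp_sign_rev i j => ->.
by rewrite mul1r.
Qed.

Lemma theta_delta i j :
  theta (delta_mx i j) = osp_sign i j *: delta_mx (rev_ord j) (rev_ord i).
Proof.
apply/matrixP=> a b; rewrite !mxE.
rewrite -(inj_eq rev_ord_inj _ i) -(inj_eq rev_ord_inj _ j) !rev_ordK andbC.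
by case: andP => [[/eqP-> /eqP->]|]; rewrite ?rev_ordK ?mulr0.
Qed.

Lemma osp_spaceP X : reflect (theta X = - X) (X \in osp_space).
Proof.
apply: (iffP idP) => [hX|hX].
  apply/eqP; rewrite -subr_eq0 opprK.
  rewrite (coord_span hX) linear_sum /= -big_split big1 //= => k _.
  rewrite linearZ -scalerDr /=.
  set f := _`_k; suff -> : theta f = - f by rewrite addNr scaler0.
  have /mapP[[i j] _ ->] : f \in [seq Fmx ij.1 ij.2 | ij : 'I_N * 'I_N].
    by apply: mem_nth; rewrite size_tuple.
  by rewrite /Fmx /= -theta_delta linearB /= thetaK opprB.
have -> : X = 2^-1 *: \sum_i \sum_j X i j *: Fmx i j.
  have -> : \sum_i \sum_j X i j *: Fmx i j = X *+ 2; last first.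
    by rewrite -scaler_nat scalerA mulVf ?pnatr_eq0 // scale1r.
  rewrite mulr2n -{3}[X]opprK -hX {2 3}[X]matrix_sum_delta.
  rewrite linear_sum -sumrB; apply: eq_bigr => i _.
  rewrite linear_sum -sumrB; apply: eq_bigr => j _.
  by rewrite linearZ /= theta_delta scalerBr.
apply: memvZ; apply: memv_suml => i _; apply: memv_suml => j _.
by apply: memvZ; exact: Fmx_mem.
Qed.

Lemma mx_par_osp X : X \in osp_space -> mx_par par X \in osp_space.
Proof.
move=> /osp_spaceP hX; apply/osp_spaceP.
rewrite -linearN -hX; apply/matrixP=> i j; rewrite !mxE !par_rev addbC.
by rewrite mulrCA.
Qed.

Lemma scomm_osp X Y :
  X \in osp_space -> Y \in osp_space -> scomm par X Y \in osp_space.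
Proof.
move=> /osp_spaceP hX /osp_spaceP hY; apply/osp_spaceP.
suff -> : theta (scomm par X Y) = - scomm par (theta X) (theta Y).
  congr (- _); apply/matrixP=> i l; rewrite !mxE; apply: eq_bigr => j _.
  by rewrite hX hY !mxE !mulrNN.
apply/matrixP=> i l; rewrite !mxE mulr_sumr -sumrN.
rewrite (reindex_inj rev_ord_inj) /=; apply: eq_bigr => j _.
rewrite !mxE.
have := osp_sign_comp (rev_ord l) (rev_ord j) (rev_ord i).
rewrite !par_rev.
move: (osp_sign (rev_ord l) (rev_ord j)) (osp_sign (rev_ord j) (rev_ord i))
  (osp_sign (rev_ord l) (rev_ord i)) => s1 s2 s3 e.
have {}e : s2 * s1 = (-1) ^+ ((par l (+) par j) && (par j (+) par i)) * s3.
  by rewrite mulrC.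
move: (X _ _) (X _ _) (Y _ _) (Y _ _) => x1 x2 y1 y2.
have acc a b : (s2 * a) * (s1 * b) =
    (-1) ^+ ((par l (+) par j) && (par j (+) par i)) * s3 * (a * b).
  by rewrite mulrACA e.
rewrite !acc; clear acc e.
by case: (par i) (par j) (par l) => [] [] []; rewrite /=; ring.
Qed.

Definition osp : Type := subvs_of osp_space.

HB.instance Definition _ := GRing.Lmodule.on osp.

Implicit Types x y z : osp.

Definition osp_par x : osp := Subvs (mx_par_osp (valP x)).
Definition osp_br x y : osp := Subvs (scomm_osp (valP x) (valP y)).

Lemma osp_par_val p x :
  osp_par x = (-1) ^+ p *: x -> mx_par par (val x) = (-1) ^+ p *: val x.
Proof. by move=> /(congr1 val). Qed.

Lemma osp_par_linear a x y : osp_par (a *: x + y) = a *: osp_par x + osp_par y.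
Proof. by apply: val_inj; exact: mx_par_is_linear. Qed.

Lemma osp_parK : involutive osp_par.
Proof. by move=> x; apply: val_inj; exact: mx_parK. Qed.

Lemma osp_par_br x y : osp_par (osp_br x y) = osp_br (osp_par x) (osp_par y).
Proof. by apply: val_inj; exact: mx_par_scomm. Qed.

Lemma osp_br_linearl a x y z :
  osp_br (a *: x + y) z = a *: osp_br x z + osp_br y z.
Proof. by apply: val_inj; exact: scomm_linearl. Qed.

Lemma osp_br_linearr a x y z :
  osp_br x (a *: y + z) = a *: osp_br x y + osp_br x z.
Proof. by apply: val_inj; exact: scomm_linearr. Qed.

Lemma osp_br_anti (p q : bool) x y :
  osp_par x = (-1) ^+ p *: x -> osp_par y = (-1) ^+ q *: y ->
  osp_br x y = - ((-1) ^+ (p && q) *: osp_br y x).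
Proof.
by move=> /osp_par_val hx /osp_par_val hy; apply: val_inj; exact: scomm_anti.
Qed.

Lemma osp_br_jacobi (p q : bool) x y z :
  osp_par x = (-1) ^+ p *: x -> osp_par y = (-1) ^+ q *: y ->
  osp_br x (osp_br y z) =
  osp_br (osp_br x y) z + (-1) ^+ (p && q) *: osp_br y (osp_br x z).
Proof.
by move=> /osp_par_val hx /osp_par_val hy; apply: val_inj; exact: scomm_jacobi.
Qed.

HB.instance Definition _ := Lmodule_isLieSuperalgebra.Build K osp
  osp_par_linear osp_parK osp_par_br osp_br_linearl osp_br_linearr
  osp_br_anti osp_br_jacobi.

Definition Fgen (i j : 'I_N) : osp := Subvs (Fmx_mem i j).

Definition Fhat : 'M[Uenv osp]_N :=
  \matrix_(i, j) ((-1) ^+ (par i * par j + par i + par j)%N * uin (Fgen i j)).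

Definition str_Fhat_exp (k : nat) : Uenv osp :=
  tens_str par (tens_exp par Fhat k).

End Osp.

(* Main.v *)
(* The symbol of a central element, restricted to the Cartan subalgebra, is a
   polynomial in coordinates v_a, a < n + m, where a < n are the coordinates of the
   symplectic part. Even roots make it invariant under the Weyl group, that is,
   under sign changes and under permutations inside the two groups of
   coordinates; an isotropic odd root makes its restriction to v_a = v_b
   (a < n <= b) independent of the common value. So the symbol is a supersymmetric
   polynomial in the squares v_a^2, hence a polynomial in the power sums
   \sum_a (-1)^[a < n] v_a^(2k), which up to a scalar are the symbols of the
   Str F^(2k). Subtracting the corresponding polynomial in the Str F^(2k) leaves a
   central element whose symbol vanishes on the Cartan subalgebra; by invariance
   the symbol is zero and the degree drops.

   Symbols are defined without the Poincare-Birkhoff-Witt theorem: composing the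
   comultiplication of U with the vector representation on one factor gives
   operators on U which lower the degree, and the symbol of an element of degree d
   is obtained from d of them followed by the augmentation.

   A supersymmetric polynomial in x_i and y_j is a polynomial in power sums by
   induction on the number of the x_i. Putting x_i = y_j = 0 removes one pair, and
   what vanishes there is \prod (x_i - y_j) times a polynomial c symmetric in the
   x_i and in the y_j. Such products are reached from the sums
   \sum_i x_i^k \prod_j (x_i - y_j) / \prod_(l != i) (x_i - x_l), which are
   coefficients of \prod_j (1 - y_j t) / \prod_i (1 - x_i t). *)

Require Import Defs.
From HB Require Import structures.
From mathcomp Require Import all_boot all_order fingroup perm all_algebra.
From mathcomp Require Import reals complex finmap ring zify boolp.
From mathcomp.multinomials Require monalg.
From mathcomp.multinomials Require Import mpoly.

Set Implicit Arguments.
Unset Strict Implicit.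
Unset Printing Implicit Defensive.

Import Order.TTheory GRing.Theory Num.Theory.

Local Open Scope ring_scope.

(** * The enveloping superalgebra *)

(** Without the Poincare-Birkhoff-Witt theorem the symbol has no known graded algebra to live in.
    All that is needed is that an element of degree d with vanishing symbol has degree below d. This
    follows from Euler's identity, because characteristic 0 allows division by d. The Weyl group
    itself never acts. All invariance comes from one fact, [ueps_uad]: the augmentation kills every
    adjoint image. Moving the adjoint action through a word of contractions of a central element
    gives linear relations between the values of such words. Suitable words yield the reflections,
    the independence along isotropic roots, and the determination of the symbol by its restriction
    to the Cartan subalgebra. That M is odd enters through the sign changes. For an orthogonal
    coordinate the sign change is the reflection in a short root, which joins the coordinate to the
    middle index; without a middle index the reflections change these signs only in pairs. *)

Section FreeInduction.
Import monalg.
Variables (K : comNzRingType) (I : choiceType).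

Lemma freeAlg_ind (P : freeAlg K I -> Prop) :
  P 1 -> (forall a x y, P x -> P y -> P (a *: x + y)) ->
  (forall i t, P t -> P (fgen i * t)) -> forall t, P t.
Proof.
move=> P1 Plin Pgen t.
have P0 : P 0 by rewrite -[0](subrr (1 : freeAlg K I)) -scaleN1r addrC; apply: Plin.
have Pw (s : seq I) : P << FMonom s >>.
  elim: s => [|i s IHs].
    suff -> : << FMonom [::] >> = 1 :> freeAlg K I by [].
    by rewrite -fmoneE.
  suff -> : << FMonom (i :: s) >> = fgen i * << FMonom s >> :> freeAlg K I.
    exact: Pgen.
  rewrite fgen.unlock malgME !monalg.msuppU oner_eq0 !big_seq_fset1 !monalg.mcoeffUU mul1r.
  by congr << _ >>; apply/val_inj; rewrite /= fmM fmuE.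
rewrite [t]monalgE; elim/big_rec: _ => // w x _ Px.
have -> : << monalg.mcoeff w t *g w >> = monalg.mcoeff w t *: << w >> :> freeAlg K I.
  by rewrite malg_scaleU mulr1.
by apply: Plin => //; case: w.
Qed.

End FreeInduction.

Section EnvelopingFacts.
Variables (K : numFieldType) (L : lieSuperalgType K).
Local Notation U := (Uenv L).
Implicit Types (u v : U) (x y : L) (p q : bool).

Lemma uin_linear a x y : uin (a *: x + y) = a *: uin x + uin y :> U.
Proof. by case: (uin_enveloping L) => h _; exact: h. Qed.

HB.instance Definition _ := GRing.isLinear.Build K L U _ (@uin K L) uin_linear.

Lemma uin_br p q x y : Defs.homog p x -> Defs.homog q y ->
  uin x * uin y = (-1) ^+ (p && q) *: (uin y * uin x) + uin (lbr x y) :> U.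
Proof.
by case: (uin_enveloping L) => _ h hx hy; rewrite -(h p q) // addrC subrK.
Qed.

HB.instance Definition _ := GRing.isLinear.Build K L L _ (@lpar K L) (@lpar_linear K L).

Lemma homog_decomp x : exists x0 x1 : L, [/\ Defs.homog false x0, Defs.homog true x1 & x = x0 + x1].
Proof.
exists (2^-1 *: (x + lpar x)), (2^-1 *: (x - lpar x)); split.
- by rewrite /Defs.homog expr0 scale1r linearZ linearD /= lparK addrC.
- by rewrite /Defs.homog linearZ linearB /= lparK expr1 scaleN1r -scalerN opprB.
- rewrite -scalerDr addrACA subrr addr0 -mulr2n -scaler_nat scalerA mulVf ?scale1r //.
  by rewrite pnatr_eq0.
Qed.

Lemma Uenv_ind (P : U -> Prop) :
  P 1 -> (forall a u v, P u -> P v -> P (a *: u + v)) ->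
  (forall p x u, Defs.homog p x -> P u -> P (uin x * u)) -> forall u, P u.
Proof.
move=> P1 Plin Pgen u; rewrite -(upi_repr u); move: (generic_quotient.repr u).
apply: freeAlg_ind => [|a x y hx hy|x t ht].
- by rewrite rmorph1.
- by rewrite linearP; exact: Plin.
- have [x0 [x1 [h0 h1 ->]]] := homog_decomp x.
  have -> : upi (fgen (x0 + x1) * t) = uin (x0 + x1) * upi t.
    by rewrite rmorphM uin.unlock.
  rewrite raddfD mulrDl -[uin x0 * _]scale1r; by apply: Plin; [exact: Pgen h0 ht|exact: Pgen h1 ht].
Qed.

HB.instance Definition _ := GRing.isLinear.Build K U U _ (@upar K L) (@upar_linear K L).

Lemma uparK : involutive (@upar K L).
Proof.
apply: Uenv_ind => [|a u v hu hv|p x u _ hu].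
- by rewrite !upar1.
- by rewrite !upar_linear hu hv.
- by rewrite !uparM hu !upar_uin lparK.
Qed.

Lemma utwist_linear p : linear (@utwist K L p).
Proof. by case: p => // a u v; rewrite /= linearP. Qed.

HB.instance Definition _ p := GRing.isLinear.Build K U U _ (@utwist K L p) (@utwist_linear p).

Lemma utwist1 p : utwist p 1 = 1 :> U.
Proof. by case: p => //=; exact: upar1. Qed.

Lemma utwistM p u v : utwist p (u * v) = utwist p u * utwist p v.
Proof. by case: p => //=; exact: uparM. Qed.

Lemma utwist_comp p q u : utwist p (utwist q u) = utwist (p (+) q) u.
Proof. by case: p q => [] [] //=; rewrite uparK. Qed.

Lemma utwist_uin p q x : Defs.homog q x ->
  utwist p (uin x) = (-1) ^+ (p && q) *: uin x :> U.
Proof.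
by case: p => /= [hx|_]; rewrite ?scale1r // upar_uin hx linearZ.
Qed.

Definition ueps : U -> K := @ulift K L K^o (fun=> 0).

Lemma ueps_env : @enveloping_map K L K^o (fun=> 0).
Proof. by split=> *; rewrite ?scaler0 ?addr0 ?mul0r ?scaler0 ?subr0. Qed.

Lemma ueps_linear : linear_for *%R ueps.
Proof. by move=> a u v; exact: (ulift_linear _ _ _ ueps_env). Qed.

HB.instance Definition _ := GRing.isLinear.Build K U K *%R ueps ueps_linear.

Lemma ueps1 : ueps 1 = 1.
Proof. exact: (ulift1 ueps_env). Qed.

Lemma uepsM u v : ueps (u * v) = ueps u * ueps v.
Proof. exact: (uliftM _ _ ueps_env). Qed.

Lemma ueps_uin x : ueps (uin x) = 0.
Proof. exact: (ulift_uin _ ueps_env). Qed.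

Lemma ueps_uad p x u : ueps (uad p x u) = 0.
Proof. by rewrite /uad linearB /= !uepsM !ueps_uin mul0r mulr0 subrr. Qed.

Lemma uad_linear p x : linear (uad p x : U -> U).
Proof.
move=> a u v; rewrite /uad linearP mulrDr mulrDl -scalerAr -scalerAl scalerBr.
by rewrite opprD addrACA.
Qed.

HB.instance Definition _ p x := GRing.isLinear.Build K U U _ (uad p x) (@uad_linear p x).

Lemma uad1 p x : uad p x 1 = 0 :> U.
Proof. by rewrite /uad utwist1 mul1r mulr1 subrr. Qed.

Lemma uadM p x u v : uad p x (u * v) = uad p x u * v + utwist p u * uad p x v.
Proof.
rewrite /uad utwistM mulrBl mulrBr !mulrA [RHS]addrA; congr (_ - _).
by rewrite subrK.
Qed.

Lemma uad_utwist p q x u : Defs.homog p x ->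
  uad p x (utwist q u) = (-1) ^+ (p && q) *: utwist q (uad p x u).
Proof.
move=> hx; rewrite /uad linearB /= !utwistM (utwist_uin _ hx) [q && p]andbC.
rewrite -scalerAr -scalerAl -scalerBr scalerA -expr2 sqrr_sign scale1r.
by rewrite !utwist_comp addbC.
Qed.

Lemma lbrZl a x y : lbr (a *: x) y = a *: lbr x y :> L.
Proof.
have l0 : lbr 0 y = 0 :> L.
  have := lbr_linearl 1 0 0 y; rewrite scale1r add0r scale1r => /esym/eqP.
  by rewrite -subr_eq0 addrK => /eqP.
by rewrite -[X in lbr X]addr0 lbr_linearl l0 addr0.
Qed.

Lemma lbrZr a x y : lbr x (a *: y) = a *: lbr x y :> L.
Proof.
have l0 : lbr x 0 = 0 :> L.
  have := lbr_linearr 1 x 0 0; rewrite scale1r add0r scale1r => /esym/eqP.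
  by rewrite -subr_eq0 addrK => /eqP.
by rewrite -[X in lbr x X]addr0 lbr_linearr l0 addr0.
Qed.

Lemma homog_lbr p q x y : Defs.homog p x -> Defs.homog q y -> Defs.homog (p (+) q) (lbr x y).
Proof.
by move=> hx hy; rewrite /Defs.homog lpar_lbr hx hy lbrZl lbrZr scalerA signr_addb.
Qed.

Lemma uad_uin p q x y : Defs.homog p x -> Defs.homog q y -> uad p x (uin y) = uin (lbr x y) :> U.
Proof.
move=> hx hy; rewrite /uad (utwist_uin _ hy) (uin_br hx hy) -scalerAl.
by rewrite addrC addrA addNr add0r.
Qed.

End EnvelopingFacts.

Lemma addr_cancel3 (V : zmodType) (A B C D S T : V) :
  A + B + C + (D + S) - (A + D + (C + T)) = B + (S - T).
Proof.
rewrite (addrC A B) -!addrA; congr (B + _); rewrite !opprD !(addrCA S).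
by rewrite (addrCA D) addNKr (addrCA C) !addNKr.
Qed.

Lemma addr_cancel8 (V : zmodType) (a b c d e f g h : V) :
  a + b + c + (d + e + (f + (- b + g)) + h) = a + d + f + h + (e + g + c).
Proof.
rewrite -[RHS]addr0 -(subrr b) !addrA.
by rewrite [LHS](ACl (1*4*6*9*5*8*3*2*7)%AC).
Qed.

Lemma addr_cancel6 (V : zmodType) (a b c d e f : V) :
  a + b + c - (d + e + c + f) = a - (d + f) + (b - e).
Proof.
rewrite -[RHS]addr0 -(subrr c) !opprD !addrA.
by rewrite [LHS](ACl (1*4*7*2*5*3*6)%AC).
Qed.

(** * Contraction operators and symbols *)

Section TensorAlgebra.
Variables (K : numFieldType) (L : lieSuperalgType K) (N : nat).
Variable pr : 'I_N.+1 -> bool.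
Local Notation U := (Uenv L).

(** An alias of the matrix type that carries the parity, so that its ring structure is the
    sign-twisted product and not the product of matrices. The size is a successor to ensure that 1
    differs from 0. *)
Definition tmx of ('I_N.+1 -> bool) : Type := 'M[U]_N.+1.
Local Notation T := (tmx pr).

HB.instance Definition _ := GRing.Zmodule.on T.

Implicit Types A B C : T.

Definition tmx_mul A B : T := tens_mul pr A B.
Definition tmx_scale (a : K) A : T := \matrix_(i, j) (a *: A i j).

Lemma tmx_mulA : associative tmx_mul.
Proof.
move=> A B C; apply/matrixP=> i l; rewrite !mxE.
under eq_bigr do rewrite mxE mulr_sumr.
under [RHS]eq_bigr do rewrite mxE linear_sum mulr_suml.
rewrite exchange_big; apply: eq_bigr => j _; apply: eq_bigr => k _ /=.
rewrite utwistM utwist_comp mulrA; congr (utwist _ _ * _ * _).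
by case: (pr i) (pr j) (pr k) (pr l) => [] [] [] [].
Qed.

Lemma tmx_mul1 : left_id (1%:M : T) tmx_mul.
Proof.
move=> A; apply/matrixP=> i l; rewrite !mxE (bigD1 i) //= big1 ?addr0.
  by rewrite mxE eqxx mulr1n utwist1 mul1r.
by move=> j ji; rewrite mxE eq_sym (negPf ji) mulr0n raddf0 mul0r.
Qed.

Lemma tmx_mulr1 : right_id (1%:M : T) tmx_mul.
Proof.
move=> A; apply/matrixP=> i l; rewrite !mxE (bigD1 l) //= big1 ?addr0.
  by rewrite mxE eqxx mulr1n addbb mulr1.
by move=> j jl; rewrite mxE (negPf jl) mulr0n mulr0.
Qed.

Lemma tmx_mulDl : left_distributive tmx_mul +%R.
Proof.
move=> A B C; apply/matrixP=> i l; rewrite !mxE -big_split.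
by apply: eq_bigr => j _; rewrite mxE raddfD mulrDl.
Qed.

Lemma tmx_mulDr : right_distributive tmx_mul +%R.
Proof.
move=> A B C; apply/matrixP=> i l; rewrite !mxE -big_split.
by apply: eq_bigr => j _; rewrite mxE mulrDr.
Qed.

Lemma tmx1_neq0 : (1%:M : T) != 0.
Proof.
apply/eqP=> /matrixP/(_ ord0 ord0); rewrite !mxE eqxx mulr1n.
by apply/eqP; rewrite oner_eq0.
Qed.

HB.instance Definition _ := GRing.Zmodule_isNzRing.Build T
  tmx_mulA tmx_mul1 tmx_mulr1 tmx_mulDl tmx_mulDr tmx1_neq0.

Lemma tmx_scaleA a b A : tmx_scale a (tmx_scale b A) = tmx_scale (a * b) A.
Proof. by apply/matrixP=> i j; rewrite !mxE scalerA. Qed.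

Lemma tmx_scale1 : left_id 1 tmx_scale.
Proof. by move=> A; apply/matrixP=> i j; rewrite !mxE scale1r. Qed.

Lemma tmx_scaleDr : right_distributive tmx_scale +%R.
Proof. by move=> a A B; apply/matrixP=> i j; rewrite !mxE scalerDr. Qed.

Lemma tmx_scaleDl A : {morph tmx_scale^~ A : a b / a + b}.
Proof. by move=> a b; apply/matrixP=> i j; rewrite !mxE scalerDl. Qed.

HB.instance Definition _ := GRing.Zmodule_isLmodule.Build K T
  tmx_scaleA tmx_scale1 tmx_scaleDr tmx_scaleDl.

Lemma tmx_scaleAl (a : K) A B : a *: (A * B) = (a *: A) * B.
Proof.
apply/matrixP=> i l; rewrite !mxE scaler_sumr; apply: eq_bigr => j _.
by rewrite mxE linearZ scalerAl.
Qed.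

HB.instance Definition _ := GRing.Lmodule_isLalgebra.Build K T tmx_scaleAl.

Lemma tmx_scaleAr (a : K) A B : a *: (A * B) = A * (a *: B).
Proof.
apply/matrixP=> i l; rewrite !mxE scaler_sumr; apply: eq_bigr => j _.
by rewrite mxE scalerAr.
Qed.

HB.instance Definition _ := GRing.Lalgebra_isAlgebra.Build K T tmx_scaleAr.

End TensorAlgebra.

Section HomogeneousMatrices.
Variables (K : numFieldType) (N : nat) (pr : 'I_N -> bool).
Implicit Types a b x : 'M[K]_N.

Definition mhom (p : bool) a : Prop := mx_par pr a = (-1) ^+ p *: a.

Lemma mhom_entry p a i j : mhom p a -> pr i (+) pr j != p -> a i j = 0.
Proof. by move=> /matrixP/(_ i j); rewrite !mxE => /signb_eq h /h. Qed.

Lemma mhomP p a : (forall i j, pr i (+) pr j != p -> a i j = 0) -> mhom p a.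
Proof.
move=> h; apply/matrixP=> i j; rewrite !mxE.
by have [->//|/h->] := eqVneq (pr i (+) pr j) p; rewrite !mulr0.
Qed.

Lemma mhomM p q a b : mhom p a -> mhom q b -> mhom (p (+) q) (a *m b).
Proof.
move=> ha hb; rewrite /mhom mx_parM ha hb -scalemxAl -scalemxAr scalerA.
by rewrite signr_addb.
Qed.

Lemma mhom_scomm p q a b : mhom p a -> mhom q b -> mhom (p (+) q) (scomm pr a b).
Proof. exact: mx_par_scomm_homog. Qed.

(** This is the supertrace of [a *m x]; through it a matrix [a] acts as a linear form. *)
Definition strform a x : K := \sum_i \sum_l (-1) ^+ pr l * a l i * x i l.

Lemma strform_neq p q a x : mhom p a -> mhom q x -> p != q -> strform a x = 0.
Proof.
move=> ha hx pq; rewrite /strform big1 // => i _; rewrite big1 // => l _.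
have [e|/(mhom_entry hx)->] := eqVneq (pr i (+) pr l) q; last by rewrite mulr0.
by rewrite (mhom_entry ha) ?mulr0 ?mul0r // addbC e eq_sym.
Qed.

Lemma strformC p q a x : mhom p a -> mhom q x ->
  strform a x = (-1) ^+ (p && q) * strform x a.
Proof.
move=> ha hx; have [<-|pq] := eqVneq p q; last first.
  by rewrite (strform_neq ha hx pq) (strform_neq hx ha) ?mulr0 // eq_sym.
rewrite andbb /strform exchange_big mulr_sumr; apply: eq_bigr => l _.
rewrite mulr_sumr; apply: eq_bigr => i _.
have [e|/(mhom_entry ha)->] := eqVneq (pr l (+) pr i) p; last by rewrite !mulr0 mul0r.
by rewrite -e; case: (pr l) (pr i) => [] [] /=; ring.
Qed.

Lemma scommM p q a b x : mhom p x -> mhom q a ->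
  scomm pr x (a *m b) = (-1) ^+ (p && q) *: (a *m scomm pr x b) + scomm pr x a *m b.
Proof.
move=> hx ha; rewrite !(scommEl _ hx).
have twM (z w : 'M[K]_N) : mx_twist pr p (z *m w) = mx_twist pr p z *m mx_twist pr p w.
  by case: p {hx} => //=; rewrite mx_parM.
have twa : mx_twist pr p a = (-1) ^+ (p && q) *: a.
  by case: p {hx twM} => //=; rewrite scale1r.
rewrite twM twa mulmxBl mulmxBr scalerBr !mulmxA -!scalemxAl [RHS]addrC.
by rewrite addrA subrK.
Qed.

Lemma strform_mulA a b x : strform (a *m b) x = strform a (b *m x).
Proof.
rewrite /strform exchange_big [RHS]exchange_big; apply: eq_bigr => l _ /=.
under eq_bigr do rewrite mxE mulr_sumr mulr_suml.
rewrite exchange_big; apply: eq_bigr => k _ /=.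
by rewrite mxE mulr_sumr; apply: eq_bigr => i _; rewrite !mulrA.
Qed.

Lemma strform_is_linear a : linear_for *%R (strform a).
Proof.
move=> c x y; rewrite /strform mulr_sumr -big_split; apply: eq_bigr => i _ /=.
rewrite mulr_sumr -big_split; apply: eq_bigr => l _ /=; rewrite !mxE; ring.
Qed.

HB.instance Definition _ a :=
  GRing.isLinear.Build K 'M[K]_N K *%R (strform a) (strform_is_linear a).

Lemma strform_linearl c a b x : strform (c *: a + b) x = c * strform a x + strform b x.
Proof.
rewrite /strform mulr_sumr -big_split; apply: eq_bigr => i _ /=.
rewrite mulr_sumr -big_split; apply: eq_bigr => l _ /=; rewrite !mxE; ring.
Qed.

Lemma strform_scomm p q r x a b : mhom p x -> mhom q a -> mhom r b ->
  strform (scomm pr x a) b = - (-1) ^+ (p && q) * strform a (scomm pr x b).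
Proof.
move=> hx ha hb; rewrite (scommE hx ha) (scommE hx hb) addrC -scaleNr.
rewrite strform_linearl !strform_mulA linearB linearZ /=.
rewrite (strformC hx (mhomM ha hb)) strform_mulA.
by case: (p) (q) (r) => [] [] []; rewrite /=; ring.
Qed.

End HomogeneousMatrices.

Section ContractionOperators.
Variables (K : numFieldType) (L : lieSuperalgType K) (N : nat).
Variable pr : 'I_N.+1 -> bool.
Local Notation U := (Uenv L).
Variable rho : {linear L -> 'M[K]_N.+1}.
Hypothesis rho_hom : forall p (x : L), Defs.homog p x -> mhom pr p (rho x).
Hypothesis rho_br : forall x y : L, rho (lbr x y) = scomm pr (rho x) (rho y).
Local Notation T := (tmx L pr).
Local Notation mhom := (mhom pr).
Local Notation strform := (strform pr).
Implicit Types (a b : 'M[K]_N.+1) (u v : U) (x y : L) (p q : bool).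

(* The comultiplication of U(L) followed by rho on the first factor. *)
Definition cogen x : T := \matrix_(i, l) ((i == l)%:R *: uin x + (rho x i l)%:A).

Lemma cogen_mul x (A : T) i l :
  (cogen x * A) i l = utwist (pr i (+) pr l) (uin x) * A i l
    + \sum_j rho x i j *: A j l.
Proof.
rewrite mxE; under eq_bigr => j _.
  rewrite mxE linearD !linearZ /= utwist1 mulrDl -!scalerAl mul1r.
over.
rewrite big_split /=; congr (_ + _).
rewrite (bigD1 i) //= eqxx scale1r big1 ?addr0 // => j ji.
by rewrite eq_sym (negPf ji) scale0r.
Qed.

Lemma cogen_enveloping : enveloping_map cogen.
Proof.
split=> [a x y|p q x y hx hy].
  apply/matrixP=> i l; rewrite !mxE !linearP /= !mxE.
  by rewrite scalerDl !scalerA [_%:R * a]mulrC addrACA.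
apply/matrixP=> i l; rewrite mxE [X in _ + X]mxE [X in _ - X]mxE !cogen_mul.
rewrite [RHS]mxE [X in _ + X%:A](_ : _ = (rho x *m rho y) i l
   - (-1) ^+ (p && q) * (rho y *m rho x) i l); last first.
  by rewrite rho_br (scommE (rho_hom hx) (rho_hom hy)) !mxE.
under eq_bigr do rewrite mxE scalerDr !scalerA.
under [X in _ - _ *: (_ + X)]eq_bigr do rewrite mxE scalerDr !scalerA.
rewrite !big_split /= -!scaler_suml.
have sumd (m : 'M[K]_N.+1) (w : U) : (\sum_j m i j * (j == l)%:R) *: w = m i l *: w.
  congr (_ *: _); rewrite (bigD1 l) //= eqxx mulr1 big1 ?addr0 // => j /negPf->.
  by rewrite mulr0.
rewrite !sumd !mxE !mulrDr -!scalerAr !mulr1.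
(* An entry of [rho w] is nonzero only at a position of the parity of [w], so the twist by the
   position is a constant sign. *)
have tw (z w : L) r s : Defs.homog r z -> Defs.homog s w ->
    rho w i l *: utwist (pr i (+) pr l) (uin z) = (-1) ^+ (r && s) * rho w i l *: (uin z : U).
  move=> hz hw; have [->|ne] := eqVneq (pr i (+) pr l) s.
    by rewrite (utwist_uin _ hz) scalerA mulrC andbC.
  by rewrite (mhom_entry (rho_hom hw) ne) mulr0 !scale0r.
rewrite (tw x y p q) // (tw y x q p) // [q && p]andbC.
have twd (z w : U) : (i == l)%:R *: (utwist (pr i (+) pr l) z * w) = (i == l)%:R *: (z * w).
  by case: (eqVneq i l) => [->|]; rewrite ?addbb ?scale0r.
rewrite !twd (uin_br hx hy).
rewrite scalerBl -scalerA !scalerDr !scalerA mulrA -signr_addb addbb mul1r.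
by rewrite [_ * (-1) ^+ _]mulrC addr_cancel3.
Qed.

Definition comul u : T := ulift cogen u.

Lemma comul_linear : linear comul.
Proof. by move=> a u v; exact: (ulift_linear _ _ _ cogen_enveloping). Qed.

HB.instance Definition _ := GRing.isLinear.Build K U T _ comul comul_linear.

Lemma comul1 : comul 1 = 1.
Proof. exact: (ulift1 cogen_enveloping). Qed.

Lemma comulM u v : comul (u * v) = comul u * comul v.
Proof. exact: (uliftM _ _ cogen_enveloping). Qed.

Lemma comul_uin x : comul (uin x) = cogen x.
Proof. exact: (ulift_uin _ cogen_enveloping). Qed.

(* On symbols, [contr a] is the derivative in the direction of [a], where
   matrices act as linear forms through the supertrace form. *)
Definition contr a u : U :=
  \sum_i \sum_l ((-1) ^+ pr l * a l i) *: (comul u i l - (i == l)%:R *: u).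

Lemma contr_linear a : linear (contr a).
Proof.
move=> c u v; rewrite /contr scaler_sumr -big_split; apply: eq_bigr => i _ /=.
rewrite scaler_sumr -big_split; apply: eq_bigr => l _ /=.
rewrite linearP !mxE (scalerA c) [c * _]mulrC -(scalerA _ c) -scalerDr; congr (_ *: _).
by rewrite scalerDr opprD addrACA scalerBr !scalerA [c * _]mulrC.
Qed.

HB.instance Definition _ a := GRing.isLinear.Build K U U _ (contr a) (contr_linear a).

Lemma contr_linearl c a b u : contr (c *: a + b) u = c *: contr a u + contr b u.
Proof.
rewrite /contr scaler_sumr -big_split; apply: eq_bigr => i _ /=.
rewrite scaler_sumr -big_split; apply: eq_bigr => l _ /=.
by rewrite !mxE mulrDr scalerDl mulrCA scalerA.
Qed.

Lemma contr1 a : contr a 1 = 0.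
Proof.
rewrite /contr comul1 big1 // => i _; rewrite big1 // => l _.
by rewrite mxE scaler_nat subrr scaler0.
Qed.

(** The linear form is applied to [cogen x * comul u]. The first and the last term are those of a
    superderivation sending [x] to [strform a (rho x)]. The middle term comes from [rho x] acting on
    the first factor of [comul u]; it has lower degree, so [contr a] is a derivation on symbols
    only. *)
Lemma contr_uinM p q a x u : mhom q a -> Defs.homog p x ->
  contr a (uin x * u) = (-1) ^+ (p && q) *: (uin x * contr a u)
    + contr (a *m rho x) u + strform a (rho x) *: u.
Proof.
move=> ha hx; rewrite /contr /strform mulr_sumr scaler_sumr.
transitivity (\sum_i (\sum_l (-1) ^+ (p && q) *: (uin x * (((-1) ^+ pr l * a l i) *: (comul u i l - (i == l)%:R *: u)))
  + \sum_l \sum_j ((-1) ^+ pr l * a l i * rho x i j) *: (comul u j l - (j == l)%:R *: u)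
  + (\sum_l (-1) ^+ pr l * a l i * rho x i l) *: u)).
  apply: eq_bigr => i _; rewrite scaler_suml -!big_split; apply: eq_bigr => l _ /=.
  rewrite comulM comul_uin cogen_mul.
  have [e|ne] := eqVneq (pr l (+) pr i) q; last first.
    rewrite (mhom_entry ha ne) mulr0 mul0r !scale0r mulr0 scaler0 add0r addr0.
    by rewrite big1 // => j _; rewrite mul0r scale0r.
  rewrite [pr i (+) _]addbC e (utwist_uin _ hx) [q && p]andbC.
  have -> : \sum_j ((-1) ^+ pr l * a l i * rho x i j) *: (comul u j l - (j == l)%:R *: u)
     = ((-1) ^+ pr l * a l i) *: (\sum_j rho x i j *: comul u j l - rho x i l *: u).
    under eq_bigr do rewrite -scalerA scalerBr scalerA.
    rewrite -scaler_sumr sumrB -scaler_suml; congr (_ *: (_ - _ *: _)).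
    by rewrite (bigD1 l) //= eqxx mulr1 big1 ?addr0 // => j /negPf->; rewrite mulr0.
  move: ((-1) ^+ pr l * a l i) => c.
  have -> z : uin x * (c *: z) = c *: (uin x * z) by rewrite -scalerAr.
  have -> z : (-1) ^+ (p && q) *: (c *: z) = c *: ((-1) ^+ (p && q) *: z) :> U.
    by rewrite !scalerA mulrC.
  rewrite -[(c * _) *: u]scalerA -!scalerDr.
  congr (_ *: _); rewrite -[RHS]addrA subrK mulrBr scalerBr -scalerAl addrAC; congr (_ - _ + _).
  case: (eqVneq i l) e => [->|]; rewrite ?scale0r ?mulr0 ?scaler0 //.
  by rewrite addbb scale1r => <-; rewrite andbF expr0 scale1r scale1r.
rewrite !big_split /= -scaler_suml; congr (_ + _ + _).
  by apply: eq_bigr => i _; rewrite mulr_sumr scaler_sumr.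
rewrite exchange_big; under eq_bigr do rewrite exchange_big.
rewrite exchange_big /=; apply: eq_bigr => j _.
apply: eq_bigr => l _; rewrite -scaler_suml; congr (_ *: _).
by rewrite mxE mulr_sumr; apply: eq_bigr => i _; rewrite mulrA.
Qed.

(** Contractions supercommute exactly and not only on symbols: they are convolutions with linear
    forms on U(L), whose comultiplication is cocommutative. The induction checks this on
    generators. *)
Lemma contrC q r a b u : mhom q a -> mhom r b ->
  contr a (contr b u) = (-1) ^+ (q && r) *: contr b (contr a u).
Proof.
move=> ha hb; move: u q r a b ha hb; apply: Uenv_ind => [q r a b _ _||p x u hx IH q r a b ha hb].
- by rewrite !contr1 !linear0.
- by move=> c u v hu hv q r a b ha hb; rewrite !linearP /= (hu q r) // (hv q r) // scalerDr !scalerA [c * _]mulrC.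
have hX := rho_hom hx.
rewrite (contr_uinM _ hb hx) (contr_uinM _ ha hx) !linearD !linearZ /=.
rewrite (contr_uinM _ ha hx) (contr_uinM _ hb hx) (IH q r) //.
rewrite (IH _ _ _ _ (mhomM ha hX) hb) (IH _ _ _ _ ha (mhomM hb hX)).
have ea : (-1) ^+ (p && r) * strform a (rho x) = strform a (rho x) * (-1) ^+ (q && r).
  by have [->|ne] := eqVneq p q; [rewrite mulrC|rewrite (strform_neq ha hX) 1?eq_sym // mulr0 mul0r].
have eb : (-1) ^+ (p && q) * (-1) ^+ (q && r) * strform b (rho x) = strform b (rho x).
  have [->|ne] := eqVneq p r; last by rewrite (strform_neq hb hX) 1?eq_sym // !mulr0.
  by rewrite andbC -expr2 sqrr_sign mul1r.
rewrite -!scalerAr !scalerDr !scalerA ea eb.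
have -> : (-1) ^+ (p && r) * (-1) ^+ ((q (+) p) && r) = (-1) ^+ (q && r) :> K.
  by case: (p) (q) (r) => [] [] []; rewrite /=; ring.
have -> : (-1) ^+ (q && (r (+) p)) = (-1) ^+ (p && q) * (-1) ^+ (q && r) :> K.
  by case: (p) (q) (r) => [] [] []; rewrite /=; ring.
have -> : (-1) ^+ (p && r) * (-1) ^+ (p && q) * (-1) ^+ (q && r) =
    (-1) ^+ (p && q) * (-1) ^+ (q && r) * (-1) ^+ (p && r) :> K by ring.
by rewrite -!addrA; congr (_ + _); rewrite addrA addrC -!addrA.
Qed.

(** The comultiplication is equivariant, so the adjoint action passes a contraction at the cost of
    the same action on the matrix. *)
Lemma contr_uad p q x a u : Defs.homog p x -> mhom q a ->
  contr a (uad p x u) =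
    (-1) ^+ (p && q) *: (uad p x (contr a u) - contr (scomm pr (rho x) a) u).
Proof.
move=> hx; move: u q a; apply: Uenv_ind => [q a ha|c u v hu hv q a ha|r y u hy IH q a ha].
- by rewrite uad1 !contr1 !linear0 addr0 scaler0.
- rewrite !linearP /= (hu q) // (hv q) //.
  by rewrite !scalerDr !scalerA [c * _]mulrC addrACA.
have [hX hY] := (rho_hom hx, rho_hom hy).
have hxy := homog_lbr hx hy.
rewrite uadM (uad_uin hx hy) (utwist_uin _ hy) -scalerAl linearD linearZ /=.
rewrite (contr_uinM _ ha hxy) (contr_uinM u ha hy) (contr_uinM (uad p x u) ha hy).
rewrite (IH _ _ ha) (IH _ _ (mhomM ha hY)).
rewrite (contr_uinM _ (mhom_scomm hX ha) hy).
have uD w1 w2 : uad p x (w1 + w2) = uad p x w1 + uad p x w2 by exact: raddfD.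
have uZ c w : uad p x (c *: w) = c *: uad p x w by exact: linearZ.
rewrite 2!uD 2!uZ uadM (uad_uin hx hy) (utwist_uin _ hy).
rewrite !rho_br (scommM _ hX ha) contr_linearl (strform_scomm hX ha hY) -scalerAl -!scalerAr.
have e8 : (-1) ^+ (p && r) * strform a (rho y) = (-1) ^+ (p && q) * strform a (rho y).
  have [->//|ne] := eqVneq q r.
  by rewrite (strform_neq ha hY) ?mulr0.
rewrite mulrBr.
move: (uad p x (contr a u)) (uad p x (contr (a *m rho y) u)) (uad p x u)
  (contr (a *m scomm pr (rho x) (rho y)) u) (contr (scomm pr (rho x) a *m rho y) u)
  (uin (lbr x y) * contr a u) (contr (scomm pr (rho x) a) u) => t4 t6 t8 t2 t9 t1 t5.
move: (uin y * t4) (uin y * t5) => {}t4 {}t5.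
rewrite !scalerBr !scalerDr !scalerN !scalerDr !scalerA e8.
case: (p) (q) (r) => [] [] []; rewrite /= ?expr0 ?expr1 ?mulrN1 ?mulN1r ?mulr1 ?mul1r ?opprK ?scaleNr ?scale1r ?opprK ?opprD ?opprK ?mul1r.
all: by rewrite ?mulNr ?mul1r ?scaleNr ?opprK addr_cancel8.
Qed.

Lemma mhom_decomp a : exists a0 a1, [/\ mhom false a0, mhom true a1 & a = a0 + a1].
Proof.
exists (2^-1 *: (a + mx_par pr a)), (2^-1 *: (a - mx_par pr a)); split.
- by rewrite /mhom expr0 scale1r linearZ linearD /= mx_parK addrC.
- by rewrite /mhom linearZ linearB /= mx_parK expr1 scaleN1r -scalerN opprB.
- rewrite -scalerDr addrACA subrr addr0 -mulr2n -scaler_nat scalerA mulVf ?scale1r //.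
  by rewrite pnatr_eq0.
Qed.

(* [Ufil d.+1] is the span of the products of at most [d] elements of [L], and
   [Ufil 0] is zero. *)
Inductive Ufil : nat -> U -> Prop :=
| Ufil_zero d : Ufil d 0
| Ufil_lin d (a : K) u v : Ufil d u -> Ufil d v -> Ufil d (a *: u + v)
| Ufil_one d : Ufil d.+1 1
| Ufil_uin d p x u : Defs.homog p x -> Ufil d u -> Ufil d.+1 (uin x * u).

Lemma Ufil0 u : Ufil 0 u -> u = 0.
Proof.
move: {-2}0%N (erefl 0%N) => d d0 h; elim: h d0 => // {}d a {}u v _ IHu _ IHv d0.
by rewrite IHu // IHv // scaler0 addr0.
Qed.

Lemma UfilD d u v : Ufil d u -> Ufil d v -> Ufil d (u + v).
Proof. by move=> hu hv; rewrite -[u]scale1r; exact: Ufil_lin. Qed.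

Lemma UfilZ d c u : Ufil d u -> Ufil d (c *: u).
Proof. by move=> hu; rewrite -[_ *: _]addr0; apply: Ufil_lin => //; exact: Ufil_zero. Qed.

Lemma UfilN d u : Ufil d u -> Ufil d (- u).
Proof. by move=> hu; rewrite -scaleN1r; exact: UfilZ. Qed.

Lemma UfilB d u v : Ufil d u -> Ufil d v -> Ufil d (u - v).
Proof. by move=> hu hv; apply: UfilD => //; exact: UfilN. Qed.

Lemma Ufil_sum d (I : Type) (r : seq I) (P : pred I) (F : I -> U) :
  (forall i, P i -> Ufil d (F i)) -> Ufil d (\sum_(i <- r | P i) F i).
Proof.
move=> hF; elim/big_rec: _ => [|i x Pi hx]; first exact: Ufil_zero.
by apply: UfilD => //; exact: hF.
Qed.

Lemma UfilS d u : Ufil d u -> Ufil d.+1 u.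
Proof.
elim=> [e|e a {}u v _ hu _ hv|e|e p x {}u hx _ hu]; first exact: Ufil_zero.
- exact: Ufil_lin.
- exact: Ufil_one.
- exact: Ufil_uin hx hu.
Qed.

Lemma Ufil_leq d e u : (d <= e)%N -> Ufil d u -> Ufil e u.
Proof.
by move=> /subnK<-; elim: (_ - _)%N => [//|k IH] /IH; exact: UfilS.
Qed.

Lemma Ufil_mulx d x u : Ufil d u -> Ufil d.+1 (uin x * u).
Proof.
move=> hu; have [x0 [x1 [h0 h1 ->]]] := homog_decomp x.
by rewrite linearD mulrDl; apply: UfilD; [exact: Ufil_uin h0 hu|exact: Ufil_uin h1 hu].
Qed.

Lemma Ufil_total u : exists d, Ufil d u.
Proof.
move: u; apply: Uenv_ind => [|a u v [d hu] [e hv]|p x u hx [d hu]].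
- by exists 1%N; exact: Ufil_one.
- exists (maxn d e); apply: Ufil_lin.
    exact: Ufil_leq (leq_maxl _ _) hu.
  exact: Ufil_leq (leq_maxr _ _) hv.
- by exists d.+1; exact: Ufil_mulx.
Qed.

(** The predecessor is due to the shifted index: degrees k - 1 and l - 1 add up to k + l - 2. *)
Lemma UfilM k l u v : Ufil k u -> Ufil l v -> Ufil (k + l).-1 (u * v).
Proof.
move=> hu hv; elim: hu => [d|d a {}u w _ hu _ hw|d|d p x {}u hx hu IH].
- by rewrite mul0r; exact: Ufil_zero.
- by rewrite mulrDl -scalerAl; exact: Ufil_lin.
- by rewrite mul1r addSn /=; apply: Ufil_leq hv; rewrite leq_addl.
- rewrite -mulrA addSn /=; case: d hu IH => [/Ufil0-> _|d _ IH].
    by rewrite mul0r mulr0; exact: Ufil_zero.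
  by rewrite addSn; exact: Ufil_mulx.
Qed.

Lemma Ufil_contr d a u : Ufil d u -> Ufil d.-1 (contr a u).
Proof.
move=> hu; elim: hu a => [e|e c {}u v _ hu _ hv|e|e p x {}u hx hu IH] a.
- by rewrite linear0; exact: Ufil_zero.
- by rewrite linearP; apply: Ufil_lin; [exact: hu|exact: hv].
- by rewrite contr1; exact: Ufil_zero.
have hom q b : mhom q b -> Ufil e (contr b (uin x * u)).
  move=> hb; rewrite (contr_uinM _ hb hx); case: e hu IH => [/Ufil0-> _|e hu IH].
    by rewrite !linear0 mulr0 scaler0 !addr0; exact: Ufil_zero.
  apply: UfilD; last exact: UfilZ.
  by apply: UfilD; [apply: UfilZ; exact: Ufil_mulx|apply: UfilS; exact: IH].
have [a0 [a1 [h0 h1 ->]]] := mhom_decomp a.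
by rewrite -[a0]scale1r contr_linearl; apply: Ufil_lin; [exact: hom h0|exact: hom h1].
Qed.

Definition contrs (s : seq 'M[K]_N.+1) u := foldr contr u s.

Lemma Ufil_contrs d s u : Ufil d u -> Ufil (d - size s) (contrs s u).
Proof.
by move=> hu; elim: s => [|a s IH] /=; rewrite ?subn0 // subnS; exact: Ufil_contr.
Qed.

(** Each contraction lowers the degree by one, and [d] of them reach [Ufil 0]. Hence on elements of
    degree d the value of d contractions depends only on the class modulo lower degree. *)
Lemma ueps_contrs d s u : Ufil d u -> size s = d -> ueps (contrs s u) = 0.
Proof.
move=> /(Ufil_contrs s) hu sd; move: hu; rewrite sd subnn => /Ufil0->.
by rewrite linear0.
Qed.

(** * Euler's identity and the drop of degree *)

Section Euler.
Variables (I : finType) (pI : I -> bool) (c : I -> K) (b : I -> L) (b' : I -> 'M[K]_N.+1).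
Hypothesis b_hom : forall i, Defs.homog (pI i) (b i).
Hypothesis b'_hom : forall i, mhom (pI i) (b' i).
Hypothesis b_dual : forall x, \sum_i (c i * strform (b' i) (rho x)) *: b i = x.

(* Euler's identity: on the part of degree [d] of the associated graded algebra,
   [euler] is multiplication by [d]. *)
Definition euler u : U := \sum_i c i *: (uin (b i) * contr (b' i) u).

Lemma euler_linear : linear euler.
Proof.
move=> a u v; rewrite /euler scaler_sumr -big_split; apply: eq_bigr => i _ /=.
by rewrite linearP mulrDr -scalerAr scalerDr !scalerA [a * _]mulrC.
Qed.

HB.instance Definition _ := GRing.isLinear.Build K U U _ euler euler_linear.

(** By [b_dual] the scalar terms of [contr_uinM] add up to [uin x * u]. What else appears, the
    brackets of [b i] with [x] and the middle terms of [contr_uinM], has lower degree. *)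
Lemma euler_uinM d p x u : Defs.homog p x -> Ufil d u ->
  Ufil d (euler (uin x * u) - (uin x * euler u + uin x * u)).
Proof.
move=> hx; case: d => [/Ufil0->|d hu]; first by rewrite mulr0 !linear0 mulr0 addr0 subrr; exact: Ufil_zero.
have e : uin x * u = \sum_i (c i * strform (b' i) (rho x)) *: (uin (b i) * u).
  rewrite -{1}(b_dual x) linear_sum mulr_suml; apply: eq_bigr => i _.
  by rewrite linearZ scalerAl.
rewrite {2}e {2}/euler mulr_sumr -big_split /euler -sumrB; apply: Ufil_sum => i _ /=.
rewrite (contr_uinM _ (b'_hom i) hx) !mulrDr !scalerDr -!scalerAr !scalerA opprD addrACA subrr addr0.
rewrite addrAC; apply: UfilD; last first.
  by apply/UfilZ/Ufil_mulx/(Ufil_contr _ hu).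
rewrite [uin (b i) * (uin x * _)]mulrA (uin_br (b_hom i) hx) mulrDl scalerDr -scalerAl.
rewrite !scalerA [p && _]andbC -mulrA -signr_addb addbb mulr1 -[_ * _ * contr _ _]mulrA.
by rewrite addrAC subrr add0r; apply/UfilZ/Ufil_mulx/(Ufil_contr _ hu).
Qed.

Lemma eulerP d u : Ufil d.+1 u -> Ufil d (euler u - d%:R *: u).
Proof.
suff gen e v : Ufil e v -> Ufil e.-1 (euler v - e.-1%:R *: v) by move/gen.
elim=> [{}e|{}e a {}v w _ hv _ hw|{}e|{}e p x {}v hx hv IH].
- by rewrite !linear0 addr0; exact: Ufil_zero.
- rewrite linearP scalerDr opprD addrACA scalerA [_ * a]mulrC -scalerA -scalerBr.
  exact: Ufil_lin.
- rewrite /euler big1 => [|i _]; last by rewrite contr1 mulr0 scaler0.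
  case: e => [|e]; first by rewrite scale0r subr0; exact: Ufil_zero.
  by rewrite sub0r; apply/UfilN/UfilZ; exact: Ufil_one.
case: e hv IH => [/Ufil0-> _|e hv IH].
  by rewrite mulr0 !linear0 addr0; exact: Ufil_zero.
have := UfilD (euler_uinM hx hv) (Ufil_mulx x IH).
congr (Ufil _ _); rewrite /= mulrBr -scalerAr -[in RHS]natr1 scalerDl scale1r.
by rewrite !opprD -addrA; congr (_ + _); rewrite addrACA addNr add0r addrC.
Qed.

(** The substitute for the Poincare-Birkhoff-Witt theorem. By induction every [contr (b' i) u] has
    lower degree than expected, hence so has [euler u], which is a nonzero integer multiple of [u]
    up to lower terms. *)
Lemma Ufil_pred d u : Ufil d.+1 u ->
  (forall s : seq I, size s = d -> ueps (contrs (map b' s) u) = 0) -> Ufil d u.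
Proof.
elim: d u => [|d IH] u hu hs.
  have /= eu := hs [::] erefl; suff -> : u = 0 by exact: Ufil_zero.
  (* [Ufil 1] consists of scalars, which the augmentation recovers. *)
  move: {hs} eu; suff [c0 ->] : exists c0, u = c0 *: 1.
    by rewrite linearZ /= ueps1 mulr1 => ->; rewrite scale0r.
  move: {-2}1%N (erefl 1%N) hu => e e1 hu.
  elim: hu e1 => [{}e|{}e a {}u v _ hu _ hv|{}e|{}e p x {}u hx hu _] e1.
  - by exists 0; rewrite scale0r.
  - have [[k ->] [l ->]] := (hu e1, hv e1); exists (a * k + l).
    by rewrite scalerDl scalerA.
  - by exists 1; rewrite scale1r.
  - by move: hu; case: e1 => -> /Ufil0->; exists 0; rewrite mulr0 scale0r.
have hE i : Ufil d (contr (b' i) u).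
  apply: IH; first exact: (Ufil_contr _ hu).
  move=> s sd; rewrite -[RHS](hs (rcons s i)) ?size_rcons ?sd //.
  by rewrite /contrs map_rcons foldr_rcons.
have hEu : Ufil d.+1 (euler u).
  by apply: Ufil_sum => i _; apply/UfilZ/Ufil_mulx.
have := UfilZ (d.+1%:R^-1) (UfilB hEu (eulerP hu)).
by rewrite opprB addrC subrK scalerA mulVf ?scale1r // pnatr_eq0.
Qed.

End Euler.

(** The defect is made of the middle terms of [contr_uinM] and has degree at most k + l - 2, one
    less than the terms compared. *)
Lemma contr_leibniz k l a u v : mhom false a -> Ufil k.+1 u -> Ufil l.+1 v ->
  Ufil (k + l).-1 (contr a (u * v) - (contr a u * v + u * contr a v)).
Proof.
move=> ha hu hv.
suff gen e w : Ufil e w -> Ufil (e.-1 + l).-1 (contr a (w * v) - (contr a w * v + w * contr a v)).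
  exact: (gen k.+1).
elim=> [{}e|{}e c {}w w' _ h _ h'|{}e|{}e p x {}w hx hw IH].
- by rewrite !(mul0r, linear0) addr0 subrr; exact: Ufil_zero.
- have := Ufil_lin c h h'; congr (Ufil _ _).
  rewrite !mulrDl -!scalerAl !linearP /= !mulrDl -!scalerAl scalerBr scalerDr.
  by rewrite addrACA -opprD; congr (_ - _); rewrite addrACA.
- by rewrite mul1r contr1 mul0r add0r mul1r subrr; exact: Ufil_zero.
case: e hw IH => [/Ufil0-> _|e hw IH].
  by rewrite mulr0 !(mul0r, linear0) addr0 subrr; exact: Ufil_zero.
rewrite -mulrA !(contr_uinM _ ha hx) andbF expr0 !scale1r !mulrDl.
rewrite -scalerAl addr_cancel6.
rewrite -!mulrA -mulrDr -mulrBr; apply: (@UfilD (e + l)%N); last first.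
  apply: UfilB.
    by have := Ufil_contr (a *m rho x) (UfilM hw hv); rewrite addSn addnS.
  by have := UfilM (Ufil_contr (a *m rho x) hw) hv; rewrite addnS.
move: IH => /=; case: (e + l)%N => [/Ufil0->|d]; last exact: Ufil_mulx.
by rewrite mulr0; exact: Ufil_zero.
Qed.

Lemma contrD a b u : contr (a + b) u = contr a u + contr b u.
Proof. by rewrite -[a]scale1r contr_linearl !scale1r. Qed.

Lemma contr0 u : contr 0 u = 0.
Proof. by have := contr_linearl (-1) 0 0 u; rewrite scaler0 add0r scaleN1r addNr. Qed.

Lemma contrZ c a u : contr (c *: a) u = c *: contr a u.
Proof. by rewrite -[c *: a]addr0 contr_linearl contr0 addr0. Qed.

Lemma contrZr c a u : contr a (c *: u) = c *: contr a u.
Proof. exact: linearZ. Qed.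

Lemma contrC_even a b u : mhom false b -> contr a (contr b u) = contr b (contr a u).
Proof.
move=> hb; have [a0 [a1 [h0 h1 ->]]] := mhom_decomp a.
rewrite !contrD linearD /= (contrC _ h0 hb) (contrC _ h1 hb) andbF.
by rewrite expr0 !scale1r.
Qed.

(** [contr_uad] solved for the adjoint action, which is thus moved inwards until it meets a central
    element. The twist replaces the sign when [a] has mixed parity. *)
Lemma uad_contr p x a u : Defs.homog p x ->
  uad p x (contr a u) =
    contr (mx_twist pr p a) (uad p x u) + contr (scomm pr (rho x) a) u.
Proof.
move=> hx.
have hom q b : mhom q b -> uad p x (contr b u) =
    contr (mx_twist pr p b) (uad p x u) + contr (scomm pr (rho x) b) u.
  move=> hb; have -> : mx_twist pr p b = (-1) ^+ (p && q) *: b.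
    by case: (p) => //=; rewrite scale1r.
  rewrite contrZ (contr_uad _ hx hb) scalerA -expr2 sqrr_sign scale1r subrK //.
have [a0 [a1 [h0 h1 ->]]] := mhom_decomp a.
have -> : mx_twist pr p (a0 + a1) = mx_twist pr p a0 + mx_twist pr p a1.
  by case: (p) => //=; rewrite linearD.
have -> : scomm pr (rho x) (a0 + a1) = scomm pr (rho x) a0 + scomm pr (rho x) a1.
  by have := scomm_linearr pr (rho x) 1 a0 a1; rewrite !scale1r.
by rewrite !contrD linearD /= (hom _ _ h0) (hom _ _ h1) addrACA.
Qed.

(** The Taylor coefficient of degree [d] in the direction [a]; the factorial makes it
    multiplicative. *)
Definition symb d a u : K := (d`!%:R)^-1 * ueps (iter d (contr a) u).

Lemma symb_linear d a : linear_for *%R (symb d a).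
Proof.
move=> c u v; rewrite /symb.
have -> : iter d (contr a) (c *: u + v) = c *: iter d (contr a) u + iter d (contr a) v.
  by elim: d => //= d ->; rewrite linearP.
by rewrite linearP /= mulrDr mulrCA.
Qed.

HB.instance Definition _ d a := GRing.isLinear.Build K U K *%R (symb d a) (symb_linear d a).

Lemma symb_contr d a u : symb d a (contr a u) = d.+1%:R * symb d.+1 a u.
Proof.
rewrite /symb factS natrM invfM -iterSr !mulrA mulfV ?mul1r //.
by rewrite pnatr_eq0.
Qed.

Lemma iter_contrs d a u : iter d (contr a) u = contrs (nseq d a) u.
Proof. by elim: d => //= d ->. Qed.

Lemma symb_Ufil d a u : Ufil d u -> symb d a u = 0.
Proof.
by move=> hu; rewrite /symb iter_contrs (ueps_contrs hu) ?mulr0 // size_nseq.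
Qed.

(** Multiplied by k + l, the left side is the symbol of one contraction of [u * v]. The Leibniz rule
    splits it into two products of smaller total degree, which contribute k and l times the right
    side. *)
Lemma symbM k l a u v : mhom false a -> Ufil k.+1 u -> Ufil l.+1 v ->
  symb (k + l) a (u * v) = symb k a u * symb l a v.
Proof.
move=> ha; move: {-1}(k + l)%N (erefl (k + l)%N) => d.
elim: d k l u v => [|d IH] k l u v dkl hu hv.
  by move: dkl; case: k hu => // hu; case: l hv => // hv _; rewrite /symb fact0 invr1 !mul1r uepsM.
have d0 : d.+1%:R != 0 :> K by rewrite pnatr_eq0.
apply: (mulfI d0); rewrite -dkl dkl -symb_contr.
have := contr_leibniz ha hu hv; rewrite dkl /= => /(symb_Ufil a).
rewrite linearB linearD /= => /eqP; rewrite subr_eq0 => /eqP ->.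
have -> : symb d a (contr a u * v) = k%:R * (symb k a u * symb l a v).
  case: k hu dkl => [|k] hu dkl.
    by have /= /Ufil0-> := Ufil_contr a hu; rewrite !mul0r linear0.
  by rewrite (IH k l) ?symb_contr ?mulrA //; [case: dkl|exact: (Ufil_contr _ hu)].
have -> : symb d a (u * contr a v) = l%:R * (symb k a u * symb l a v).
  case: l hv dkl => [|l] hv dkl.
    by have /= /Ufil0-> := Ufil_contr a hv; rewrite mulr0 mul0r linear0.
  rewrite (IH k l) ?symb_contr 1?mulrCA //; last exact: (Ufil_contr _ hv).
  by move: dkl; rewrite addnS => -[].
by rewrite -mulrDl -natrD dkl.
Qed.

(** * Relations satisfied by the symbol of a central element *)

Section Invariants.
Variables (z : U).
Hypothesis z_central : supercenter z.

Lemma uad_contrs_ker p x s : Defs.homog p x -> (forall a, a \in s -> scomm pr (rho x) a = 0) ->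
  uad p x (contrs s z) = 0.
Proof.
move=> hx; elim: s => [_|a s IH hs] /=; first exact: z_central.
rewrite (uad_contr _ _ hx) (hs a) ?inE ?eqxx // contr0 IH ?linear0 ?addr0 //.
by move=> b bs; apply: hs; rewrite inE bs orbT.
Qed.

(** The adjoint action of [x] on [contr (rho y)] of an [x]-invariant word leaves only the commutator
    term, and its augmentation is 0. *)
Lemma contr_isotropic x y s : Defs.homog true x ->
  (forall a, a \in s -> scomm pr (rho x) a = 0) ->
  ueps (contr (scomm pr (rho x) (rho y)) (contrs s z)) = 0.
Proof.
move=> hx hs; have := ueps_uad true x (contr (rho y) (contrs s z)).
by rewrite (uad_contr _ _ hx) (uad_contrs_ker hx hs) linear0 add0r.
Qed.

Section Sl2.
Variables (e f : L) (h : 'M[K]_N.+1) (lam : K).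
Hypotheses (e_even : Defs.homog false e) (f_even : Defs.homog false f).
Hypothesis ef : scomm pr (rho e) (rho f) = h.
Hypothesis eh : scomm pr (rho e) h = lam *: rho e.

Let he : mhom false (rho e) := rho_hom e_even.
Let hf : mhom false (rho f) := rho_hom f_even.
Let hh : mhom false h.
Proof. by rewrite -ef -[false](addbb false); exact: mhom_scomm. Qed.

Lemma uad_iter_contr a b k u : mhom false b ->
  scomm pr (rho e) a = b -> mhom false a ->
  uad false e (iter k (contr a) u) =
    iter k (contr a) (uad false e u) + k%:R *: contr b (iter k.-1 (contr a) u).
Proof.
move=> hb eab ha; elim: k => [|k IH]; first by rewrite scale0r addr0.
rewrite iterS (uad_contr _ _ e_even) /= IH linearD linearZ /= eab -addrA; congr (_ + _).
case: k IH => [|k] IH /=; first by rewrite scale0r scale1r add0r.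
by rewrite (contrC_even _ _ hb) -[X in _ + X]scale1r -scalerDl natr1.
Qed.

Lemma contr_iter a b k u : mhom false b ->
  contr b (iter k (contr a) u) = iter k (contr a) (contr b u).
Proof. by move=> hb; elim: k => //= k <-; rewrite (contrC_even _ _ hb). Qed.

Lemma iter_contrZ k a c u : iter k (contr a) (c *: u) = c *: iter k (contr a) u.
Proof. by elim: k => //= k ->; rewrite linearZ. Qed.

(* The coefficient of h^i e^j f^j in the symbol satisfies a recurrence which
   relates (i + 2, j) to (i, j + 1) and starts with 0 at i = 1. *)
Lemma contr_sl2 s : (forall a, a \in s -> scomm pr (rho e) a = 0) ->
  forall i j, odd i ->
  ueps (iter j (contr (rho f)) (iter j (contr (rho e)) (iter i (contr h) (contrs s z)))) = 0.
Proof.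
move=> hs; set w := contrs s z; pose c i j :=
  ueps (iter j (contr (rho f)) (iter j (contr (rho e)) (iter i (contr h) w))).
have hw : uad false e w = 0 by exact: uad_contrs_ker hs.
have ee : scomm pr (rho e) (rho e) = 0.
  by rewrite (scommE he he) expr0 scale1r subrr.
have h0 : mhom false (0 : 'M[K]_N.+1) by rewrite /mhom linear0 scaler0.
have hle : mhom false (lam *: rho e).
  by rewrite /mhom linearZ /= he expr0 !scale1r.
(* The adjoint action of [e] on the word f^(j+1) e^j h^i turns one [f] into [h], in j + 1 ways, or
   one [h] into [lam *: rho e], in i ways. The augmentation of the result is 0. *)
have step i j : j.+1%:R * c i.+1 j = - (i%:R * lam * c i.-1 j.+1).
  apply/eqP; rewrite -addr_eq0 addrC; apply/eqP.
  rewrite -[RHS](ueps_uad false e (iter j.+1 (contr (rho f))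
    (iter j (contr (rho e)) (iter i (contr h) w)))).
  rewrite (uad_iter_contr _ _ hh ef hf) (uad_iter_contr _ _ h0 ee he).
  rewrite (uad_iter_contr _ _ hle eh hh) hw contr0 scaler0 addr0.
  have -> : iter i (contr h) 0 = 0 by elim: (i) => //= k ->; rewrite linear0.
  rewrite add0r contrZ !iter_contrZ linearD !linearZ /= mulrA; congr (_ + _).
    by rewrite /c (iterSr j (contr (rho e))).
  by rewrite /c /= !(contr_iter _ _ _ hh).
move=> i j oi; rewrite -/(c i j) -(odd_double_half i) oi add1n.
elim: {i oi} (i./2) j => [|i IH] j.
  have := step 0%N j; rewrite !mul0r oppr0 => /eqP; rewrite mulf_eq0 pnatr_eq0 /=.
  by move/eqP.
have := step (i.*2.+2)%N j; rewrite /= IH mulr0 oppr0 => /eqP.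
by rewrite mulf_eq0 pnatr_eq0 => /eqP.
Qed.

(** [r] lies on the hyperplane of the reflection and [h] on the line that it negates. In the
    expansion in [t] the words with an odd number of [h] vanish by [contr_sl2] with j = 0. *)
Lemma symb_reflection d r t : scomm pr (rho e) r = 0 ->
  symb d (r + t *: h) z = symb d (r - t *: h) z.
Proof.
move=> er; rewrite /symb; congr (_ * _).
(* [s] records the factors already split off, true for [h] and false for [r]; each [h] costs one
   sign. *)
suff gen k (s : seq bool) : let ms := map (fun b : bool => if b then h else r) s in
    ueps (iter k (contr (r - t *: h)) (contrs ms z)) =
    (-1) ^+ count id s * ueps (iter k (contr (r + t *: h)) (contrs ms z)).
  by have /= := gen d [::]; rewrite expr0 mul1r => ->.
elim: k s => [|k IH] s ms.
  have [oc|ec] := boolP (odd (count id s)); last by rewrite -signr_odd (negPf ec) mul1r.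
  have [s' [hs' hsr]] : exists s', (forall a, a \in s' -> scomm pr (rho e) a = 0)
     /\ contrs ms z = iter (count id s) (contr h) (contrs s' z).
    rewrite /ms; elim: (s) => [|b s1 [s' [h1 h2]]]; first by exists [::].
    case: b; first by exists s'; split=> //=; rewrite h2.
    exists (r :: s'); split=> [a|/=]; last first.
      rewrite h2 add0n; elim: (count _ _) => //= j <-.
      by rewrite (contrC_even _ _ hh).
    by rewrite inE => /predU1P[->|/h1].
  have := contr_sl2 hs' 0 oc; rewrite /= hsr => ->; by rewrite mulr0.
have lin a (c : K) u v : iter k (contr a) (u + c *: v) =
    iter k (contr a) u + c *: iter k (contr a) v.
  by elim: (k) => //= j ->; rewrite linearD linearZ.
have em w : contr (r - t *: h) w = contr r w + (- t) *: contr h w.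
  by rewrite -scaleNr contrD contrZ.
have ep w : contr (r + t *: h) w = contr r w + t *: contr h w by rewrite contrD contrZ.
have lin2 (c : K) u v : ueps (u + c *: v) = ueps u + c * ueps v.
  by rewrite linearD linearZ.
rewrite !iterSr em ep /ms !lin !lin2.
have /= -> := IH (false :: s); have /= -> := IH (true :: s).
by rewrite add0n add1n exprS; ring.
Qed.

End Sl2.

(** Both [r] and [h] commute with [x], so a word in them is invariant under [x], and one more
    contraction by [h] gives 0 by [contr_isotropic]. The factors [r + t *: h] become [r] one at a
    time. *)
Lemma symb_isotropic d x y r t : Defs.homog true x -> Defs.homog true y ->
  scomm pr (rho x) (scomm pr (rho x) (rho y)) = 0 -> scomm pr (rho x) r = 0 ->
  symb d (r + t *: scomm pr (rho x) (rho y)) z = symb d r z.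
Proof.
move=> hx hy; set h := scomm pr (rho x) (rho y) => xh xr.
rewrite /symb; congr (_ * _).
suff gen k j : ueps (iter k (contr (r + t *: h)) (iter j (contr r) z)) =
    ueps (iter k (contr r) (iter j (contr r) z)) by have := gen d 0%N.
elim: k j => [//|k IH] j; rewrite !iterSr -!iterS -IH contrD contrZ.
have lin a (c : K) u v : iter k (contr a) (u + c *: v) =
    iter k (contr a) u + c *: iter k (contr a) v.
  by elim: (k) => //= i ->; rewrite linearD linearZ.
rewrite lin linearD linearZ /= -iterS.
have hh : mhom false h by exact: (mhom_scomm (rho_hom hx) (rho_hom hy)).
have xrt : scomm pr (rho x) (r + t *: h) = 0.
  by have := scomm_linearr pr (rho x) t h r; rewrite xh xr scaler0 addr0 addrC.
have -> : iter k (contr (r + t *: h)) (contr h (iter j (contr r) z)) =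
    contr h (contrs (nseq k (r + t *: h) ++ nseq j r) z).
  rewrite /contrs foldr_cat -!/(contrs _ _) -!iter_contrs.
  by elim: (k) => //= i ->; rewrite (contrC_even _ _ hh).
rewrite (contr_isotropic y hx) ?mulr0 ?addr0 // => a.
by rewrite mem_cat => /orP[] /nseqP[->].
Qed.

(** * Injectivity of the restriction to a Cartan subalgebra *)

Section Restriction.
Variables (d : nat) (cart : L -> Prop).
Hypothesis cart_lin : forall (a : K) x y, cart x -> cart y -> cart (a *: x + y).
Hypothesis cart_even : forall h, cart h -> Defs.homog false h.
Hypothesis cart_vanish : forall hs, size hs = d -> (forall h, h \in hs -> cart h) ->
  ueps (contrs (map rho hs) z) = 0.

Definition root_vector x : Prop := exists p al h0,
  [/\ Defs.homog p x, cart h0, al h0 != 0 & forall h, cart h -> lbr x h = al h *: x].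

Hypothesis cart_root_ind : forall P : L -> Prop,
  (forall (a : K) x y, P x -> P y -> P (a *: x + y)) ->
  (forall x, cart x -> P x) -> (forall x, root_vector x -> P x) -> forall x, P x.

Lemma contrs_rcons s a u : contrs (rcons s a) u = contrs s (contr a u).
Proof. by rewrite /contrs foldr_rcons. Qed.

Lemma contrs_cat s s' u : contrs (s ++ s') u = contrs s (contrs s' u).
Proof. by rewrite /contrs foldr_cat. Qed.

Lemma contrs_linear s : linear (contrs s).
Proof.
elim: s => [//|a s IH] c u v.
by rewrite -[contrs (a :: s)]/(contr a \o contrs s) /= IH linearP.
Qed.

HB.instance Definition _ s := GRing.isLinear.Build K U U _ (contrs s) (contrs_linear s).

(** The induction on [k] frees one argument at a time: k = 0 is the hypothesis on Cartan elements, k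
    = d the claim for all arguments. *)
Definition vanish k := forall ys hs, size ys = k -> (k + size hs)%N = d ->
  (forall h, h \in hs -> cart h) ->
  ueps (contrs (map rho ys) (contrs (map rho hs) z)) = 0.

Lemma mx_par_rho x : mx_par pr (rho x) = rho (lpar x).
Proof.
have [x0 [x1 [h0 h1 ->]]] := homog_decomp x.
rewrite !linearD /= h0 h1 !linearZ /=.
by rewrite (rho_hom h0) (rho_hom h1).
Qed.

Lemma vanish_uad k p x ys hs : vanish k -> Defs.homog p x -> size ys = k ->
  (k + size hs)%N = d -> (forall h, h \in hs -> cart h) ->
  ueps (contrs (map rho ys) (uad p x (contrs (map rho hs) z))) = 0.
Proof.
move=> van hx sys szd hhs; set w := contrs (map rho hs) z.
(* When [x] passes a contraction it twists the argument by the parity; starting from twisted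
   arguments gives back [ys]. The commutator terms contain a bracket of L in place of an argument
   and vanish by [van]. *)
pose tw y := if p then lpar y else y.
have twK : involutive tw by rewrite /tw; case: (p) => //; exact: lparK.
have gen pre zs : (size pre + size zs)%N = k ->
    ueps (contrs (map rho pre) (uad p x (contrs (map rho zs) w))) =
    ueps (contrs (map rho (pre ++ map tw zs)) (uad p x w)).
  elim: zs pre => [|y zs IH] pre; first by rewrite cats0.
  move=> /= sk; rewrite (uad_contr _ _ hx) linearD linearD /=.
  have -> : mx_twist pr p (rho y) = rho (tw y).
    by rewrite /tw; case: (p) => //=; rewrite mx_par_rho.
  rewrite -rho_br -!(contrs_rcons _ (rho _)) -!map_rcons IH ?size_rcons ?addSnnS //.
  rewrite cat_rcons -[RHS]addr0; congr (_ + _).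
  have := van (rcons pre (lbr x y) ++ zs) hs.
  by rewrite map_cat contrs_cat; apply; rewrite // size_cat size_rcons addSnnS.
have := gen [::] (map tw ys); rewrite /= size_map => /(_ sys).
by rewrite (mapK twK) ueps_uad => <-.
Qed.

(** The bracket of a root vector [x] with [h0] is a nonzero multiple of [x]. So a word containing
    [x] beside Cartan elements can be written through adjoint images, under [x], of words of Cartan
    elements, and [vanish_uad] applies. *)
Lemma vanishS k : vanish k -> vanish k.+1.
Proof.
move=> van ys hs; case/lastP: ys => // ys x; rewrite size_rcons => -[sys] szd hhs.
rewrite map_rcons contrs_rcons; move: x; apply: cart_root_ind => [a x y hx hy|x hx|x].
- by rewrite linearP /= contr_linearl linearP /= linearP /= hx hy mulr0 addr0.
- apply: (van ys (x :: hs)) => //=; first by rewrite addnS.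
  by move=> h; rewrite inE => /predU1P[->|/hhs].
move=> [p [al [h0 [hx ch0 al0 xh]]]].
have even h : cart h -> mhom false (rho h) by move=> /cart_even/rho_hom.
(* The case where [x] stands beside a power of [h0] and elements commuting with [x]: the adjoint
   action of [x] on h0^(c+1) gives this word (c + 1) al(h0) times. *)
have A c ks : (forall h, h \in ks -> cart h /\ lbr x h = 0) ->
    (k + (c + size ks).+1)%N = d ->
    ueps (contrs (map rho ys)
      (contr (rho x) (iter c (contr (rho h0)) (contrs (map rho ks) z)))) = 0.
  move=> hks sz; set w := contrs (map rho ks) z.
  have wks : uad p x w = 0.
    apply: uad_contrs_ker => // _ /mapP[h /hks [_ e] ->].
    by rewrite -rho_br e linear0.
  have ui : uad p x (iter c.+1 (contr (rho h0)) w) =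
      (c.+1%:R * al h0) *: contr (rho x) (iter c (contr (rho h0)) w).
    have rx : rho (lbr x h0) = al h0 *: rho x by rewrite xh // linearZ.
    elim: c {sz} => [|c IH]; rewrite iterS (uad_contr _ _ hx) -rho_br rx contrZ.
      by rewrite wks linear0 add0r mul1r.
    rewrite {}IH contrZr.
    have -> : mx_twist pr p (rho h0) = rho h0.
      by case: (p) => //=; rewrite (even _ ch0) scale1r.
    by rewrite -(contrC_even _ _ (even _ ch0)) -scalerDl -[al h0 in X in _ + X]mul1r -mulrDl natr1.
  have := vanish_uad (hs := nseq c.+1 h0 ++ ks) van hx sys.
  rewrite size_cat size_nseq map_cat map_nseq contrs_cat -iter_contrs addSn => /(_ sz).
  rewrite ui !linearZ /= => h; apply/eqP.
  have /eqP : c.+1%:R * al h0 *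
     ueps (contrs (map rho ys) (contr (rho x) (iter c (contr (rho h0)) w))) = 0.
    by apply: h => h; rewrite inE mem_cat => /or3P[/eqP->//|/nseqP[->]//|/hks[]].
  by rewrite !mulf_eq0 pnatr_eq0 (negPf al0).
(* The general case: each Cartan factor is split into a multiple of [h0], which raises [c], and an
   element [q] in the kernel of the root, which joins [ks]. *)
suff B c ks : (forall h, h \in ks -> cart h /\ lbr x h = 0) ->
    (k + (size hs + (c + size ks)).+1)%N = d ->
    ueps (contrs (map rho ys) (contr (rho x) (contrs (map rho hs)
      (iter c (contr (rho h0)) (contrs (map rho ks) z))))) = 0.
  by apply: (B 0%N [::]) => //=; rewrite !addn0 addnS -addSn.
elim/last_ind: hs c ks {szd} hhs => [|hs h IH] c ks hhs hks sz; first exact: A.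
have ch : cart h by apply: hhs; rewrite mem_rcons inE eqxx.
have {}hhs h' : h' \in hs -> cart h'.
  by move=> m; apply: hhs; rewrite mem_rcons inE m orbT.
rewrite map_rcons contrs_rcons.
pose q := - (al h / al h0) *: h0 + h.
have cq : cart q by exact: cart_lin.
have xq : lbr x q = 0.
  by rewrite lbr_linearr !xh // scalerA mulNr divfK // scaleNr addNr.
have -> : h = (al h / al h0) *: h0 + q by rewrite /q addrA scaleNr subrr add0r.
rewrite linearP contr_linearl /=.
rewrite contrs_linear contr_linear contrs_linear ueps_linear.
rewrite -(iterS c (contr (rho h0))) IH // ?mulr0 ?add0r; last first.
  by rewrite -sz size_rcons !addSn !addnS.
have -> : contr (rho q) (iter c (contr (rho h0)) (contrs (map rho ks) z)) =
    iter c (contr (rho h0)) (contrs (map rho (q :: ks)) z).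
  by elim: c {sz IH} => //= c <-; rewrite (contrC_even _ _ (even _ ch0)).
apply: IH => //; last by rewrite -sz size_rcons /= !addSn !addnS.
by move=> h'; rewrite inE => /predU1P[->|/hks].
Qed.

Lemma restriction_inj s : size s = d -> ueps (contrs (map rho s) z) = 0.
Proof.
move=> sd; have v0 : vanish 0.
  by move=> [|//] hs _ shs hhs; exact: cart_vanish.
have van k : vanish k by elim: k => [//|k]; exact: vanishS.
by have := van d s [::] sd; rewrite addn0; apply.
Qed.

End Restriction.

End Invariants.

End ContractionOperators.

(** * Orthosymplectic matrices and invariance *)

Section OspMatrices.
Variables (K : numFieldType) (M n : nat).
Local Notation N := (M + 2 * n)%N.
Local Notation pr := (@par M n).
Implicit Types (X Y : 'M[K]_N) (i j a b k l : 'I_N).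

(** Hence - theta is an automorphism of the general linear Lie superalgebra, with osp as its fixed
    points. *)
Lemma theta_scomm X Y : theta (scomm pr X Y) = - scomm pr (theta X) (theta Y).
Proof.
apply/matrixP=> i l; rewrite !mxE mulr_sumr -sumrN.
rewrite (reindex_inj rev_ord_inj) /=; apply: eq_bigr => j _; rewrite !mxE.
have := osp_sign_comp K (rev_ord l) (rev_ord j) (rev_ord i).
rewrite !par_rev.
move: (osp_sign K (rev_ord l) (rev_ord j)) (osp_sign K (rev_ord j) (rev_ord i))
  (osp_sign K (rev_ord l) (rev_ord i)) => s1 s2 s3 e.
have acc c d : (s2 * c) * (s1 * d) =
    (-1) ^+ ((pr l (+) pr j) && (pr j (+) pr i)) * s3 * (c * d).
  by rewrite mulrACA [s2 * s1]mulrC e.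
rewrite !acc; case: (pr i) (pr j) (pr l) => [] [] []; rewrite /=; ring.
Qed.

Lemma mhom_delta i j : mhom pr (pr i (+) pr j) (delta_mx i j : 'M[K]_N).
Proof.
apply: mhomP => k l; rewrite mxE => ne; case: eqP => [ki|//]; case: eqP => [lj|//].
by rewrite ki lj eqxx in ne.
Qed.

Lemma mhom_Fmx i j : mhom pr (pr i (+) pr j) (Fmx K i j).
Proof.
rewrite /mhom /Fmx linearB linearZ /= (mhom_delta (rev_ord j)) mhom_delta.
by rewrite !par_rev [pr j (+) _]addbC scalerBr !scalerA mulrC.
Qed.

Lemma scomm_delta p X i j : mhom pr p X ->
  scomm pr X (delta_mx i j) = \sum_k X k i *: delta_mx k j
    - (-1) ^+ (p && (pr i (+) pr j)) *: \sum_k X j k *: delta_mx i k.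
Proof.
move=> hX; rewrite (scommE hX (mhom_delta i j)); congr (_ - _ *: _).
  apply/matrixP=> a b; rewrite mxE summxE (bigD1 i) //= big1 => [|k /negPf ki].
    rewrite (bigD1 a) //= big1 => [|k /negPf ka]; last by rewrite !mxE eq_sym ka mulr0.
    by rewrite !mxE !eqxx.
  by rewrite mxE ki mulr0.
apply/matrixP=> a b; rewrite mxE summxE (bigD1 j) //= big1 => [|k /negPf kj].
  rewrite (bigD1 b) //= big1 => [|k /negPf kb]; last by rewrite !mxE [b == k]eq_sym kb andbF mulr0.
  by rewrite !mxE !eqxx andbT mulrC.
by rewrite mxE kj andbF mul0r.
Qed.

(** F_ij is the image of the matrix unit e_ij under 1 - theta, which commutes with the bracket by
    [X]; the formula for matrix units carries over. *)
Lemma scomm_Fmx p X i j : mhom pr p X -> theta X = - X ->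
  scomm pr X (Fmx K i j) = \sum_k X k i *: Fmx K k j
    - (-1) ^+ (p && (pr i (+) pr j)) *: \sum_k X j k *: Fmx K i k.
Proof.
move=> hX tX; pose proj (Y : 'M[K]_N) := Y - theta Y.
have proj_lin : linear proj.
  by move=> c Y Z; rewrite /proj linearP opprD addrACA scalerBr.
pose projL : {linear 'M[K]_N -> 'M[K]_N} :=
  HB.pack proj (GRing.isLinear.Build K _ _ _ proj proj_lin).
have projE k l : Fmx K k l = projL (delta_mx k l).
  by rewrite /= /proj /Fmx -theta_delta.
have subr_ Y Z : scomm pr X (Y - Z) = scomm pr X Y - scomm pr X Z.
  apply/matrixP=> k l; rewrite !mxE -sumrB; apply: eq_bigr => a _; rewrite !mxE; ring.
have oppl Y : scomm pr (- X) Y = - scomm pr X Y.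
  by apply/matrixP=> k l; rewrite !mxE -sumrN; apply: eq_bigr => a _; rewrite !mxE; ring.
have -> : scomm pr X (Fmx K i j) = projL (scomm pr X (delta_mx i j)).
  by rewrite projE /= /proj subr_ theta_scomm tX oppl opprK.
have projS (c : 'I_N -> K) E : projL (\sum_k c k *: E k) = \sum_k c k *: projL (E k).
  by rewrite linear_sum; apply: eq_bigr => k _; rewrite linearZ.
rewrite (scomm_delta _ _ hX) linearB linearZ /=.
have /= -> := projS (fun k => X k i) (fun k => delta_mx k j).
have /= -> := projS (fun k => X j k) (fun k => delta_mx i k).
by congr (_ - _ *: _); apply: eq_bigr => k _; rewrite projE.
Qed.

Lemma osp_sign_diag i : osp_sign K i i = 1.
Proof. by rewrite /osp_sign addnn -mul2n mulnCA exprM sqrrN !expr1n mul1r sqr_eps. Qed.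

Lemma theta_Fmx i j : theta (Fmx K i j) = - Fmx K i j.
Proof. by apply/osp_spaceP; exact: Fmx_mem. Qed.

Lemma osp_entry_rev X i j : theta X = - X ->
  X i j = - (osp_sign K (rev_ord j) (rev_ord i) * X (rev_ord j) (rev_ord i)).
Proof. by move=> /matrixP/(_ i j); rewrite !mxE => ->; rewrite opprK. Qed.

Lemma osp_diag_rev X i : theta X = - X -> X (rev_ord i) (rev_ord i) = - X i i.
Proof. by move=> /osp_entry_rev ->; rewrite !rev_ordK osp_sign_diag mul1r. Qed.

Lemma osp_expand X : theta X = - X -> X = 2^-1 *: \sum_i \sum_j X i j *: Fmx K i j.
Proof.
move=> hX; have -> : \sum_i \sum_j X i j *: Fmx K i j = X *+ 2; last first.
  by rewrite -scaler_nat scalerA mulVf ?pnatr_eq0 // scale1r.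
rewrite mulr2n -{3}[X]opprK -hX {2 3}[X]matrix_sum_delta linear_sum -sumrB.
apply: eq_bigr => i _; rewrite linear_sum -sumrB; apply: eq_bigr => j _.
by rewrite linearZ /= theta_delta scalerBr.
Qed.

Lemma strform_delta i j X : strform pr (delta_mx i j) X = (-1) ^+ pr i * X j i.
Proof.
rewrite /strform (bigD1 j) //= [X in _ + X]big1 => [|k /negPf kj]; last first.
  by rewrite big1 // => l _; rewrite mxE kj andbF mulr0 mul0r.
rewrite (bigD1 i) //= [X in _ + X + _]big1 => [|k /negPf ki]; last first.
  by rewrite mxE ki mulr0 mul0r.
by rewrite mxE !eqxx mulr1 !addr0.
Qed.

Lemma strform_Fmx i j X : theta X = - X ->
  strform pr (Fmx K j i) X = 2 * (-1) ^+ pr j * X i j.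
Proof.
move=> hX; rewrite /Fmx.
have -> : delta_mx j i - osp_sign K j i *: delta_mx (rev_ord i) (rev_ord j) =
    - osp_sign K j i *: delta_mx (rev_ord i) (rev_ord j) + delta_mx j i.
  by rewrite scaleNr addrC.
rewrite strform_linearl !strform_delta [X i j](osp_entry_rev _ _ hX) par_rev.
rewrite /osp_sign !eps_rev !par_rev.
by case: (pr i) (pr j) => [] []; rewrite /=; ring.
Qed.

Lemma Fmx_col i j k : i != j -> Fmx K i j k j = (k == i)%:R * Fmx K i j i j.
Proof.
move=> ij; rewrite !mxE !eqxx /=; have [->|ki] := eqVneq k i; first by rewrite mul1r.
rewrite mul0r sub0r; have [ji|_] := eqVneq j (rev_ord i); last by rewrite andbF mulr0 oppr0.
by rewrite ji rev_ordK (negPf ki) mulr0 oppr0.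
Qed.

Lemma Fmx_row i j k : i != j -> Fmx K i j i k = (k == j)%:R * Fmx K i j i j.
Proof.
move=> ij; rewrite !mxE !eqxx /=; have [->|kj] := eqVneq k j; first by rewrite mul1r.
rewrite mul0r sub0r; have [ij'|_] := eqVneq i (rev_ord j); last by rewrite mulr0 oppr0.
by rewrite ij' rev_ordK (negPf kj) mulr0 oppr0.
Qed.

(** The scalar is 1 unless j = i'. In that case it is 2 when [i] is odd, which is the long
    symplectic root, and 0 when [i] is even, where F_ij itself is 0. *)
Lemma scomm_Fmx_rev i j : i != j ->
  scomm pr (Fmx K i j) (Fmx K j i) =
  Fmx K i j i j *: (Fmx K i i - (-1) ^+ (pr i (+) pr j) *: Fmx K j j).
Proof.
move=> ij; rewrite (scomm_Fmx _ _ (mhom_Fmx i j) (theta_Fmx i j)) scalerBr.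
rewrite [pr j (+) _]addbC andbb scalerA [_ * (-1) ^+ _]mulrC -scalerA.
congr (_ - _ *: _).
  rewrite (bigD1 i) //= big1 ?addr0 // => k /negPf ki.
  by rewrite Fmx_col // ki mul0r scale0r.
rewrite (bigD1 j) //= big1 ?addr0 // => k /negPf kj.
by rewrite Fmx_row // kj mul0r scale0r.
Qed.

Lemma scomm_Fmx_diag i j X : theta X = - X -> is_diag_mx X ->
  scomm pr (Fmx K i j) X = (X j j - X i i) *: Fmx K i j.
Proof.
move=> hX /is_diag_mxP dX.
have X0 a b : a != b -> X a b = 0 by exact: dX.
have hX0 : mhom pr false X.
  apply: mhomP => a b; have [->|/X0-> //] := eqVneq a b; by rewrite addbb.
have -> : scomm pr (Fmx K i j) X = - scomm pr X (Fmx K i j).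
  by rewrite (scomm_anti (mhom_Fmx i j) hX0) andbF expr0 scale1r.
rewrite (scomm_Fmx _ _ hX0 hX) expr0 scale1r (bigD1 i) //= big1 => [|k ki]; last first.
  by rewrite X0 ?scale0r.
rewrite (bigD1 j) //= big1 => [|k kj]; last by rewrite X0 ?scale0r // eq_sym.
by rewrite !addr0 -scalerBl -scaleNr opprB.
Qed.

End OspMatrices.

Lemma linear_comb (K : numFieldType) (V W : lmodType K) (f : {linear V -> W})
  (I : finType) (c : I -> K) (v : I -> V) :
  f (\sum_i c i *: v i) = \sum_i c i *: f (v i).
Proof. by rewrite linear_sum; apply: eq_bigr => i _; rewrite linearZ. Qed.

Section Covariance.
Variables (K : numFieldType) (M n : nat).
Local Notation N := (M + 2 * n)%N.
Local Notation L := (osp K M n).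
Local Notation U := (Uenv L).
Local Notation pr := (@par M n).
Implicit Types (x y : L) (u : U) (i j k l a b : 'I_N).

Definition osp_rho x : 'M[K]_N := val x.

Lemma osp_rho_linear : linear osp_rho. Proof. by []. Qed.

HB.instance Definition _ := GRing.isLinear.Build K L 'M[K]_N _ osp_rho osp_rho_linear.

Lemma osp_rho_inj : injective osp_rho. Proof. exact: val_inj. Qed.

Lemma osp_rho_hom p x : Defs.homog p x -> mhom pr p (osp_rho x).
Proof. exact: osp_par_val. Qed.

Lemma osp_rho_br x y : osp_rho (lbr x y) = scomm pr (osp_rho x) (osp_rho y).
Proof. by []. Qed.

Lemma theta_osp_rho x : theta (osp_rho x) = - osp_rho x.
Proof. exact/osp_spaceP/(valP x). Qed.

Lemma osp_rho_Fgen i j : osp_rho (Fgen K i j) = Fmx K i j.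
Proof. by []. Qed.

(* Invariance of A in End(V) (x) U(L) under L, where x acts on the first factor
   through the supertranspose of - osp_rho x. *)
Definition covariant (A : 'M[U]_N) : Prop := forall p x i j, Defs.homog p x ->
  uad p x (A i j) = (-1) ^+ (p && ~~ pr j) *:
    (\sum_a osp_rho x a i *: A a j - \sum_b osp_rho x j b *: A i b).

Lemma covariant1 : covariant 1%:M.
Proof.
move=> p x i j hx; rewrite mxE.
have -> : uad p x ((i == j)%:R) = 0.
  by case: (i == j); rewrite ?uad1 ?linear0.
rewrite (bigD1 j) //= big1 => [|a /negPf aj]; last by rewrite mxE aj scaler0.
rewrite [X in _ - X](bigD1 i) //= [X in _ - (_ + X)]big1 => [|a /negPf ai]; last first.
  by rewrite mxE eq_sym ai scaler0.
by rewrite !mxE !eqxx !addr0 subrr scaler0.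
Qed.

Lemma Fgen_homog i j : Defs.homog (pr i (+) pr j) (Fgen K i j : L).
Proof. by apply: val_inj; exact: mhom_Fmx. Qed.

Lemma signr_scale (k : nat) u : (-1) ^+ k * u = (-1 : K) ^+ k *: u.
Proof.
rewrite -[in LHS]signr_odd -[in RHS]signr_odd; case: (odd k).
  by rewrite !expr1 mulN1r scaleN1r.
by rewrite mul1r scale1r.
Qed.

Lemma covariant_Fhat : covariant (Fhat K M n).
Proof.
move=> p x i j hx; have hX := osp_rho_hom hx.
have tX := theta_osp_rho x.
have Fh a b : Fhat K M n a b = (-1) ^+ (par a * par b + par a + par b)%N *: uin (Fgen K a b).
  by rewrite mxE signr_scale.
rewrite Fh linearZ /= (uad_uin hx (Fgen_homog i j)).
have -> : lbr x (Fgen K i j) = \sum_k osp_rho x k i *: Fgen K k j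
    - (-1) ^+ (p && (pr i (+) pr j)) *: \sum_k osp_rho x j k *: Fgen K i k :> L.
  apply: osp_rho_inj; rewrite osp_rho_br (scomm_Fmx _ _ hX tX) [in RHS]linearB [in RHS]linearZ /=.
  by rewrite !(linear_comb osp_rho) scalerN.
rewrite linearB linearZ /= !(linear_comb (@uin K L)) /= !scalerDr !scalerN; congr (_ - _).
  rewrite !scaler_sumr; apply: eq_bigr => k _; rewrite Fh linearZ /= !scalerA.
  have [e|/(mhom_entry hX)->] := eqVneq (pr k (+) pr i) p; last by rewrite !(mulr0, mul0r, scale0r).
  by rewrite -e; congr (_ *: _); case: (pr i) (pr j) (pr k) => [] [] [] /=; ring.
rewrite !scaler_sumr; apply: eq_bigr => k _; rewrite Fh linearZ /= !scalerA.
have [e|/(mhom_entry hX)->] := eqVneq (pr j (+) pr k) p; last by rewrite !(mulr0, mul0r, scale0r).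
by rewrite -e; congr (_ *: _); case: (pr i) (pr j) (pr k) => [] [] [] /=; ring.
Qed.

(** The terms in which [x] acts on the summation index cancel: the column index of [A] against the
    row index of [B]. *)
Lemma covariantM A B : covariant A -> covariant B -> covariant (tens_mul pr A B).
Proof.
move=> hA hB p x i l hx; have hX := osp_rho_hom hx.
rewrite mxE linear_sum /=.
under eq_bigr do rewrite uadM (uad_utwist _ _ hx) (hA _ _ _ _ hx) (hB _ _ _ _ hx).
transitivity (\sum_j (-1) ^+ (p && ~~ pr l) *: (
    (\sum_a osp_rho x a i *: (utwist (pr j (+) pr l) (A a j) * B j l)
     - \sum_b osp_rho x j b *: (utwist (pr j (+) pr l) (A i b) * B j l))
    + (\sum_a osp_rho x a j *: (utwist (p (+) (pr j (+) pr l)) (A i j) * B a l)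
     - \sum_b osp_rho x l b *: (utwist (p (+) (pr j (+) pr l)) (A i j) * B j b)))).
  apply: eq_bigr => j _; rewrite [RHS]scalerDr utwist_comp; congr (_ + _).
    rewrite linearZ linearB /= !(linear_comb (utwist (pr j (+) pr l))) scalerA -scalerAl.
    rewrite mulrBl !mulr_suml; congr (_ *: (_ - _)).
    - by case: (p) (pr j) (pr l) => [] [] [] /=; ring.
    - by apply: eq_bigr => a _; rewrite scalerAl.
    - by apply: eq_bigr => a _; rewrite scalerAl.
  rewrite -scalerAr mulrBr !mulr_sumr.
  by congr (_ *: (_ - _)); apply: eq_bigr => a _; rewrite scalerAr.
rewrite -scaler_sumr !big_split /= !sumrN; congr (_ *: _).
have -> : \sum_j \sum_b osp_rho x j b *: (utwist (pr j (+) pr l) (A i b) * B j l) =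
    \sum_j \sum_a osp_rho x a j *: (utwist (p (+) (pr j (+) pr l)) (A i j) * B a l).
  rewrite exchange_big; apply: eq_bigr => j _; apply: eq_bigr => a _ /=.
  have [<-|/(mhom_entry hX)->] := eqVneq (pr a (+) pr j) p; last by rewrite !scale0r.
  by congr (_ *: (utwist _ _ * _)); case: (pr a) (pr j) (pr l) => [] [] [].
rewrite addrA subrK; congr (_ - _).
  rewrite exchange_big; apply: eq_bigr => a _; rewrite mxE scaler_sumr.
  by apply: eq_bigr.
rewrite exchange_big; apply: eq_bigr => b _; rewrite mxE scaler_sumr.
apply: eq_bigr => j _ /=.
have [<-|/(mhom_entry hX)->] := eqVneq (pr l (+) pr b) p; last by rewrite !scale0r.
by congr (_ *: (utwist _ _ * _)); case: (pr b) (pr j) (pr l) => [] [] [].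
Qed.

Lemma covariant_exp A (k : nat) : covariant A -> covariant (tens_exp pr A k).
Proof. by move=> hA; elim: k => [|k IH]; [exact: covariant1|exact: covariantM]. Qed.

Lemma covariant_str A : covariant A -> supercenter (tens_str pr A).
Proof.
move=> hA p x hx; have hX := osp_rho_hom hx.
rewrite linear_sum /=.
transitivity (\sum_i \sum_a ((-1) ^+ pr i * (-1) ^+ (p && ~~ pr i) * osp_rho x a i) *: A a i
   - \sum_i \sum_b ((-1) ^+ pr i * (-1) ^+ (p && ~~ pr i) * osp_rho x i b) *: A i b).
  rewrite -sumrB; apply: eq_bigr => i _.
  rewrite signr_scale linearZ /= (hA _ _ _ _ hx) scalerA scalerBr !scaler_sumr.
  by congr (_ - _); apply: eq_bigr => a _; rewrite scalerA.
rewrite exchange_big -sumrB big1 // => a _ /=; rewrite -sumrB big1 // => i _.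
rewrite -scalerBl; have [<-|/(mhom_entry hX)->] := eqVneq (pr a (+) pr i) p.
  by rewrite -mulrBl; case: (pr a) (pr i) => [] []; rewrite /= ?expr0 ?expr1 ?mulrNN ?mulr1 ?mul1r ?subrr ?mul0r ?scale0r.
by rewrite !mulr0 subrr scale0r.
Qed.

Lemma supercenter_str (k : nat) : supercenter (str_Fhat_exp K M n k).
Proof. exact/covariant_str/covariant_exp/covariant_Fhat. Qed.

Lemma supercenter_subalg (S : U -> Prop) u :
  (forall v, S v -> supercenter v) -> subalg_gen S u -> supercenter u.
Proof.
move=> hS; elim=> [v /hS//|p x _|a v w _ hv _ hw p x hx|v w _ hv _ hw p x hx].
- exact: uad1.
- by rewrite linearP /= hv // hw // scaler0 addr0.
- by rewrite uadM hv // hw // mul0r mulr0 addr0.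
Qed.

End Covariance.

(** * The Cartan subalgebra and the root vectors of osp *)

Section CartanPart.
Variables (K : numFieldType) (m n : nat).
Local Notation N := ((2 * m).+1 + 2 * n)%N.
Local Notation L := (osp K (2 * m).+1 n).
Local Notation U := (Uenv L).
Local Notation pr := (@par (2 * m).+1 n).
Local Notation rho := (@osp_rho K (2 * m).+1 n).
Local Notation contr := (@contr K L (2 * m + 2 * n) pr rho).
Local Notation contrs := (@contrs K L (2 * m + 2 * n) pr rho).
Local Notation symb := (@symb K L (2 * m + 2 * n) pr rho).
Local Notation rho_hom := (@osp_rho_hom K (2 * m).+1 n).
Local Notation rho_br := (@osp_rho_br K (2 * m).+1 n).
Implicit Types (x y h : L) (u z : U) (i j a b : 'I_N).

Lemma osp_Ufil_pred d u : Ufil d.+1 u ->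
  (forall s : seq L, size s = d -> ueps (contrs (map rho s) u) = 0) -> Ufil d u.
Proof.
move=> hu hs; pose I := ('I_N * 'I_N)%type.
(* The F_ij span osp with redundancy: the expansion over all pairs carries 1/2 ([osp_expand]), and
   [strform_Fmx] brings a factor 2. Together they give the constant 1/4. *)
apply: (Ufil_pred rho_hom rho_br (I := I) (pI := fun ij => pr ij.1 (+) pr ij.2)
  (c := fun ij => 4^-1 * (-1) ^+ pr ij.2) (b := fun ij => Fgen K ij.1 ij.2)
  (b' := fun ij => Fmx K ij.2 ij.1)) => // [[i j]|[i j]|x|s sd] /=.
- exact: Fgen_homog.
- by rewrite addbC; exact: (@mhom_Fmx K (2 * m).+1 n j i).
- apply: osp_rho_inj; rewrite linear_sum /= [RHS](osp_expand (theta_osp_rho x)).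
  rewrite pair_big scaler_sumr; apply: eq_bigr => -[i j] _ /=.
  rewrite linearZ /= scalerA (strform_Fmx _ _ (theta_osp_rho x)).
  by rewrite osp_rho_Fgen; congr (_ *: _); case: (pr j) => /=; field.
rewrite -[RHS](hs [seq Fgen K ij.2 ij.1 | ij <- s]) ?size_map //.
by rewrite -map_comp.
Qed.

Definition cart h : Prop := is_diag_mx (rho h).

Lemma cart_entry h i j : cart h -> i != j -> rho h i j = 0.
Proof. by move=> /is_diag_mxP; apply. Qed.

Lemma cart_lin (c : K) x y : cart x -> cart y -> cart (c *: x + y).
Proof.
move=> hx hy; apply/is_diag_mxP => i j ij; rewrite linearP !mxE.
by rewrite !cart_entry // mulr0 addr0.
Qed.

Lemma cart_homog h : cart h -> Defs.homog false h.
Proof.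
move=> hh; apply: osp_rho_inj; rewrite expr0 scale1r.
apply/matrixP=> i j; rewrite mxE; have [->|ij] := eqVneq i j; last first.
  by rewrite (cart_entry hh ij) mulr0.
by rewrite addbb mul1r.
Qed.

Lemma Fmx_diagE i a b : Fmx K i i a b =
  ((a == i) && (b == i))%:R - ((a == rev_ord i) && (b == rev_ord i))%:R.
Proof. by rewrite /Fmx osp_sign_diag scale1r !mxE. Qed.

Lemma cart_Fgen i : cart (Fgen K i i).
Proof.
apply/is_diag_mxP => a b ab; rewrite osp_rho_Fgen Fmx_diagE.
have ne k : (a == k) && (b == k) = false.
  by apply/negP => /andP[/eqP ak /eqP bk]; rewrite ak bk eqxx in ab.
by rewrite !ne subrr.
Qed.

Lemma lbr_Fgen_cart i j h : cart h ->
  lbr (Fgen K i j) h = (rho h j j - rho h i i) *: Fgen K i j.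
Proof.
move=> hh; apply: osp_rho_inj; rewrite linearZ /= -(scomm_Fmx_diag _ _ _ hh) //.
exact: theta_osp_rho.
Qed.

Lemma rev_fixed i j : rev_ord i = i -> rev_ord j = j -> i = j.
Proof.
move=> /(congr1 val) /= hi /(congr1 val) /= hj; apply: val_inj => /=.
by case: i j hi hj => i /= hi [j /= hj]; lia.
Qed.

Lemma cart_root_ind (P : L -> Prop) :
  (forall (c : K) x y, P x -> P y -> P (c *: x + y)) ->
  (forall x, cart x -> P x) -> (forall x, root_vector cart x -> P x) ->
  forall x, P x.
Proof.
move=> Plin Pcart Proot x.
have P0 : P 0.
  by apply: Pcart; apply/is_diag_mxP => i j _; rewrite linear0 mxE.
have Psum (I : finType) (c : I -> K) (v : I -> L) :
    (forall k : I, P (v k)) -> P (\sum_(k : I) c k *: v k).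
  by move=> Pv; elim/big_rec: _ => // k y _ Py; exact: Plin.
have -> : x = \sum_i 2^-1 *: \sum_j rho x i j *: Fgen K i j.
  apply: osp_rho_inj; rewrite [LHS](osp_expand (theta_osp_rho x)).
  rewrite (linear_comb rho) scaler_sumr; apply: eq_bigr => i _.
  by rewrite (linear_comb rho).
apply: (Psum _ (fun=> 2^-1)) => i; apply: Psum => j.
have [->|ij] := eqVneq i j; first exact/Pcart/cart_Fgen.
apply: Proot; exists (pr i (+) pr j), (fun h => rho h j j - rho h i i).
have two : 2 != 0 :> K by rewrite pnatr_eq0.
(* The weight of F_ij is nonzero on F_ii, except when [i] is the middle index, where F_ii = 0; then
   F_jj serves. *)
have [ri|ri] := eqVneq (rev_ord i) i.
  have rj : rev_ord j != j by apply: contraNneq ij => rj; rewrite (rev_fixed ri rj).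
  exists (Fgen K j j); split; [exact: Fgen_homog|exact: cart_Fgen| |exact: lbr_Fgen_cart].
  rewrite osp_rho_Fgen !Fmx_diagE eqxx [j == _]eq_sym (negPf rj) (negPf ij) /=.
  have -> : (i == rev_ord j) = false.
    by apply/negP => /eqP e; rewrite -e -ri e rev_ordK eqxx in rj.
  by rewrite !subr0 oner_eq0.
exists (Fgen K i i); split; [exact: Fgen_homog|exact: cart_Fgen| |exact: lbr_Fgen_cart].
rewrite osp_rho_Fgen !Fmx_diagE eqxx [j == i]eq_sym (negPf ij) [i == rev_ord i]eq_sym (negPf ri) /=.
rewrite sub0r subr0; case: (j == _) => /=; rewrite ?oppr0 ?sub0r ?oppr_eq0 ?oner_eq0 //.
by rewrite -opprD oppr_eq0 -[1 + 1]/2.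
Qed.

Lemma osp_restriction_inj d z : supercenter z ->
  (forall hs : seq L, size hs = d -> (forall h, h \in hs -> cart h) ->
     ueps (contrs (map rho hs) z) = 0) ->
  forall s : seq L, size s = d -> ueps (contrs (map rho s) z) = 0.
Proof.
move=> hz hd; apply: (restriction_inj rho_hom rho_br hz _ _ hd).
- exact: cart_lin.
- exact: cart_homog.
- exact: cart_root_ind.
Qed.

(** [symb_reflection] for e = F_ij and f = F_ji, whose bracket is F_ii - F_jj up to the nonzero
    scalar [k]; rescaling [t] absorbs it. *)
Lemma symb_refl d z i j r t : supercenter z -> i != j -> pr i = pr j ->
  cart r -> rho r i i = rho r j j -> Fmx K i j i j != 0 ->
  symb d (rho (r + t *: (Fgen K i i - Fgen K j j))) z =
  symb d (rho (r - t *: (Fgen K i i - Fgen K j j))) z.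
Proof.
move=> hz ij pij cr rij k0; set k := Fmx K i j i j in k0.
pose f := Fgen K j i; pose e : L := Fgen K i j.
have ef : scomm pr (rho e) (rho f) = k *: rho (Fgen K i i - Fgen K j j).
  by rewrite !osp_rho_Fgen scomm_Fmx_rev // pij addbb expr0 scale1r linearB.
have ch : cart (Fgen K i i - Fgen K j j).
  rewrite -[_ - _]opprK opprB -[Fgen K j j]scale1r -scaleN1r.
  by rewrite scaleN1r opprB -scaleN1r addrC; apply: cart_lin; rewrite ?scale1r; exact: cart_Fgen.
have eh x : cart x -> scomm pr (rho e) (rho x) = (rho x j j - rho x i i) *: rho e.
  by move=> cx; rewrite -rho_br lbr_Fgen_cart // linearZ.
have e_even : Defs.homog false e by rewrite -[false](addbb (pr j)) -{1}pij; exact: Fgen_homog.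
have f_even : Defs.homog false f by rewrite -[false](addbb (pr j)) -{2}pij; exact: Fgen_homog.
set h := Fgen K i i - Fgen K j j in ef ch *.
have ekh : scomm pr (rho e) (k *: rho h) = (k * (rho h j j - rho h i i)) *: rho e.
  have := scomm_linearr pr (rho e) k (rho h) 0; rewrite addr0 => ->.
  rewrite eh // scalerA -[RHS]addr0; congr (_ + _).
  by apply/matrixP=> a b; rewrite !mxE big1 // => c _; rewrite !mxE; ring.
have er : scomm pr (rho e) (rho r) = 0 by rewrite eh // rij subrr scale0r.
have := symb_reflection rho_hom rho_br hz e_even f_even ef ekh d (t / k) er.
rewrite scalerA divfK // -linearZ /= -linearB -linearD //.
Qed.

(** The odd root vector F_ij has weight 1 - 1 = 0 on its coroot F_ii + F_jj, which is isotropy. With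
    a middle index one of the two summands would be 0 and the root not isotropic. *)
Lemma symb_iso d z i j r t : supercenter z -> i != j -> pr i != pr j ->
  rev_ord i != i -> rev_ord j != j -> rev_ord i != j ->
  cart r -> rho r i i = rho r j j ->
  symb d (rho (r + t *: (Fgen K i i + Fgen K j j))) z = symb d (rho r) z.
Proof.
move=> hz ij pij ri rj rij cr reij.
pose f := Fgen K j i; pose e : L := Fgen K i j.
have pt : pr i (+) pr j = true by move: pij; case: (pr i) (pr j) => [] [].
have k1 : Fmx K i j i j = 1.
  by rewrite !mxE !eqxx [j == _]eq_sym (negPf rij) andbF mulr0 subr0.
have ef : scomm pr (rho e) (rho f) = rho (Fgen K i i + Fgen K j j).
  by rewrite !osp_rho_Fgen scomm_Fmx_rev // k1 pt scale1r expr1 scaleN1r opprK linearD.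
have ch : cart (Fgen K i i + Fgen K j j).
  by rewrite -[Fgen K i i]scale1r; apply: cart_lin; exact: cart_Fgen.
have eh x : cart x -> scomm pr (rho e) (rho x) = (rho x j j - rho x i i) *: rho e.
  by move=> cx; rewrite -rho_br lbr_Fgen_cart // linearZ.
have e_odd : Defs.homog true e by rewrite -pt; exact: Fgen_homog.
have f_odd : Defs.homog true f by rewrite -pt addbC; exact: Fgen_homog.
have rji : i == rev_ord j = false.
  by apply/negP => /eqP e'; rewrite e' rev_ordK eqxx in rij.
have := symb_isotropic rho_hom rho_br hz d t e_odd f_odd; rewrite ef => h.
rewrite linearD linearZ /=; apply: h.
  have rhoD a : rho (Fgen K i i + Fgen K j j) a a = Fmx K i i a a + Fmx K j j a a.
    by rewrite linearD mxE.
  rewrite eh // !rhoD !Fmx_diagE !eqxx (negPf ij) [j == i]eq_sym (negPf ij) rji.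
  rewrite [j == rev_ord i]eq_sym (negPf rij) [i == rev_ord i]eq_sym (negPf ri).
  by rewrite [j == rev_ord j]eq_sym (negPf rj) /= !subr0 add0r addr0 subrr scale0r.
by rewrite eh // reij subrr scale0r.
Qed.

End CartanPart.

(** * Supersymmetric polynomials *)

Section MpolyFacts.
Variables (K : numFieldType) (r : nat).
Implicit Types (p q : {mpoly K[r]}) (v : 'I_r -> K) (i : 'I_r) (m : 'X_{1..r}).

Lemma mpoly_ring_ind (P : {mpoly K[r]} -> Prop) :
  (forall c, P c%:MP) -> (forall p q, P p -> P q -> P (p + q)) ->
  (forall i p, P p -> P ('X_i * p)) -> forall p, P p.
Proof.
move=> Pc Padd PX p; have PXe i k q : P q -> P ('X_i ^+ k * q).
  by move=> Pq; elim: k => [|k IH]; rewrite ?mul1r // exprS -mulrA; exact: PX.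
rewrite [p]mpolyE; apply: (big_ind P) => //; first by rewrite -mpolyC0.
move=> m _; rewrite mpolyXE_id -mul_mpolyC mulrC.
by elim/big_rec: _ => [|i x _ Px]; rewrite ?mul1r // -mulrA; exact: PXe.
Qed.

Lemma poly_eq0 (q : {poly K}) : (forall t, q.[t] = 0) -> q = 0.
Proof.
move=> hq; apply/eqP/negPn/negP => q0.
have := max_poly_roots q0 (rs := [seq (k : nat)%:R | k <- iota 0 (size q)]).
rewrite size_map size_iota ltnn => h; suff: false by []; apply: h.
  by apply/allP => _ /mapP[i _ ->]; apply/rootP.
by rewrite map_inj_uniq ?iota_uniq // => a b /eqP; rewrite eqr_nat => /eqP.
Qed.

(** On the line through [v] in direction [i], [p] is a univariate polynomial that vanishes
    everywhere; its derivative at 0 is the value in question. *)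
Lemma meval_mderiv_eq0 p i : (forall v, p.@[v] = 0) -> forall v, p^`M(i).@[v] = 0.
Proof.
move=> p0 v.
pose g j : {poly K} := (v j)%:P + (j == i)%:R *: 'X.
pose h p : {poly K} := mmap polyC g p.
have hE q t : (h q).[t] = q.@[fun j => v j + (j == i)%:R * t].
  elim/mpoly_ring_ind: q => [c|q q' IH IH'|j q IH].
  - by rewrite /h mmapC mevalC hornerC.
  - by rewrite /h mmapD hornerD mevalD -IH -IH'.
  - by rewrite /h rmorphM /= mmapX mmap1U hornerM mevalM mevalXU IH !hornerE.
have hd q : (h q)^`() = h (q^`M(i)).
  elim/mpoly_ring_ind: q => [c|q q' IH IH'|j q IH].
  - by rewrite mderivC /h mmapC derivC mmap0.
  - by rewrite mderivD /h !mmapD derivD -/(h _) IH IH'.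
  - rewrite mderivM /h rmorphD !rmorphM /= mmapX mmap1U derivM -/(h _) IH; congr (_ * _ + _).
    rewrite /g derivD derivC derivZ derivX add0r mderivX mnm1E.
    have [->|ji] := eqVneq j i.
      rewrite ?eqxx !scale1r; have -> : (U_(i) - U_(i))%MM = 0%MM :> 'X_{1..r}.
        by apply/mnmP => k; rewrite mnmBE subnn mnm0E.
      by rewrite mpolyX0 -mpolyC1 mmapC.
    by rewrite !scale0r mmap0.
have h0 : h p = 0 by apply: poly_eq0 => t; rewrite hE.
have := hd p; rewrite h0 deriv0 => /(congr1 (horner^~ 0)); rewrite horner0 hE => e; rewrite [RHS]e.
by apply: meval_eq => j; rewrite mulr0 addr0.
Qed.

(** Derivatives reduce every coefficient to a constant term, which is the value at 0. *)
Lemma meval_eq0 p : (forall v, p.@[v] = 0) -> p = 0.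
Proof.
move=> p0; apply/mpolyP => m; rewrite mcoeff0.
move: {2}(mdeg m) (erefl (mdeg m)) => d; elim: d m p p0 => [|d IH] m p p0 dm.
  have -> : m = 0%MM by apply/eqP; rewrite -mdeg_eq0 dm.
  have <- : p.@[fun=> 0] = p@_0; last exact: p0.
  elim/mpoly_ring_ind: {p0} p => [c|q q' IH IH'|j q IH].
  - by rewrite mevalC mcoeffC eqxx mulr1.
  - by rewrite mevalD mcoeffD IH IH'.
  - by rewrite mevalM mevalXU mul0r rmorphM /= mcoeffX mnm1_eq0 mul0r.
have [i mi] : exists i, (0 < m i)%N.
  apply/existsP; apply: contraPT dm => /existsPn h; rewrite mdegE big1 // => i _.
  by apply/eqP; rewrite -leqn0 leqNgt.
have em : (m - U_(i) + U_(i))%MM = m by rewrite submK // lep1mP -lt0n.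
have := IH (m - U_(i))%MM _ (meval_mderiv_eq0 i p0).
rewrite mcoeff_deriv em => h; apply/eqP; have /eqP : p@_m *+ ((m - U_(i))%MM i).+1 = 0.
  by apply: h; move: dm; rewrite -{1}em mdegD mdeg1 addn1 => -[].
by rewrite mulrn_eq0.
Qed.

End MpolyFacts.

(** * Logarithmic derivatives and Newton's identities for truncated series *)

Section TruncatedSeries.
Variables (R : comNzRingType) (T : nat).
Implicit Types (f g p q : {poly R}) (u v : R) (N k : nat).

Definition eqtrunc f g := forall N, (N < T)%N -> f`_N = g`_N.

Lemma eqtruncM f f' g g' : eqtrunc f f' -> eqtrunc g g' -> eqtrunc (f * g) (f' * g').
Proof.
move=> ff gg N NT; rewrite !coefM; apply: eq_bigr => -[i /= iN] _.
by rewrite ff ?gg //; lia.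
Qed.

Lemma eqtruncD f f' g g' : eqtrunc f f' -> eqtrunc g g' -> eqtrunc (f + g) (f' + g').
Proof. by move=> ff gg N NT; rewrite !coefD ff ?gg. Qed.

Definition geo u : {poly R} := \poly_(k < T) u ^+ k.
Definition lin v : {poly R} := 1 - v *: 'X.
Definition pow u : {poly R} := \poly_(k < T) (u ^+ k *+ (0 < k)%N).

Lemma coef_mul_lin v f N : (lin v * f)`_N.+1 = f`_N.+1 - v * f`_N.
Proof. by rewrite mulrBl mul1r coefB -scalerAl coefZ coefXM. Qed.

Lemma coef0_lin v f : (lin v * f)`_0 = f`_0.
Proof. by rewrite mulrBl mul1r coefB -scalerAl coefZ coefXM /= mulr0 subr0. Qed.

Lemma lin_geo u : eqtrunc (lin u * geo u) 1.
Proof.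
case=> [|N] NT; first by rewrite coef0_lin coef_poly NT expr0 coef1.
by rewrite coef_mul_lin !coef_poly NT (ltnW NT) exprS subrr coef1.
Qed.

(** Says without division that p = X f'/f modulo X^T, so that products of [f] become sums of [p]. *)
Definition logder f p := eqtrunc ('X * f^`()) (p * f).

Lemma logderM f g p q : logder f p -> logder g q -> logder (f * g) (p + q).
Proof.
move=> hf hg; rewrite /logder derivM mulrDr mulrDl.
have -> : 'X * (f^`() * g) = ('X * f^`()) * g by rewrite mulrA.
have -> : 'X * (f * g^`()) = ('X * g^`()) * f by rewrite mulrCA mulrC.
have -> : p * (f * g) = (p * f) * g by rewrite mulrA.
have -> : q * (f * g) = (q * g) * f by rewrite mulrCA mulrC.
by apply: eqtruncD; apply: eqtruncM.
Qed.

Lemma logder_prod (I : finType) (P : pred I) (f p : I -> {poly R}) :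
  (forall i, logder (f i) (p i)) -> logder (\prod_(i | P i) f i) (\sum_(i | P i) p i).
Proof.
move=> h; elim/big_rec2: _ => [|i y z _ hyz]; last exact: logderM.
by move=> N NT; rewrite derivC mulr0 mul0r.
Qed.

Lemma logder_lin v : logder (lin v) (- pow v).
Proof.
move=> N NT; rewrite mulrC mulNr coefN.
case: N NT => [|N] NT; first by rewrite coefMX [pow v * _]mulrC coef0_lin /pow coef_poly NT oppr0.
rewrite [pow v * _]mulrC coef_mul_lin coefMX /= /lin /pow derivB derivC derivZ derivX sub0r coefN coefZ coef1.
rewrite !coef_poly NT (ltnW NT) mulr1n; case: N NT => [|N] NT /=.
  by rewrite expr1 mulr0n mulr0 subr0 mulr1.
by rewrite mulr0 mulr1n -exprS subrr.
Qed.

Lemma logder_geo u : logder (geo u) (pow u).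
Proof.
move=> N NT; rewrite coefXM coefM.
rewrite (eq_bigr (fun i : 'I_N.+1 => u ^+ N *+ (0 < i)%N)) => [|[i iN] _ /=]; last first.
  have iT : (i < T)%N by lia.
  have NiT : (N - i < T)%N by lia.
  by rewrite !coef_poly iT NiT mulrnAl -exprD subnKC.
case: N NT => [|N] NT /=; first by rewrite big_ord1 mulr0n.
rewrite big_ord_recl /= mulr0n add0r coef_deriv coef_poly NT.
by rewrite (eq_bigr (fun=> u ^+ N.+1)) // sumr_const card_ord.
Qed.

End TruncatedSeries.

Section SuperComplete.
Variables (R : comNzRingType) (I : finType) (x : I -> R) (T : nat).
Implicit Types (B C : {set I}).

(* Modulo 'X^T, [geo T u] is the inverse of [lin u], so [cser B C] is the generating
   function of the complete supersymmetric polynomials. *)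
Definition cser B C : {poly R} := (\prod_(j in C) lin (x j)) * \prod_(i in B) geo T (x i).

Definition spow B C k : R := \sum_(i in B) x i ^+ k - \sum_(j in C) x j ^+ k.

(** Newton's identities: the [spow B C k] are the coefficients of X times the logarithmic derivative
    of [cser B C]. *)
Lemma cser_newton B C N : (N < T)%N ->
  (cser B C)`_N *+ N = \sum_(j < N.+1 | (0 < j)%N) spow B C j * (cser B C)`_(N - j).
Proof.
move=> NT; have lg : logder T (cser B C) (\sum_(j in C) - pow T (x j) + \sum_(i in B) pow T (x i)).
  by apply: logderM; apply: logder_prod => i; [exact: logder_lin|exact: logder_geo].
have := lg N NT; rewrite coefXM coefM.
have -> : (if N == 0%N then 0 else ((cser B C)^`())`_N.-1) = (cser B C)`_N *+ N.
  by case: (N) => [|k]; rewrite ?mulr0n // coef_deriv.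
move=> ->; rewrite [RHS]big_mkcond; apply: eq_bigr => -[j jN] _ /=.
rewrite coefD !coef_sum.
have jT : (j < T)%N by lia.
case: ifPn => [j0|]; last first.
  rewrite -eqn0Ngt => /eqP->; rewrite !big1 ?addr0 ?mul0r // => i _.
    by rewrite coef_poly mulr0n if_same.
  by rewrite coefN coef_poly mulr0n if_same oppr0.
congr (_ * _); rewrite /spow addrC; congr (_ + _).
  by apply: eq_bigr => i _; rewrite coef_poly jT j0.
by rewrite -sumrN; apply: eq_bigr => i _; rewrite coefN coef_poly jT j0.
Qed.

Lemma cser0 B C : (0 < T)%N -> (cser B C)`_0 = 1.
Proof.
move=> T0; rewrite -[LHS]/(_) -horner_coef0 hornerM !horner_prod.
rewrite !big1 ?mulr1 // => i _; last first.
  by rewrite horner_coef0 -[lin _]mulr1 coef0_lin coef1.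
by rewrite horner_coef0 coef_poly T0.
Qed.

(** Newton's identities determine N times a coefficient, whence the assumption that [S] allows
    division by positive integers. *)
Lemma cser_closed (S : R -> Prop) B C :
  S 1 -> (forall a b, S a -> S b -> S (a + b)) -> (forall a b, S a -> S b -> S (a * b)) ->
  (forall k a, S (a *+ k.+1) -> S a) -> (forall k, S (spow B C k.+1)) -> S 0 ->
  forall N, (N < T)%N -> S (cser B C)`_N.
Proof.
move=> S1 Sadd Smul Sdiv Sp S0 N; have [k] := ubnP N; elim: k N => // k IH N Nk NT.
case: N Nk NT => [|N] Nk NT; first by rewrite cser0.
apply: (Sdiv N); rewrite cser_newton //; elim/big_rec: _ => // -[[|j] /= jN] y //= _ Sy.
by apply: (Sadd) => //; apply: Smul => //; apply: IH; lia.
Qed.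

End SuperComplete.

(** * Interpolation sums as coefficients of a generating function *)

Section Residues.
Variables (F : fieldType) (I : finType) (x : I -> F) (T : nat).
Hypothesis x_inj : injective x.
Implicit Types (B C : {set I}) (i j c d : I) (k : nat).

Definition res_weight B C i : F :=
  (\prod_(j in C) (x i - x j)) / \prod_(l in B | l != i) (x i - x l).

Definition residue B C k : F := \sum_(i in B) x i ^+ k * res_weight B C i.

(** For a polynomial q, coefficient N of q / (1 - u X) is u^N q(1/u) as soon as N is at least the
    degree of q. *)
Lemma cser_set1 C c k : (k + #|C| < T)%N ->
  ((\prod_(j in C) lin (x j)) * geo T (x c))`_(k + #|C|) =
  x c ^+ k * \prod_(j in C) (x c - x j).
Proof.
move: {2}#|C| (erefl #|C|) => n; elim: n C k => [|n IH] C k cC kT.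
  have -> : C = set0 by apply: cards0_eq.
  by rewrite !big_set0 cards0 addn0 mul1r mulr1 coef_poly; case: ifP => //; lia.
have [v vC] : exists v, v \in C by apply/set0Pn; rewrite -cards_eq0 cC.
rewrite !(big_setD1 v vC) /= -mulrA (cardsD1 v C) vC add1n addnS coef_mul_lin.
have cD : #|C :\ v| = n by move: cC; rewrite (cardsD1 v C) vC add1n => -[].
have := IH (C :\ v) k cD; have := IH (C :\ v) k.+1 cD; rewrite addSn cD => h1 h2.
by rewrite h1 ?h2; [rewrite exprS; ring|lia|lia].
Qed.

Lemma residue_shift B C c k : c \in B ->
  residue B C k.+1 - x c * residue B C k = residue (B :\ c) C k.
Proof.
move=> cB; rewrite /residue mulr_sumr -sumrB (big_setD1 c cB) /= exprS.
rewrite -mulrA subrr add0r; apply: eq_bigr => i; rewrite !inE => /andP[ic iB].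
rewrite exprS /res_weight.
have -> : \prod_(l in B | l != i) (x i - x l) = (x i - x c) * \prod_(l in B :\ c | l != i) (x i - x l).
  rewrite (bigD1 c) /=; last by rewrite cB eq_sym.
  congr (_ * _); apply: eq_bigl => l; rewrite !inE.
  by case: (l != c) (l \in B) (l != i) => [] [] [].
have n0 : x i - x c != 0 by rewrite subr_eq0 (inj_eq x_inj).
rewrite invfM; move: (\prod_(j in C) _) (\prod_(l in B :\ c | l != i) _)^-1 => P Q.
by field.
Qed.

(** The partial fraction expansion, proved by induction on [B]: both sides satisfy the recurrence of
    [residue_shift] for every element of [B]. The factor X^|B| avoids the index k + |C| + 1 - |B|,
    which may be negative. *)
Lemma cser_residue B C k : B != set0 -> (k + #|C| + 2 < T)%N ->
  ('X^#|B| * cser x T B C)`_(k + #|C|).+1 = residue B C k.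
Proof.
move: {2}#|B| (erefl #|B|) => n; elim: n B k => [|n IH] B k cB B0 kT.
  by case/negP: B0; rewrite -cards_eq0 cB.
have [c cinB] := set0Pn _ B0.
have [D0|D0] := eqVneq (B :\ c) set0.
  have -> : B = [set c] by rewrite -(setD1K cinB) D0 setU0.
  rewrite cards1 coefXM /= /cser big_set1 cser_set1; last by lia.
  rewrite /residue big_set1 /res_weight [X in _ / X]big1 ?divr1 // => l.
  by rewrite !inE andbN.
have [d dinD] := set0Pn _ D0; move: (dinD); rewrite !inE => /andP[dc dinB].
pose Y (j : nat) := ('X^#|B| * cser x T B C)`_(j + #|C|).+1.
have Yshift (a : I) (j : nat) : a \in B -> (j + #|C| + 2 < T)%N ->
    Y j.+1 - x a * Y j = residue (B :\ a) C j.
  move=> aB jT; rewrite /Y addSn -coef_mul_lin.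
  have cD : #|B :\ a| = n by move: cB; rewrite (cardsD1 a B) aB add1n => -[].
  have Da0 : B :\ a != set0.
    apply/set0Pn; have [->|ac] := eqVneq a c; first by exists d.
    by exists c; rewrite !inE cinB eq_sym ac.
  rewrite -(IH (B :\ a) j cD Da0 jT) cD cB /cser (big_setD1 a aB) /=.
  set g := (\prod_(j0 in C) _) * \prod_(i in B :\ a) _.
  have -> : lin (x a) * ('X^(n.+1) * (\prod_(j0 in C) lin (x j0) *
      (geo T (x a) * \prod_(i in B :\ a) geo T (x i)))) =
      'X * ('X^n * g * (lin (x a) * geo T (x a))) by rewrite /g exprS; ring.
  transitivity (('X^n * g * 1)%R`_(j + #|C|).+1); last by rewrite mulr1.
  by rewrite coefXM /=; apply: (eqtruncM (T := T)); [|exact: lin_geo|lia].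
have del (a : I) (j : nat) : a \in B -> (j + #|C| + 2 < T)%N ->
    Y j.+1 - residue B C j.+1 = x a * (Y j - residue B C j).
  by move=> aB jT; have := Yshift a j aB jT; rewrite -residue_shift // => /eqP; rewrite subr_eq => /eqP->; ring.
(* The next difference of the two sides is both [x c] and [x d] times this one, and these differ. *)
have del0 : Y 0%N - residue B C 0%N = 0.
  have := del c 0%N cinB; rewrite (del d 0%N) //; last by lia.
  move=> /(_ _) => h; apply/eqP; have /eqP : (x d - x c) * (Y 0%N - residue B C 0) = 0.
    by rewrite mulrBl h ?subrr //; lia.
  by rewrite mulf_eq0 subr_eq0 (inj_eq x_inj) (negPf dc).
apply/eqP; rewrite -subr_eq0; apply/eqP; rewrite -/(Y k).
elim: k kT => [//|k IHk] kT; rewrite (del c k cinB) ?IHk ?mulr0 //; lia.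
Qed.

End Residues.

Section Substitution.
Variables (K : numFieldType) (r : nat).
Local Notation P := {mpoly K[r]}.
Implicit Types (g h : 'I_r -> P) (p q : P) (i j : 'I_r).

Definition subst g p : P := p \mPo [tuple g i | i < r].

Lemma substD g : {morph subst g : p q / p + q}. Proof. exact: comp_mpolyD. Qed.
Lemma substB g : {morph subst g : p q / p - q}. Proof. exact: comp_mpolyB. Qed.
Lemma substM g : {morph subst g : p q / p * q}. Proof. exact: rmorphM. Qed.
Lemma substC g c : subst g c%:MP = c%:MP. Proof. exact: comp_mpolyC. Qed.
Lemma substZ g c p : subst g (c *: p) = c *: subst g p. Proof. exact: comp_mpolyZ. Qed.
Lemma subst0 g : subst g 0 = 0. Proof. exact: raddf0. Qed.
Lemma subst1 g : subst g 1 = 1. Proof. exact: rmorph1. Qed.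
Lemma substX g i : subst g 'X_i = g i.
Proof. by rewrite /subst comp_mpolyXU -tnth_nth tnth_mktuple. Qed.
Lemma substXn g p k : subst g (p ^+ k) = subst g p ^+ k. Proof. exact: rmorphXn. Qed.
Lemma subst_sum g (I : Type) (s : seq I) (R : pred I) (f : I -> P) :
  subst g (\sum_(i <- s | R i) f i) = \sum_(i <- s | R i) subst g (f i).
Proof. exact: raddf_sum. Qed.
Lemma subst_prod g (I : Type) (s : seq I) (R : pred I) (f : I -> P) :
  subst g (\prod_(i <- s | R i) f i) = \prod_(i <- s | R i) subst g (f i).
Proof. exact: rmorph_prod. Qed.

Lemma subst_comp g h p : subst g (subst h p) = subst (fun i => subst g (h i)) p.
Proof.
elim/mpoly_ring_ind: p => [c|p q hp hq|i p hp]; first by rewrite !substC.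
  by rewrite !substD hp hq.
by rewrite !substM !substX hp.
Qed.

Lemma subst_ext g h p : g =1 h -> subst g p = subst h p.
Proof.
move=> gh; elim/mpoly_ring_ind: p => [c|p q hp hq|i p hp]; first by rewrite !substC.
  by rewrite !substD hp hq.
by rewrite !substM !substX hp gh.
Qed.

Lemma subst_id p : subst (fun i => 'X_i) p = p. Proof. exact: comp_mpoly_id. Qed.

Lemma subst_meval g p v : (subst g p).@[v] = p.@[fun i => (g i).@[v]].
Proof.
by rewrite comp_mpoly_meval; apply: meval_eq => i; rewrite tnth_mktuple.
Qed.

End Substitution.

Section SubalgFacts.
Variables (K : nzRingType) (A : algType K) (S S' : A -> Prop).

Lemma subalg_zero : subalg_gen S 0.
Proof. by rewrite -[0](addNr 1) -scaleN1r; apply: subalg_lin; exact: subalg_one. Qed.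

Lemma subalg_add x y : subalg_gen S x -> subalg_gen S y -> subalg_gen S (x + y).
Proof. by move=> hx hy; rewrite -[x]scale1r; exact: subalg_lin. Qed.

Lemma subalg_scale a x : subalg_gen S x -> subalg_gen S (a *: x).
Proof. by move=> hx; rewrite -[_ *: x]addr0; apply: subalg_lin => //; exact: subalg_zero. Qed.

Lemma subalg_opp x : subalg_gen S x -> subalg_gen S (- x).
Proof. by move=> hx; rewrite -scaleN1r; exact: subalg_scale. Qed.

Lemma subalg_sum (I : Type) (r : seq I) (P : pred I) (F : I -> A) :
  (forall i, P i -> subalg_gen S (F i)) -> subalg_gen S (\sum_(i <- r | P i) F i).
Proof.
move=> h; elim/big_rec: _ => [|i x Pi hx]; first exact: subalg_zero.
by apply: subalg_add => //; exact: h.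
Qed.

Lemma subalg_exp x k : subalg_gen S x -> subalg_gen S (x ^+ k).
Proof.
move=> hx; elim: k => [|k IH]; first exact: subalg_one.
by rewrite exprS; exact: subalg_mul.
Qed.

Lemma subalg_prod (I : Type) (r : seq I) (P : pred I) (F : I -> A) :
  (forall i, P i -> subalg_gen S (F i)) -> subalg_gen S (\prod_(i <- r | P i) F i).
Proof.
move=> h; elim/big_rec: _ => [|i x Pi hx]; first exact: subalg_one.
by apply: subalg_mul => //; exact: h.
Qed.

Lemma subalg_sub x : (forall y, S y -> subalg_gen S' y) ->
  subalg_gen S x -> subalg_gen S' x.
Proof.
move=> h; elim=> [y /h//||a y z _ hy _ hz|y z _ hy _ hz].
- exact: subalg_one.
- exact: subalg_lin.
- exact: subalg_mul.
Qed.

End SubalgFacts.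

(** * Symmetrized multiples of delta are polynomials in the power sums *)

Section ResidueSum.
Variables (K : numFieldType) (r : nat) (A0 A1 : {set 'I_r}).
Local Notation P := {mpoly K[r]}.
Local Notation F := {fraction P}.
Local Notation tofrac := (@FracField.tofrac P).
Hypothesis A0_neq0 : A0 != set0.
Implicit Types (p q b : P) (i j l : 'I_r) (k : nat) (e : 'X_{1..r}).

Definition psum k : P := \sum_(i in A0) 'X_i ^+ k - \sum_(j in A1) 'X_j ^+ k.

(** Variables outside both sets count as constants. This lets the sets shrink in inductions while
    the polynomial ring stays fixed. *)
Definition pgen p : Prop := (exists k, p = psum k.+1) \/
  (exists l, l \notin A0 :|: A1 /\ p = 'X_l).

Local Notation Q := (subalg_gen pgen).

Definition delta : P := \prod_(i in A0) \prod_(j in A1) ('X_i - 'X_j).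

(** The product runs over ordered pairs: up to sign it is the square of the Vandermonde determinant,
    hence symmetric, and it is the product of the denominators of all weights. *)
Definition vdm : P := \prod_(i in A0) \prod_(l in A0 | l != i) ('X_i - 'X_l).

Let x i : F := tofrac 'X_i.

Let x_inj : injective x.
Proof.
move=> i j /eqP; rewrite /x tofrac_eq => /eqP /(congr1 (mcoeff U_(i))).
rewrite !mcoeffXU eqxx; have [//|ij] := eqVneq j i.
by move=> /eqP; rewrite oner_eq0.
Qed.

Definition fracQ (y : F) : Prop := exists2 q, Q q & y = tofrac q.

Lemma fracQ_add y z : fracQ y -> fracQ z -> fracQ (y + z).
Proof. by move=> [p hp ->] [q hq ->]; exists (p + q); rewrite ?rmorphD //; exact: subalg_add. Qed.

Lemma fracQ_mul y z : fracQ y -> fracQ z -> fracQ (y * z).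
Proof. by move=> [p hp ->] [q hq ->]; exists (p * q); rewrite ?rmorphM //; exact: subalg_mul. Qed.

Lemma fracQ_residue k : fracQ (residue x A0 A1 k).
Proof.
(* The least truncation order that [cser_residue] admits. *)
pose T := (k + #|A1| + 3)%N.
rewrite -(cser_residue x_inj (T := T)) //; last by rewrite /T ltn_add2l.
have f0 : fracQ 0 by exists 0; rewrite ?rmorph0 //; exact: subalg_zero.
rewrite coefXnM; case: ifP => // _; apply: cser_closed => //; last first.
  by apply: leq_ltn_trans (leq_subr _ _) _; rewrite /T -[_.+1]addn1 ltn_add2l.
- move=> N; exists (psum N.+1); first by apply: subalg_incl; left; exists N.
  by rewrite /spow /psum rmorphB !rmorph_sum; congr (_ - _); apply: eq_bigr => i _; rewrite rmorphXn.
- move=> N a [q hq e]; exists (N.+1%:R^-1 *: q); first exact: subalg_scale.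
  have n0 : N.+1%:R != 0 :> F by rewrite -(rmorph_nat tofrac) tofrac_eq0 -mpolyC_nat mpolyC_eq0 pnatr_eq0.
  apply: (mulfI n0); rewrite mulr_natl e -(rmorph_nat tofrac) -rmorphM.
  by congr tofrac; rewrite mulr_natl -scaler_nat scalerA mulfV ?scale1r // pnatr_eq0.
- exact: fracQ_mul.
- exact: fracQ_add.
- by exists 1; [exact: subalg_one|rewrite rmorph1].
Qed.

Definition fam i : pred 'I_r := fun j => if i \in A0 then j \in A0 else j == i.

Definition rename (f : 'I_r -> 'I_r) p : P := subst (fun i => 'X_(f i)) p.

Let w := res_weight x A0 A1.

(* [Lam] replaces each monomial by a product of residues, which are polynomials in
   the power sums; on multiples of the Vandermonde product it becomes [delta]
   times a symmetrization. *)
Definition Lam p : F :=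
  \sum_(f : {ffun 'I_r -> 'I_r} | f \in family fam) tofrac (rename f p) * \prod_(i in A0) w (f i).

Lemma Lam_monomial e : Lam 'X_[e] =
  \prod_i (if i \in A0 then residue x A0 A1 (e i) else x i ^+ e i).
Proof.
transitivity (\prod_i \sum_(j | fam i j) x j ^+ e i * (if i \in A0 then w j else 1)).
  rewrite bigA_distr_big_dep; apply: eq_bigr => f _.
  rewrite [RHS]big_split /= [X in _ * X = _]big_mkcond; congr (_ * _).
  rewrite /rename mpolyXE_id subst_prod rmorph_prod; apply: eq_bigr => i _.
  by rewrite substXn substX rmorphXn.
apply: eq_bigr => i _; rewrite /fam; case: ifP => // _.
by rewrite big_pred1_eq mulr1.
Qed.

Lemma Lam_linear (c : K) p q : Lam (c *: p + q) = tofrac c%:MP * Lam p + Lam q.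
Proof.
rewrite /Lam mulr_sumr -big_split; apply: eq_bigr => f _ /=.
by rewrite /rename substD substZ rmorphD /= -mul_mpolyC rmorphM /= mulrDl mulrA.
Qed.

Definition varA0 p : Prop := exists2 i, i \in A0 & p = 'X_i.

(** Only variables of [A0] are allowed, because [Lam] leaves the others unchanged instead of turning
    them into residues. *)
Lemma fracQ_Lam p : subalg_gen varA0 p -> fracQ (Lam p).
Proof.
have mon e : (forall i, i \notin A0 -> e i = 0%N) -> fracQ (Lam 'X_[e]).
  move=> he; rewrite Lam_monomial; elim/big_rec: _ => [|i y _ hy].
    by exists 1; [exact: subalg_one|rewrite rmorph1].
  apply: fracQ_mul => //; case: ifPn => iA; first exact: fracQ_residue.
  by rewrite he // expr0; exists 1; [exact: subalg_one|rewrite rmorph1].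
pose good b := forall e, (forall i, i \notin A0 -> e i = 0%N) -> fracQ (Lam (b * 'X_[e])).
suff gen a : subalg_gen varA0 a -> forall b, good b -> good (a * b).
  move=> hp; have := gen p hp 1; rewrite mulr1.
  move=> /(_ _ 0%MM) h; rewrite -[p]mulr1 -(@mpolyX0 r K); apply: h => [e he|i _].
    by rewrite mul1r; exact: mon.
  by rewrite mnm0E.
elim=> [_ [i iA ->]|| c y z _ hy _ hz | y z _ hy _ hz] b hb.
- move=> e he; rewrite mulrAC mulrC [X in Lam (_ * X)]mulrC.
  rewrite mulrA -mulrA -mpolyXD; apply: hb => l lA; rewrite mnmDE he // mnm1E.
  by case: eqP lA => // <-; rewrite iA.
- by rewrite mul1r.
- move=> e he; rewrite mulrDl -scalerAl mulrDl -scalerAl Lam_linear.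
  apply: fracQ_add; last exact: hz.
  apply: fracQ_mul; last exact: hy.
  by exists c%:MP => //; rewrite -[_%:MP]mulr1 mul_mpolyC; apply/subalg_scale/subalg_one.
- by rewrite -mulrA; apply: hy; exact: hz.
Qed.

Lemma rename_vdm_noninj f : f \in family fam -> ~~ injectiveb f -> rename f vdm = 0.
Proof.
move=> /familyP hf /injectivePn[i [l il fil]].
have fi : fam i (f i) := hf i; have fl : fam l (f l) := hf l; rewrite /fam in fi fl.
have [iA lA] : i \in A0 /\ l \in A0.
  move: fi fl; rewrite fil; case: (boolP (i \in A0)) => iA; case: (boolP (l \in A0)) => lA //.
  - by move=> h /eqP e; rewrite e (negPf lA) in h.
  - by move=> /eqP e h; rewrite e (negPf iA) in h.
  - by move=> /eqP e /eqP e'; rewrite -e e' eqxx in il.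
rewrite /rename /vdm subst_prod (bigD1 i) //= subst_prod (bigD1 l) /=; last by rewrite lA eq_sym.
by rewrite substB !substX fil subrr !mul0r.
Qed.

Lemma rename_vdm (s : 'S_r) : perm_on A0 s -> rename s vdm = vdm.
Proof.
move=> sA; rewrite /rename /vdm subst_prod [RHS](reindex_inj (@perm_inj _ s)) /=.
apply: eq_big => [i|i iA]; first by rewrite perm_closed.
rewrite subst_prod [RHS](reindex_inj (@perm_inj _ s)) /=.
apply: eq_big => [l|l _]; first by rewrite perm_closed // (inj_eq perm_inj).
by rewrite substB !substX.
Qed.

Lemma vdm_weight : tofrac vdm * \prod_(i in A0) w i = tofrac delta.
Proof.
rewrite /vdm /delta !rmorph_prod -big_split; apply: eq_bigr => i iA /=.
rewrite !rmorph_prod /w /res_weight.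
under [X in X * _ = _]eq_bigr do rewrite rmorphB.
under [RHS]eq_bigr do rewrite rmorphB.
rewrite mulrC divfK //; apply/prodf_neq0 => l /andP[_ li].
by rewrite subr_eq0 (inj_eq x_inj) eq_sym.
Qed.

(** A map that is not injective sends a factor of [vdm] to 0, so the sum reduces to permutations of
    [A0]; on these [vdm] clears the denominators of the weights and leaves [delta]. *)
Lemma Lam_vdm p : Lam (vdm * p) =
  tofrac (delta * \sum_(s : 'S_r | perm_on A0 s) rename s p).
Proof.
rewrite /Lam (bigID (fun f : {ffun 'I_r -> 'I_r} => injectiveb f)) /= addrC big1 ?add0r.
  rewrite (reindex_onto (@pval _) (insubd (1%g : 'S_r))) /=; last first.
    by move=> f /andP[_ fi]; apply: insubdK.
  rewrite rmorphM rmorph_sum mulr_sumr /=; apply: eq_big => [s|s].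
    rewrite valKd eqxx andbT (valP s) andbT; apply/familyP/idP => [h|sA i].
      apply/subsetP => i; rewrite !inE; apply: contraR => iA.
      by have : fam i (pval s i) := h i; rewrite /fam (negPf iA) pvalE.
    suff: fam i (pval s i) by []; rewrite /fam pvalE; case: ifPn => iA; first by rewrite perm_closed.
    by rewrite (out_perm sA).
  rewrite valKd eqxx andbT (valP s) andbT => /familyP h.
  have sA : perm_on A0 s.
    apply/subsetP => i; rewrite !inE; apply: contraR => iA.
    by have : fam i (pval s i) := h i; rewrite /fam (negPf iA) pvalE.
  have -> q : rename (pval s) q = rename s q by apply: subst_ext => i; rewrite pvalE.
  rewrite -vdm_weight /rename substM -!/(rename _ _) rename_vdm // rmorphM /=.
  rewrite [in RHS](reindex_inj (@perm_inj _ s)) /= mulrAC; congr (_ * _ * _).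
  by apply: eq_big => i; [rewrite perm_closed|rewrite pvalE].
move=> f /andP[ff fi]; rewrite /rename substM -/(rename _ _) rename_vdm_noninj //.
by rewrite mul0r rmorph0 mul0r.
Qed.

Lemma delta_sum_rename b : subalg_gen varA0 b ->
  Q (delta * \sum_(s : 'S_r | perm_on A0 s) rename s b).
Proof.
move=> hb; have [|q hq] := @fracQ_Lam (vdm * b).
  apply: subalg_mul => //; rewrite /vdm; apply: subalg_prod => i iA.
  apply: subalg_prod => l /andP[lA _]; apply: subalg_add.
    by apply: subalg_incl; exists i.
  by apply/subalg_opp/subalg_incl; exists l.
by rewrite Lam_vdm => /eqP; rewrite tofrac_eq => /eqP->.
Qed.

End ResidueSum.

Section PermInduction.
Variables (T : finType) (A : {set T}).

Lemma perm_on_ind (P : {perm T} -> Prop) :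
  P 1%g -> (forall s t, P s -> P t -> P (s * t)%g) ->
  (forall i j, i \in A -> j \in A -> P (tperm i j)) ->
  forall s, perm_on A s -> P s.
Proof.
move=> P1 PM Pt s; move: {2}(#|[set i | s i != i]|) (leqnn #|[set i | s i != i]|) => k.
elim: k s => [|k IH] s sk sA.
  suff -> : s = 1%g by [].
  apply/permP => i; rewrite perm1; apply/eqP; apply: contraTT sk => si.
  by rewrite -ltnNge card_gt0; apply/set0Pn; exists i; rewrite inE.
have [-> //|s1] := eqVneq s 1%g.
have [i si] : exists i, s i != i.
  apply/existsP; apply: contraNT s1 => /existsPn h; apply/eqP/permP => i.
  by rewrite perm1; apply/eqP/negPn.
have iA : i \in A by apply: (subsetP sA); rewrite inE.
have siA : s i \in A by rewrite perm_closed.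
have -> : s = (s * tperm i (s i) * tperm i (s i))%g by rewrite -mulgA tperm2 mulg1.
apply: PM; last exact: Pt.
have fix_ x : s x = x -> (s * tperm i (s i))%g x = x.
  move=> sx; rewrite permM sx tpermD //.
    by apply: contraNneq si => ->; rewrite sx.
  by apply: contraNneq si => e; apply/eqP/(@perm_inj _ s); rewrite e sx.
apply: IH; last by apply: perm_onM => //; apply/subsetP => x; rewrite !inE; case: tpermP => [->|->|]; rewrite ?eqxx.
rewrite -ltnS; apply: leq_trans sk; apply: proper_card; apply/properP; split.
  by apply/subsetP => x; rewrite !inE; apply: contraNneq => /fix_ ->.
by exists i; rewrite !inE // permM tpermR eqxx.
Qed.

End PermInduction.

Section Rename.
Variables (K : numFieldType) (r : nat).
Local Notation P := {mpoly K[r]}.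
Implicit Types (p q c : P) (i j k l : 'I_r) (A : {set 'I_r}).

Lemma rename_comp f g p : rename f (rename g p) = rename (f \o g) p.
Proof. by rewrite /rename subst_comp; apply: subst_ext => i; rewrite substX. Qed.

Lemma rename_perm_on A c : (forall i j, i \in A -> j \in A -> rename (tperm i j) c = c) ->
  forall s : 'S_r, perm_on A s -> rename s c = c.
Proof.
move=> ht; apply: perm_on_ind => [|s t hs ht'|i j]; last exact: ht.
  by rewrite -[RHS]subst_id; apply: subst_ext => i; rewrite perm1.
rewrite -[RHS]ht' -[in RHS]hs rename_comp.
by apply: subst_ext => i; rewrite permM.
Qed.

Definition collapse i j k := if k == i then j else k.

Lemma sub_collapse_dvd i j p : exists q, p = ('X_i - 'X_j) * q + rename (collapse i j) p.
Proof.
elim/mpoly_ring_ind: p => [c|p q [p' hp] [q' hq]|k p [q hq]].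
- by exists 0; rewrite mulr0 add0r /rename substC.
- exists (p' + q'); rewrite /rename substD -!/(rename _ _) {1}hp {1}hq; ring.
- rewrite /rename substM substX -/(rename _ _) /collapse.
  have [->|ki] := eqVneq k i.
    exists ('X_i * q + rename (collapse i j) p); rewrite {1}hq; ring.
  by exists ('X_k * q); rewrite {1}hq; ring.
Qed.

Lemma mpolyX_eq i j : ('X_i == 'X_j :> P) = (i == j).
Proof.
apply/eqP/eqP => [/(congr1 (mcoeff U_(i)))|->//].
by rewrite !mcoeffXU eqxx; case: eqVneq => // _ /eqP; rewrite oner_eq0.
Qed.

(** Putting x_i = x_j does not kill the factors of the other pairs, so in a domain it must kill the
    cofactor, which is then divisible by x_i - x_j. *)
Lemma dvd_pairs (A0 A1 : {set 'I_r}) p (s : seq ('I_r * 'I_r)) :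
  [disjoint A0 & A1] -> uniq s ->
  (forall ij, ij \in s -> [/\ ij.1 \in A0, ij.2 \in A1 & rename (collapse ij.1 ij.2) p = 0]) ->
  exists c, p = (\prod_(ij <- s) ('X_(ij.1) - 'X_(ij.2))) * c.
Proof.
move=> dA; elim: s => [|[i j] s IH] us hs.
  by exists p; rewrite big_nil mul1r.
move: us => /= /andP[ns us].
have [|c' hc] := IH us; first by move=> ij h; apply: hs; rewrite inE h orbT.
have [/= iA jA pij] := hs (i, j) (mem_head _ _).
have nA k l : k \in A0 -> l \in A1 -> k != l.
  by move=> kA lA; apply: contraTneq kA => ->; rewrite (disjointFl dA lA).
have [q hq] := sub_collapse_dvd i j c'.
suff c0 : rename (collapse i j) c' = 0.
  by exists q; rewrite big_cons {1}hc {1}hq c0 addr0; ring.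
move/eqP: pij; rewrite hc /rename substM -!/(rename _ _) mulf_eq0 => /orP[|/eqP //].
rewrite /rename subst_prod prodf_seq_eq0 => /hasP[[k l] kls] /=.
have [/= kA lA _] := hs (k, l) (mem_behead (s := (i, j) :: s) kls).
rewrite substB !substX subr_eq0 mpolyX_eq /collapse [l == i]eq_sym (negPf (nA _ _ iA lA)).
case: (k =P i) => [ki|_]; last by rewrite /= (negPf (nA _ _ kA lA)).
by rewrite /= => /eqP jl; rewrite ki -jl in kls; rewrite kls in ns.
Qed.

End Rename.

Section SymIdeal.
Variables (K : numFieldType) (r : nat).
Local Notation P := {mpoly K[r]}.
Implicit Types (p q c b : P) (i j k l : 'I_r) (A : {set 'I_r}).

Lemma rename_pgen A0 A1 (s : 'S_r) q : [disjoint A0 & A1] ->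
  perm_on A0 s \/ perm_on A1 s -> pgen A0 A1 q -> rename s q = q.
Proof.
move=> dA sA.
have sums A (B : {set 'I_r}) (k : nat) : [disjoint A & B] -> perm_on A s \/ perm_on B s ->
    \sum_(i in A) ('X_(s i) : P) ^+ k = \sum_(i in A) 'X_i ^+ k.
  move=> dAB [sA'|sB].
    rewrite [RHS](reindex_inj (@perm_inj _ s)) /=.
    by apply: eq_bigl => i; rewrite perm_closed.
  by apply: eq_bigr => i iA; rewrite (out_perm sB) // (disjointFr dAB iA).
move=> [[k ->]|[l [lA ->]]].
  rewrite /rename /psum substB !subst_sum; congr (_ - _).
    rewrite -[RHS](sums A0 A1 _ dA sA).
    by apply: eq_bigr => i _; rewrite substXn substX.
  have sA' : perm_on A1 s \/ perm_on A0 s by case: sA; [right|left].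
  have dA' : [disjoint A1 & A0] by rewrite disjoint_sym.
  rewrite -[RHS](sums A1 A0 _ dA' sA').
  by apply: eq_bigr => i _; rewrite substXn substX.
move: lA; rewrite inE negb_or => /andP[l0 l1].
by rewrite /rename substX; case: sA => h; rewrite (out_perm h).
Qed.

(** A symmetric [c] is its own average over the permutations of [A0], and averages are reached by
    [delta_sum_rename]. *)
Lemma delta_mul_sym A0 A1 c : [disjoint A0 & A1] -> A0 != set0 ->
  (forall s : 'S_r, perm_on A0 s -> rename s c = c) ->
  subalg_gen (fun p => pgen A0 A1 p \/ varA0 A0 p) c ->
  subalg_gen (pgen A0 A1) (delta K A0 A1 * c).
Proof.
move=> dA A0n sc hc.
(* Generators of [c] are removed one at a time: the invariant ones leave the sum over permutations,
   the variables of [A0] are collected in [b]. *)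
pose good a := forall b, subalg_gen (varA0 A0) b -> subalg_gen (pgen A0 A1)
  (delta K A0 A1 * \sum_(s : 'S_r | perm_on A0 s) rename s (a * b)).
have gen a : subalg_gen (fun p => pgen A0 A1 p \/ varA0 A0 p) a ->
    forall a', good a' -> good (a * a').
  elim=> [{}a [ha|ha]||t y z _ hy _ hz|y z _ hy _ hz] a' ga' b hb.
  - have -> : \sum_(s : 'S_r | perm_on A0 s) rename s (a * a' * b) =
        a * \sum_(s : 'S_r | perm_on A0 s) rename s (a' * b).
      rewrite mulr_sumr; apply: eq_bigr => s sA; rewrite -[_ * _ * _]mulrA.
      by rewrite {1}/rename substM -!/(rename _ _) (rename_pgen dA (or_introl sA) ha).
    by rewrite mulrCA; apply: subalg_mul; [exact: subalg_incl|exact: ga'].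
  - rewrite [a * a']mulrC -[X in subalg_gen _ (_ * X)]/(_).
    under eq_bigr do rewrite -mulrA.
    by apply: ga'; apply: subalg_mul => //; exact: subalg_incl.
  - by rewrite mul1r; exact: ga'.
  - have -> : \sum_(s : 'S_r | perm_on A0 s) rename s ((t *: y + z) * a' * b) =
        t *: \sum_(s : 'S_r | perm_on A0 s) rename s (y * a' * b) +
        \sum_(s : 'S_r | perm_on A0 s) rename s (z * a' * b).
      rewrite scaler_sumr -big_split; apply: eq_bigr => s _ /=.
      by rewrite !mulrDl -!scalerAl /rename substD substZ.
    rewrite mulrDr -scalerAr; apply: subalg_lin; first exact: hy.
    exact: hz.
  - by rewrite -mulrA; apply: hy => //; exact: hz.
have good1 : good 1.
  by move=> b hb; under eq_bigr do rewrite mul1r; exact: delta_sum_rename.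
have := gen c hc 1 good1 1 (subalg_one _); rewrite !mulr1.
under eq_bigr => s sA do rewrite sc //.
rewrite sumr_const mulrnAr => h.
have n0 : #|[pred s : 'S_r | perm_on A0 s]|%:R != 0 :> K.
  by rewrite pnatr_eq0 -lt0n; apply/card_gt0P; exists 1%g; rewrite inE perm_on1.
have := subalg_scale (#|[pred s : 'S_r | perm_on A0 s]|%:R^-1) h.
by rewrite -scaler_nat scalerA mulVf // scale1r.
Qed.

Lemma delta0l A1 : delta K set0 A1 = 1 :> P.
Proof. by rewrite /delta big_set0. Qed.

Lemma delta0r A0 : delta K A0 set0 = 1 :> P.
Proof. by rewrite /delta big1 // => i _; rewrite big_set0. Qed.

Lemma subalg_vars p (S : P -> Prop) : (forall i, subalg_gen S 'X_i) -> subalg_gen S p.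
Proof.
move=> hX; elim/mpoly_ring_ind: p => [c|p q hp hq|i p hp].
- by rewrite -[_%:MP]mulr1 mul_mpolyC; apply/subalg_scale/subalg_one.
- exact: subalg_add.
- by apply: subalg_mul.
Qed.

(** The classical theorem on symmetric polynomials is [delta_mul_sym] with empty second set, where
    [delta] is 1. Applied to [A1], it leaves only power sums in the variables of [A1], and each of
    these is a power sum over [A0] minus the super one. *)
Lemma delta_mul_bisym A0 A1 c : [disjoint A0 & A1] ->
  (forall s : 'S_r, perm_on A0 s \/ perm_on A1 s -> rename s c = c) ->
  subalg_gen (pgen A0 A1) (delta K A0 A1 * c).
Proof.
move=> dA sc.
have cA1 : subalg_gen (pgen A1 set0) c.
  have [->|A1n] := eqVneq A1 set0.
    by apply: subalg_vars => i; apply: subalg_incl; right; exists i; rewrite setU0 inE.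
  rewrite -[c]mul1r -(delta0r A1); apply: delta_mul_sym => //.
  - by rewrite disjoints_subset setC0 subsetT.
  - by move=> s sA; apply: sc; right.
  - apply: subalg_vars => i; apply: subalg_incl.
    have [iA|iA] := boolP (i \in A1); first by right; exists i.
    by left; right; exists i; rewrite setU0.
have cB : subalg_gen (fun p => pgen A0 A1 p \/ varA0 A0 p) c.
  apply: subalg_sub cA1 => p [[k ->]|[l [lA ->]]].
    have -> : psum K A1 set0 k.+1 = \sum_(i in A0) 'X_i ^+ k.+1 - psum K A0 A1 k.+1.
      by rewrite /psum big_set0 subr0 opprB addrC subrK.
    apply: subalg_add.
      apply: subalg_sum => i iA; apply/subalg_exp/subalg_incl; right; exists i => //.
    by apply/subalg_opp/subalg_incl; left; left; exists k.
  apply: subalg_incl; have [lA0|lA0] := boolP (l \in A0); first by right; exists l.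
  by left; right; exists l; split => //; move: lA; rewrite setU0 inE negb_or lA0.
have [A00|A0n] := eqVneq A0 set0; last by apply: delta_mul_sym => // s sA; apply: sc; left.
rewrite A00 delta0l mul1r; rewrite A00 in cB.
by apply: subalg_sub cB => p [hp|[j]]; [exact: subalg_incl|rewrite inE].
Qed.

End SymIdeal.

Section Supersymmetric.
Variables (K : numFieldType) (r : nat).
Local Notation P := {mpoly K[r]}.
Implicit Types (p q c F G : P) (i j a b : 'I_r) (A : {set 'I_r}).

Definition zero2 i j p : P :=
  subst (fun a => if (a == i) || (a == j) then 0 else 'X_a) p.

(** In [ssym01], independence of the common value of x_i and x_j is encoded as equality with the
    value at 0. *)
Record supersymmetric A0 A1 p : Prop := Supersymmetric {
  ssym0 : forall i j, i \in A0 -> j \in A0 -> rename (tperm i j) p = p;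
  ssym1 : forall i j, i \in A1 -> j \in A1 -> rename (tperm i j) p = p;
  ssym01 : forall i j, i \in A0 -> j \in A1 -> rename (collapse i j) p = zero2 i j p }.

Lemma ssym_perm A0 A1 p (s : 'S_r) : supersymmetric A0 A1 p ->
  perm_on A0 s \/ perm_on A1 s -> rename s p = p.
Proof. by move=> [h0 h1 _] []; [apply: rename_perm_on h0 s|apply: rename_perm_on h1 s]. Qed.

Lemma ssymB A0 A1 p q : supersymmetric A0 A1 p -> supersymmetric A0 A1 q ->
  supersymmetric A0 A1 (p - q).
Proof.
move=> [p0 p1 p2] [q0 q1 q2]; split=> i j iA jA; rewrite /rename /zero2 !substB -!/(rename _ _).
- by rewrite p0 ?q0.
- by rewrite p1 ?q1.
- by rewrite p2 ?q2.
Qed.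

Lemma disjoint_neq A0 A1 i j : [disjoint A0 & A1] -> i \in A0 -> j \in A1 -> i != j.
Proof. by move=> dA iA jA; apply: contraTneq iA => ->; rewrite (disjointFl dA jA). Qed.

Lemma subst_psum A0 A1 i j (g g' : 'I_r -> P) (k : nat) :
  [disjoint A0 & A1] -> i \in A0 -> j \in A1 -> g i = g j -> g' i = g' j ->
  (forall l, l != i -> l != j -> g l = g' l) ->
  subst g (psum K A0 A1 k) = subst g' (psum K A0 A1 k).
Proof.
move=> dA iA jA gij g'ij gg'.
have split2 f : f i = f j -> subst f (psum K A0 A1 k) =
    \sum_(l in A0 :\ i) f l ^+ k - \sum_(l in A1 :\ j) f l ^+ k.
  move=> fij; rewrite /psum (big_setD1 i iA) (big_setD1 j jA) substB !substD !substXn !substX fij.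
  rewrite opprD addrACA subrr add0r !subst_sum.
  by congr (_ - _); apply: eq_bigr => l _; rewrite substXn substX.
rewrite (split2 g gij) (split2 g' g'ij).
congr (_ - _); apply: eq_bigr => l /setD1P[ll lA]; congr (_ ^+ _); apply: gg' => //.
  exact: (disjoint_neq dA lA jA).
by rewrite eq_sym (disjoint_neq dA iA lA).
Qed.

Lemma collapse_pgen A0 A1 i j p : [disjoint A0 & A1] -> i \in A0 -> j \in A1 ->
  pgen A0 A1 p -> rename (collapse i j) p = zero2 i j p.
Proof.
move=> dA iA jA; have /negPf ij := disjoint_neq dA iA jA.
move=> [[k ->]|[l [lA ->]]].
  apply: (subst_psum _ dA iA jA); rewrite ?eqxx ?orbT //.
    by rewrite /collapse eqxx [j == i]eq_sym ij.
  by move=> l /negPf li /negPf lj; rewrite /collapse li lj.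
move: lA; rewrite inE negb_or => /andP[l0 l1]; rewrite /rename /zero2 !substX /collapse.
have /negPf -> : l != i by apply: contraNneq l0 => ->.
by have /negPf -> : l != j by apply: contraNneq l1 => ->.
Qed.

Lemma perm_on_tperm A i j : i \in A -> j \in A -> perm_on A (tperm i j).
Proof. by move=> iA jA; apply/subsetP => k; rewrite !inE; case: tpermP => [->|->|]; rewrite ?eqxx. Qed.

Lemma ssym_pgen A0 A1 p : [disjoint A0 & A1] -> subalg_gen (pgen A0 A1) p ->
  supersymmetric A0 A1 p.
Proof.
move=> dA; elim=> [{}p hp|| t y z _ [y0 y1 y2] _ [z0 z1 z2]|y z _ [y0 y1 y2] _ [z0 z1 z2]].
- split=> i j iA jA; last exact: (collapse_pgen dA iA jA hp).
    by apply: (rename_pgen dA _ hp); left; exact: perm_on_tperm.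
  by apply: (rename_pgen dA _ hp); right; exact: perm_on_tperm.
- by split=> i j iA jA; rewrite /rename /zero2 !subst1.
- split=> i j iA jA; rewrite /rename /zero2 !substD !substZ -!/(rename _ _) -?/(zero2 _ _ _).
  + by rewrite y0 ?z0.
  + by rewrite y1 ?z1.
  + by rewrite y2 ?z2.
- split=> i j iA jA; rewrite /rename /zero2 !substM -!/(rename _ _) -?/(zero2 _ _ _).
  + by rewrite y0 ?z0.
  + by rewrite y1 ?z1.
  + by rewrite y2 ?z2.
Qed.

Lemma zero2C i j a b p : zero2 i j (zero2 a b p) = zero2 a b (zero2 i j p).
Proof.
rewrite /zero2 !subst_comp; apply: subst_ext => k.
by case: ifP => h; case: ifP => h'; rewrite ?subst0 ?substX ?h ?h'.
Qed.

Lemma zero2_idem i j p : zero2 i j (zero2 i j p) = zero2 i j p.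
Proof.
rewrite /zero2 !subst_comp; apply: subst_ext => k.
by case: ifP => h; rewrite ?subst0 ?substX ?h.
Qed.

Lemma zero2_rename i j (f : 'I_r -> 'I_r) p :
  (forall k, ((f k == i) || (f k == j)) = ((k == i) || (k == j))) ->
  rename f (zero2 i j p) = zero2 i j (rename f p).
Proof.
move=> hf; rewrite /rename /zero2 !subst_comp; apply: subst_ext => k.
by rewrite substX hf; case: ifP; rewrite ?subst0 ?substX.
Qed.

Lemma ssym_zero2 A0 A1 i j p : [disjoint A0 & A1] -> i \in A0 -> j \in A1 ->
  supersymmetric A0 A1 p -> supersymmetric (A0 :\ i) (A1 :\ j) (zero2 i j p).
Proof.
move=> dA iA jA [h0 h1 h2].
have ne := disjoint_neq dA.
split=> a b /setD1P[ai aA] /setD1P[bi bA].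
- rewrite zero2_rename ?h0 // => k.
  by case: tpermP => [->|->|//]; rewrite (negPf ai) (negPf bi) !(negPf (ne _ _ _ jA)).
- rewrite zero2_rename ?h1 // => k.
  by case: tpermP => [->|->|//]; rewrite (negPf ai) (negPf bi) ![_ == i]eq_sym !(negPf (ne _ _ iA _)).
- rewrite zero2_rename; first by rewrite (h2 _ _ aA bA) zero2C.
  move=> k; rewrite /collapse; have [->|//] := eqVneq k a.
  by rewrite (negPf ai) (negPf bi) (negPf (ne _ _ aA jA)) eq_sym (negPf (ne _ _ iA bA)).
Qed.

(** A power sum for the smaller sets is the restriction of the one for the larger sets. *)
Lemma zero2_lift A0 A1 i j p : [disjoint A0 & A1] -> i \in A0 -> j \in A1 ->
  subalg_gen (pgen (A0 :\ i) (A1 :\ j)) p ->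
  exists2 q, subalg_gen (pgen A0 A1) q & zero2 i j q = zero2 i j p.
Proof.
move=> dA iA jA; elim=> [{}p [[k ->]|[l [lA ->]]]||t y z _ [y' hy ey] _ [z' hz ez]|y z _ [y' hy ey] _ [z' hz ez]].
- exists (psum K A0 A1 k.+1); first by apply: subalg_incl; left; exists k.
  rewrite /psum (big_setD1 i) //= [X in _ - X](big_setD1 j) //= /zero2.
  by rewrite !substB !substD !substXn !substX !eqxx orbT /= expr0n !add0r.
(* Once removed from the sets, x_i and x_j are among the constants of the smaller algebra; [zero2]
   kills them, so they lift to 0. *)
- have [lij|lij] := boolP ((l == i) || (l == j)).
    exists 0; first exact: subalg_zero.
    by rewrite /zero2 subst0 substX lij.
  exists 'X_l => //; apply: subalg_incl; right; exists l; split => //.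
  by move: lA lij; rewrite !inE !negb_or; case: eqP; case: eqP.
- by exists 1; first exact: subalg_one.
- exists (t *: y' + z'); first exact: subalg_lin.
  by rewrite /zero2 !substD !substZ -!/(zero2 _ _ _) ey ez.
- exists (y' * z'); first exact: subalg_mul.
  by rewrite /zero2 !substM -!/(zero2 _ _ _) ey ez.
Qed.

Lemma collapse_conj A0 A1 i j a b p : [disjoint A0 & A1] ->
  i \in A0 -> j \in A1 -> a \in A0 -> b \in A1 -> supersymmetric A0 A1 p ->
  rename (collapse i j) p = 0 -> rename (collapse a b) p = 0.
Proof.
move=> dA iA jA aA bA sp h; have ne := disjoint_neq dA.
have <- : rename (tperm i a) (rename (tperm j b) p) = p by rewrite (ssym1 sp) ?(ssym0 sp).
pose g := collapse a b \o (tperm i a \o tperm j b).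
rewrite !rename_comp; transitivity (rename g (rename (collapse i j) p)); last first.
  by rewrite h /rename subst0.
rewrite rename_comp /g; apply: subst_ext => k /=; rewrite [in RHS]/collapse.
have [->|//] := eqVneq k i.
rewrite tpermL; have -> : tperm j b i = i by rewrite tpermD // eq_sym ne.
by rewrite tpermL /collapse eqxx tpermD ?ne // if_same.
Qed.

Lemma delta_neq0 A0 A1 : [disjoint A0 & A1] -> delta K A0 A1 != 0.
Proof.
move=> dA; apply/prodf_neq0 => i iA; apply/prodf_neq0 => j jA.
by rewrite subr_eq0 mpolyX_eq (disjoint_neq dA).
Qed.

Lemma rename_delta A0 A1 (s : 'S_r) : [disjoint A0 & A1] ->
  perm_on A0 s \/ perm_on A1 s -> rename s (delta K A0 A1) = delta K A0 A1.
Proof.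
move=> dA [sA|sA]; rewrite /rename /delta subst_prod.
  rewrite [RHS](reindex_inj (@perm_inj _ s)) /=.
  apply: eq_big => [i|i iA]; first by rewrite perm_closed.
  rewrite subst_prod; apply: eq_bigr => j jA.
  by rewrite substB !substX (out_perm sA (negbT (disjointFl dA jA))).
apply: eq_bigr => i iA; rewrite subst_prod [RHS](reindex_inj (@perm_inj _ s)) /=.
apply: eq_big => [j|j jA]; first by rewrite perm_closed.
by rewrite substB !substX (out_perm sA (negbT (disjointFr dA iA))).
Qed.

Theorem supersymmetric_gen A0 A1 p : [disjoint A0 & A1] ->
  supersymmetric A0 A1 p -> subalg_gen (pgen A0 A1) p.
Proof.
elim: {A0}_.+1 {-2}A0 (ltnSn #|A0|) A1 p => // N IH A0 A0N A1 p dA sp.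
have [A00|/set0Pn[i iA]] := eqVneq A0 set0.
  rewrite -[p]mul1r -(delta0l _ A1) -A00; apply: delta_mul_bisym => // s.
  exact: ssym_perm.
have [A10|/set0Pn[j jA]] := eqVneq A1 set0.
  rewrite -[p]mul1r -(delta0r _ A0) -A10; apply: delta_mul_bisym => // s.
  exact: ssym_perm.
have dA' : [disjoint A0 :\ i & A1 :\ j].
  apply: (disjointWl (subsetDl _ _)); rewrite disjoint_sym.
  by apply: (disjointWl (subsetDl _ _)); rewrite disjoint_sym.
have [|q hq qp] := zero2_lift dA iA jA (IH _ _ _ (zero2 i j p) dA' (ssym_zero2 dA iA jA sp)).
  by move: A0N; rewrite (cardsD1 i A0) iA ltnS.
have sq := ssymB sp (ssym_pgen dA hq).
rewrite -[p](subrK q); apply: subalg_add => //.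
have col : rename (collapse i j) (p - q) = 0.
  by rewrite (ssym01 sq) // /zero2 substB -!/(zero2 _ _ _) qp zero2_idem subrr.
pose s := [seq ij <- index_enum ('I_r * 'I_r)%type | (ij.1 \in A0) && (ij.2 \in A1)].
have [||c hc] := @dvd_pairs _ _ A0 A1 (p - q) s dA.
- by rewrite filter_uniq // index_enum_uniq.
- move=> [a b]; rewrite mem_filter /= => /andP[/andP[aA bA] _]; split=> //.
  exact: (collapse_conj dA iA jA aA bA sq).
have hd : p - q = delta K A0 A1 * c by rewrite {1}hc /s big_filter /delta pair_big.
rewrite hd; apply: delta_mul_bisym => // t tA.
(* [delta] is nonzero and invariant, so the cofactor inherits the symmetry of [p - q]. *)
apply: (mulfI (delta_neq0 dA)); rewrite -{1}(rename_delta dA tA).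
by rewrite /rename -substM -!/(rename _ _) -hd (ssym_perm sq).
Qed.

Definition sqvar p : P := subst (fun i => 'X_i ^+ 2) p.

Lemma sqvarX (m : 'X_{1..r}) : sqvar 'X_[m] = 'X_[m *+ 2].
Proof.
rewrite /sqvar !mpolyXE_id subst_prod; apply: eq_bigr => i _.
by rewrite substXn substX -exprM mulmnE mulnC.
Qed.

Lemma mcoeff_sqvar p m : (sqvar p)@_(m *+ 2) = p@_m.
Proof.
rewrite [in RHS](mpolyE p) {1}[p]mpolyE /sqvar subst_sum !raddf_sum /=.
apply: eq_bigr => m' _; rewrite substZ -/(sqvar _) sqvarX !mcoeffZ !mcoeffX; congr (_ * (_ : bool)%:R).
apply/eqP/eqP => [/mnmP h|->//]; apply/mnmP => i; have := h i.
by rewrite !mulmnE => /eqP; rewrite eqn_mul2r => /eqP.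
Qed.

Lemma sqvar_inj : injective sqvar.
Proof. by move=> p q pq; apply/mpolyP => m; rewrite -(mcoeff_sqvar p) pq mcoeff_sqvar. Qed.

Definition flip i p : P := subst (fun a => if a == i then - 'X_a else 'X_a) p.

Lemma mcoeff_flip i p m : (flip i p)@_m = (-1) ^+ m i * p@_m.
Proof.
rewrite [in RHS](mpolyE p) {1}[p]mpolyE /flip subst_sum !raddf_sum /= mulr_sumr.
apply: eq_bigr => m' _; rewrite substZ.
have -> : subst (fun a => if a == i then - 'X_a else 'X_a) 'X_[m'] = (-1) ^+ m' i *: 'X_[m'] :> P.
  rewrite mpolyXE_id subst_prod (bigD1 i) //= [in RHS](bigD1 i) //= scalerAl.
  congr (_ * _).
    by rewrite substXn substX eqxx -scaleN1r exprZn.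
  by apply: eq_bigr => a ai; rewrite substXn substX (negPf ai).
rewrite !mcoeffZ !mcoeffX; case: eqP => [->|_]; last by rewrite !mulr0.
by rewrite !mulr1 mulrC.
Qed.

Lemma flip_invariant_sqvar p : (forall i, flip i p = p) -> exists q, p = sqvar q.
Proof.
move=> hp; pose h (m : 'X_{1..r}) := [multinom (m i)./2 | i < r].
have ev m i : p@_m != 0 -> ~~ odd (m i).
  move=> pm; apply/negP => om; have := mcoeff_flip i p m; rewrite hp -signr_odd om mulN1r.
  by move=> /eqP; rewrite -addr_eq0 -mulr2n mulrn_eq0 /= (negPf pm).
exists (\sum_(m <- msupp p) p@_m *: 'X_[h m]); rewrite /sqvar subst_sum {1}[p]mpolyE.
rewrite !big_seq; apply: eq_bigr => m; rewrite mcoeff_msupp => pm.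
rewrite substZ -/(sqvar _) sqvarX; congr (_ *: 'X_[_]); apply/mnmP => i.
by rewrite mulmnE mnmE muln2 -[in LHS](odd_double_half (m i)) (negPf (ev _ _ pm)).
Qed.

(** Invariance under the flips makes [p] a polynomial in the squares; as [sqvar] is injective and
    commutes with the substitutions, supersymmetry descends. The two sets cover all variables, so no
    constants occur among the generators. *)
Theorem even_supersymmetric_gen A p : supersymmetric A (~: A) p -> (forall i, flip i p = p) ->
  subalg_gen (fun q => exists k, q = psum K A (~: A) (2 * k.+1)) p.
Proof.
move=> [p0 p1 p2] /flip_invariant_sqvar[q hq]; rewrite {}hq in p0 p1 p2 *.
have ren f q' : rename f (sqvar q') = sqvar (rename f q').
  by rewrite /rename /sqvar !subst_comp; apply: subst_ext => i; rewrite substXn !substX.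
have z2 i j q' : zero2 i j (sqvar q') = sqvar (zero2 i j q').
  rewrite /zero2 /sqvar !subst_comp; apply: subst_ext => a; rewrite substXn !substX.
  by case: ifP; rewrite ?subst0 ?expr0n ?substX.
have dA : [disjoint A & ~: A] by rewrite -setI_eq0 setICr.
have : subalg_gen (pgen A (~: A)) q.
  apply: supersymmetric_gen => //; split=> i j iA jA; apply: sqvar_inj; rewrite -ren.
  - exact: p0.
  - exact: p1.
  - by rewrite -z2; exact: p2.
elim=> {p0 p1 p2}[{}q [[k ->]|[l]]||t y z _ hy _ hz|y z _ hy _ hz].
- apply: subalg_incl; exists k; rewrite /psum /sqvar substB !subst_sum; congr (_ - _).
    by apply: eq_bigr => i _; rewrite substXn substX exprM.
  by apply: eq_bigr => i _; rewrite substXn substX exprM.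
- by rewrite setUCr inE => -[].
- by rewrite /sqvar subst1; exact: subalg_one.
- by rewrite /sqvar substD substZ; exact: subalg_lin.
- by rewrite /sqvar substM; exact: subalg_mul.
Qed.

End Supersymmetric.

(** * Symbols of central elements *)

Section Coordinates.
Variables (K : numFieldType) (m n : nat).
Local Notation N := ((2 * m).+1 + 2 * n)%N.
Local Notation r := (n + m)%N.
Local Notation L := (osp K (2 * m).+1 n).
Local Notation U := (Uenv L).
Local Notation pr := (@par (2 * m).+1 n).
Local Notation rho := (@osp_rho K (2 * m).+1 n).
Local Notation contr := (@contr K L (2 * m + 2 * n) pr rho).
Local Notation contrs := (@contrs K L (2 * m + 2 * n) pr rho).
Local Notation symb := (@symb K L (2 * m + 2 * n) pr rho).
Local Notation rho_hom := (@osp_rho_hom K (2 * m).+1 n).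
Local Notation rho_br := (@osp_rho_br K (2 * m).+1 n).
Local Notation cart := (@cart K m n).
Implicit Types (x y h : L) (u z w : U) (i j : 'I_N) (a b c : 'I_r) (v : 'I_r -> K) (d k : nat).

Lemma ci_subproof : (r <= N)%N. Proof. lia. Qed.

Definition ci a : 'I_N := widen_ord ci_subproof a.

Lemma ci_inj : injective ci.
Proof. by move=> a b /(congr1 val) /= e; exact: val_inj. Qed.

Lemma rev_ci a b : (rev_ord (ci a) == ci b) = false.
Proof.
apply/eqP => /(congr1 val) /=; case: a b => a /= ha [b /= hb]; lia.
Qed.

Lemma par_ci a : pr (ci a) = (a < n)%N.
Proof. rewrite /par /=; case: a => a /= ha; lia. Qed.

Lemma mid_subproof : (r < N)%N. Proof. lia. Qed.

Definition mid : 'I_N := Ordinal mid_subproof.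

Lemma rev_mid : rev_ord mid = mid.
Proof. by apply: val_inj => /=; lia. Qed.

Lemma par_mid : pr mid = false.
Proof. by rewrite /par /=; lia. Qed.

Lemma mid_ci a : (mid == ci a) = false.
Proof. by apply/eqP => /(congr1 val) /=; case: a => a /= ha; lia. Qed.

Lemma ciP i : [\/ exists a, i = ci a, i = mid | exists a, i = rev_ord (ci a)].
Proof.
have [lt|gt|e] := ltngtP i r.
- by apply: Or31; exists (Ordinal lt); exact: val_inj.
- apply: Or33; have h : (rev_ord i < r)%N by case: i gt => i /= hi; lia.
  by exists (Ordinal h); rewrite -[LHS]rev_ordK; congr rev_ord; exact: val_inj.
- by apply: Or32; exact: val_inj.
Qed.

Definition hv v : L := \sum_a v a *: Fgen K (ci a) (ci a).

Lemma cart_hv v : cart (hv v).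
Proof.
rewrite /hv; elim/big_rec: _ => [|a h _ ch]; last by apply: cart_lin => //; exact: cart_Fgen.
by apply/is_diag_mxP => i j _; rewrite linear0 mxE.
Qed.

Lemma hv_ci v a : rho (hv v) (ci a) (ci a) = v a.
Proof.
rewrite /hv (linear_comb rho) summxE (bigD1 a) //= mxE osp_rho_Fgen Fmx_diagE eqxx.
rewrite eq_sym rev_ci subr0 mulr1 big1 ?addr0 // => b ba.
by rewrite mxE osp_rho_Fgen Fmx_diagE (inj_eq ci_inj) eq_sym (negPf ba) [ci a == _]eq_sym rev_ci subr0 mulr0.
Qed.

Lemma rho_rev h i : rho h (rev_ord i) (rev_ord i) = - rho h i i.
Proof. exact: (osp_diag_rev _ (theta_osp_rho h)). Qed.

Lemma rho_mid h : rho h mid mid = 0.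
Proof.
have := rho_rev h mid; rewrite rev_mid => /eqP.
by rewrite -subr_eq0 opprK -mulr2n mulrn_eq0 => /eqP.
Qed.

Lemma cart_ext h h' : cart h -> cart h' ->
  (forall a, rho h (ci a) (ci a) = rho h' (ci a) (ci a)) -> h = h'.
Proof.
move=> ch ch' e; apply: osp_rho_inj; apply/matrixP => i j.
have [<-|ij] := eqVneq i j; last by rewrite !cart_entry.
by case: (ciP i) => [[a ->]|->|[a ->]]; rewrite ?rho_mid // !rho_rev e.
Qed.

Lemma cartE h : cart h -> h = hv (fun a => rho h (ci a) (ci a)).
Proof. by move=> ch; apply: cart_ext => // [|a]; rewrite ?hv_ci //; exact: cart_hv. Qed.

Lemma hv_shift v x t : cart x -> hv v + t *: x = hv (fun a => v a + t * rho x (ci a) (ci a)).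
Proof.
move=> cx; apply: cart_ext; first by rewrite addrC; apply: cart_lin => //; exact: cart_hv.
  exact: cart_hv.
by move=> a; rewrite linearD linearZ /= !mxE !hv_ci.
Qed.

Lemma rhoB x y i j : rho (x - y) i j = rho x i j - rho y i j.
Proof. by rewrite linearB !mxE. Qed.

Lemma rhoD x y i j : rho (x + y) i j = rho x i j + rho y i j.
Proof. by rewrite linearD !mxE. Qed.

Lemma Fgen_ci a b : rho (Fgen K (ci a) (ci a)) (ci b) (ci b) = (b == a)%:R.
Proof.
by rewrite osp_rho_Fgen Fmx_diagE (inj_eq ci_inj) andbb [ci b == rev_ord _]eq_sym rev_ci subr0.
Qed.

Section Invariance.
Variables (z : U) (z_central : supercenter z).

Let two0 : 2 != 0 :> K. Proof. by rewrite pnatr_eq0. Qed.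

(** For a symplectic coordinate the reflection is that of the long root F_ij with j = i', for an
    orthogonal one that of the short root with [j] the middle index. *)
Lemma symb_sign d v a :
  symb d (rho (hv (fun b => if b == a then - v b else v b))) z = symb d (rho (hv v)) z.
Proof.
pose j := if pr (ci a) then rev_ord (ci a) else mid.
have ij : ci a != j.
  by rewrite /j; case: ifP; rewrite eq_sym ?rev_ci ?mid_ci.
have pij : pr (ci a) = pr j by rewrite /j; case: ifP => e; rewrite ?par_rev ?par_mid.
pose v0 b := if b == a then 0 else v b.
have rij : rho (hv v0) (ci a) (ci a) = rho (hv v0) j j.
  by rewrite /j; case: ifP; rewrite ?rho_rev ?rho_mid hv_ci /v0 eqxx ?oppr0.
have k0 : Fmx K (ci a) j (ci a) j != 0.
  rewrite !mxE !eqxx /j /=; case: ifP => e.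
    rewrite rev_ordK eqxx /osp_sign par_rev eps_rev e sqrrN expr1n mul1r.
    rewrite expr1 mulN1r mulrN sqr_eps mulN1r opprK eqxx. exact: two0.
  by rewrite rev_mid [ci a == _]eq_sym mid_ci mulr0 subr0 oner_eq0.
(* The coordinate of F_ii - F_jj at [a]: F_jj is - F_ii when j = i', and 0 when [j] is the middle
   index. *)
pose D : K := if pr (ci a) then 2 else 1.
have D0 : D != 0 by rewrite /D; case: ifP; rewrite ?oner_eq0.
have DE b : rho (Fgen K (ci a) (ci a) - Fgen K j j) (ci b) (ci b) = if b == a then D else 0.
  rewrite rhoB Fgen_ci /j /D; case: ifP => e.
    rewrite osp_rho_Fgen Fmx_diagE rev_ordK !andbb (inj_eq ci_inj) [ci b == rev_ord _]eq_sym rev_ci sub0r opprK.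
    by case: (b == a); rewrite ?addr0.
  by rewrite osp_rho_Fgen Fmx_diagE rev_mid [ci b == mid]eq_sym mid_ci subrr subr0; case: (b == a).
have cD : cart (Fgen K (ci a) (ci a) - Fgen K j j).
  by rewrite -scaleN1r addrC; apply: cart_lin; exact: cart_Fgen.
have := symb_refl d (v a / D) z_central ij pij (cart_hv v0) rij k0.
rewrite -scaleNr !hv_shift // => /esym; congr (symb d (rho _) z = symb d (rho _) z).
  congr hv; apply: funext => b; rewrite DE /v0; case: eqP => [->|_]; rewrite ?mulr0 ?addr0 //.
  by rewrite add0r mulNr divfK.
congr hv; apply: funext => b; rewrite DE /v0; case: eqP => [->|_]; rewrite ?mulr0 ?addr0 //.
by rewrite add0r divfK.
Qed.

Lemma symb_tperm d v a b : (a < n)%N = (b < n)%N ->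
  symb d (rho (hv (fun c => v (tperm a b c)))) z = symb d (rho (hv v)) z.
Proof.
move=> pab; have [->|ab] := eqVneq a b.
  by congr (symb d (rho (hv _)) z); apply: funext => c /=; rewrite tperm1 perm1.
have ij : ci a != ci b by rewrite (inj_eq ci_inj).
have pij : pr (ci a) = pr (ci b) by rewrite !par_ci.
(* [v] is decomposed into its projection [v0] to the hyperplane v_a = v_b and (v_a - v_b) / 2 times
   the coroot. *)
pose s := (v a + v b) / 2.
pose v0 c := if (c == a) || (c == b) then s else v c.
have rij : rho (hv v0) (ci a) (ci a) = rho (hv v0) (ci b) (ci b).
  by rewrite !hv_ci /v0 !eqxx orbT.
have k0 : Fmx K (ci a) (ci b) (ci a) (ci b) != 0.
  by rewrite !mxE !eqxx [ci a == rev_ord _]eq_sym rev_ci /= mulr0 subr0 oner_eq0.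
have DE c : rho (Fgen K (ci a) (ci a) - Fgen K (ci b) (ci b)) (ci c) (ci c) =
    if c == a then 1 else if c == b then - 1 else 0.
  rewrite rhoB !Fgen_ci; have [->|_] := eqVneq c a; first by rewrite (negPf ab) subr0.
  by rewrite !mulrb; case: (c == b); rewrite ?subr0 ?sub0r.
have cD : cart (Fgen K (ci a) (ci a) - Fgen K (ci b) (ci b)).
  by rewrite -scaleN1r addrC; apply: cart_lin; exact: cart_Fgen.
have := symb_refl d ((v a - v b) / 2) z_central ij pij (cart_hv v0) rij k0.
rewrite -scaleNr !hv_shift // => /esym; congr (symb d (rho _) z = symb d (rho _) z).
  congr hv; apply: funext => c; rewrite DE /v0 /=.
  case: tpermP => [->|->|/eqP/negPf-> /eqP/negPf->]; rewrite ?eqxx ?orbT /=.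
  - by rewrite /s; field.
  - by rewrite eq_sym (negPf ab) /s; field.
  - by rewrite mulr0 addr0.
congr hv; apply: funext => c; rewrite DE /v0.
have [->|ca] := eqVneq c a; first by rewrite /s /=; field.
have [->|cb] := eqVneq c b; first by rewrite /s /=; field.
by rewrite mulr0 addr0.
Qed.

Lemma symb_cancel d v v' a b : (a < n)%N != (b < n)%N -> v a = v b -> v' a = v' b ->
  (forall c, c != a -> c != b -> v c = v' c) ->
  symb d (rho (hv v)) z = symb d (rho (hv v')) z.
Proof.
move=> pab vab vab' hc.
have ab : a != b by apply: contraNneq pab => ->.
have ij : ci a != ci b by rewrite (inj_eq ci_inj).
have pij : pr (ci a) != pr (ci b) by rewrite !par_ci.
have := symb_iso d (v a - v' a) z_central ij pij _ _ _ (cart_hv v') _.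
rewrite !rev_ci !hv_ci => /(_ isT isT isT vab') <-.
have cD : cart (Fgen K (ci a) (ci a) + Fgen K (ci b) (ci b)).
  by rewrite -[X in X + _]scale1r; apply: cart_lin; exact: cart_Fgen.
rewrite hv_shift //; congr (symb d (rho (hv _)) z); apply: funext => c.
rewrite rhoD !Fgen_ci; have [->|ca] := eqVneq c a.
  by rewrite (negPf ab) addr0 mulr1 addrC subrK.
have [->|cb] := eqVneq c b; last by rewrite addr0 mulr0 addr0 hc.
by rewrite add0r mulr1 -vab -vab' addrC subrK.
Qed.

End Invariance.

End Coordinates.

(** * The restricted symbol as a polynomial *)

Section SymbolPolynomial.
Variables (K : numFieldType) (m n : nat).
Local Notation N := ((2 * m).+1 + 2 * n)%N.
Local Notation r := (n + m)%N.
Local Notation L := (osp K (2 * m).+1 n).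
Local Notation U := (Uenv L).
Local Notation pr := (@par (2 * m).+1 n).
Local Notation rho := (@osp_rho K (2 * m).+1 n).
Local Notation contr := (@contr K L (2 * m + 2 * n) pr rho).
Local Notation contrs := (@contrs K L (2 * m + 2 * n) pr rho).
Local Notation symb := (@symb K L (2 * m + 2 * n) pr rho).
Local Notation rho_hom := (@osp_rho_hom K (2 * m).+1 n).
Local Notation rho_br := (@osp_rho_br K (2 * m).+1 n).
Local Notation cart := (@cart K m n).
Local Notation hv := (@hv K m n).
Local Notation ci := (@ci m n).
Implicit Types (x y h : L) (u z w : U) (i j l : 'I_N) (a b c : 'I_r) (v : 'I_r -> K) (d k : nat).

(* The linear structures of contr, contrs and symb depend on rho_hom and rho_br,
   so that inference does not find them for the constants above. *)
Definition contrL (a : 'M[K]_N) : U -> U := contr a.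

HB.instance Definition _ (a : 'M[K]_N) :=
  GRing.isLinear.Build K U U _ (contrL a) (contr_linear rho_hom rho_br a).

Definition contrsL (s : seq 'M[K]_N) : U -> U := contrs s.

HB.instance Definition _ s :=
  GRing.isLinear.Build K U U _ (contrsL s) (contrs_linear rho_hom rho_br s).

Definition symbL d (a : 'M[K]_N) : U -> K := symb d a.

HB.instance Definition _ d (a : 'M[K]_N) :=
  GRing.isLinear.Build K U K *%R (symbL d a) (symb_linear rho_hom rho_br d a).

Definition Hci a : 'M[K]_N := rho (Fgen K (ci a) (ci a)).

(** This is d! times the restricted symbol, as a formal polynomial in the coordinates (see
    [symp_meval]). *)
Fixpoint symp d u : {mpoly K[r]} :=
  if d is d'.+1 then \sum_a 'X_a * symp d' (contr (Hci a) u) else (ueps u)%:MP.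

Lemma Hci_even a : mhom pr false (Hci a).
Proof. exact/rho_hom/cart_homog/cart_Fgen. Qed.

Lemma contr_hv v u : contr (rho (hv v)) u = \sum_a v a *: contr (Hci a) u.
Proof.
rewrite /hv (linear_comb rho); elim: (index_enum _) => [|a s IH].
  by rewrite !big_nil contr0.
by rewrite !big_cons contr_linearl IH.
Qed.

Lemma symp_meval d u v : (symp d u).@[v] = ueps (iter d (contr (rho (hv v))) u).
Proof.
elim: d u => [|d IH] u; first by rewrite mevalC.
rewrite /= rmorph_sum /= -iterS iterSr contr_hv.
have -> : iter d (contr (rho (hv v))) (\sum_a v a *: contr (Hci a) u) =
    \sum_a v a *: iter d (contr (rho (hv v))) (contr (Hci a) u).
  by elim: (d) => //= k ->; exact: (linear_comb (contrL _)).
by rewrite linear_sum; apply: eq_bigr => a _ /=; rewrite mevalM mevalXU IH linearZ.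
Qed.

Lemma symp_homog d u : symp d u \is d.-homog.
Proof.
elim: d u => [|d IH] u /=.
  by rewrite -[_%:MP]mulr1 mul_mpolyC dhomogZ // dhomog1.
apply: rpred_sum => a _; have X1 : ('X_a : {mpoly K[r]}) \is 1.-homog by rewrite dhomogX /= mdeg1.
exact: (dhomogM X1 (IH _)).
Qed.

Lemma symp_deriv d u a : (symp d.+1 u)^`M(a) = d.+1%:R *: symp d (contr (Hci a) u).
Proof.
have deriv1 k w : (symp k.+1 w)^`M(a) = symp k (contr (Hci a) w)
    + \sum_b 'X_b * (symp k (contr (Hci b) w))^`M(a).
  rewrite /= linear_sum /=; under eq_bigr do rewrite mderivM.
  rewrite big_split /=; congr (_ + _); rewrite (bigD1 a) //= big1 ?addr0 => [|b ba].
    rewrite mderivX mnm1E eqxx scale1r; have -> : (U_(a) - U_(a))%MM = 0%MM :> 'X_{1..r}.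
      by apply/mnmP => c; rewrite mnmBE subnn mnm0E.
    by rewrite mpolyX0 mul1r.
  by rewrite mderivX mnm1E (negPf ba) scale0r mul0r.
elim: d u => [|d IH] u; rewrite deriv1.
  by rewrite big1 ?addr0 ?scale1r // => b _; rewrite mderivC mulr0.
rewrite -[d.+2%:R]nat1r scalerDl scale1r; congr (_ + _).
rewrite [symp d.+1 (contr _ _)]/= scaler_sumr; apply: eq_bigr => b _.
rewrite IH -scalerAr; congr (_ *: (_ * symp _ _)).
exact: (contrC_even rho_hom rho_br _ _ (Hci_even b)).
Qed.

(** Polarization: differentiating [d] times recovers the multilinear contractions from their
    diagonal values, since contractions by Cartan elements commute. *)
Lemma symp_inj d u : symp d u = 0 ->
  forall s : seq 'I_r, size s = d -> ueps (contrs (map Hci s) u) = 0.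
Proof.
elim: d u => [|d IH] u u0 s.
  by move/size0nil->; have /(congr1 (mcoeff 0%MM)) := u0; rewrite /= mcoeffC eqxx mulr1 mcoeff0.
case/lastP: s => // s a; rewrite size_rcons => -[sd].
rewrite map_rcons contrs_rcons; apply: IH => //.
have := symp_deriv d u a; rewrite u0 mderiv0 => /esym/eqP.
by rewrite scaler_eq0 pnatr_eq0 => /eqP.
Qed.

Lemma symp_cart_vanish d u : symp d u = 0 ->
  forall hs : seq L, size hs = d -> (forall h, h \in hs -> cart h) ->
  ueps (contrs (map rho hs) u) = 0.
Proof.
move=> /symp_inj u0 hs.
suff gen s : (size hs + size s)%N = d -> (forall h, h \in hs -> cart h) ->
    ueps (contrs (map rho hs) (contrs (map Hci s) u)) = 0.
  by move=> sd; apply: (gen [::]); rewrite addn0.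
elim/last_ind: hs s => [|hs h IH] s sd chs; first exact: u0.
rewrite map_rcons contrs_rcons (cartE (chs h _)) ?mem_rcons ?inE ?eqxx //.
set v := (X in hv X); rewrite contr_hv.
have contrs_comb (G : 'I_r -> U) : contrs (map rho hs) (\sum_a v a *: G a) =
    \sum_a v a *: contrs (map rho hs) (G a) by exact: (linear_comb (contrsL _)).
rewrite contrs_comb.
rewrite linear_sum /= big1 // => a _; rewrite linearZ /=.
rewrite (IH (a :: s)) ?mulr0 // => [|h' h'hs]; last by apply: chs; rewrite mem_rcons inE h'hs orbT.
by move: sd; rewrite size_rcons addnS addSn.
Qed.

Lemma central_symbol0 d z : supercenter z -> Ufil d.+1 z ->
  (forall v, symb d (rho (hv v)) z = 0) -> Ufil d z.
Proof.
move=> cz fz s0; apply: osp_Ufil_pred => //; apply: osp_restriction_inj => //.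
apply: symp_cart_vanish; apply: meval_eq0 => v; rewrite symp_meval.
have /eqP := s0 v; rewrite mulf_eq0 invr_eq0 pnatr_eq0 eqn0Ngt fact_gt0 /=.
by move/eqP.
Qed.

Lemma symb_uin p h x : Defs.homog false h -> Defs.homog p x ->
  symb 1 (rho h) (uin x) = strform pr (rho h) (rho x).
Proof.
move=> hh hx; rewrite /symb /= invr1 mul1r -[uin x]mulr1.
rewrite (contr_uinM rho_hom rho_br _ (rho_hom hh) hx) !(contr1 rho_hom rho_br).
by rewrite mulr0 scaler0 !add0r linearZ /= ueps1 mulr1.
Qed.

(** On the Cartan subalgebra the symbol of [Fhat] is diagonal: F_ij pairs to 0 with diagonal
    matrices for distinct i and j. The 2 is that of [strform_Fmx], and on the diagonal the sign in
    [Fhat] cancels that of the supertrace form. *)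
Lemma tens_exp_symbol k v i l :
  Ufil k.+1 (tens_exp pr (Fhat K (2 * m).+1 n) k i l) /\
  symb k (rho (hv v)) (tens_exp pr (Fhat K (2 * m).+1 n) k i l) =
    (2 * rho (hv v) i i) ^+ k *+ (i == l).
Proof.
have ch := cart_hv v; have hh := rho_hom (cart_homog ch).
elim: k i l => [|k IH] i l.
  rewrite /= mxE; split.
    by case: (i == l); [exact: Ufil_one|exact: Ufil_zero].
  by rewrite /symb /= fact0 invr1 mul1r expr0; case: (i == l); rewrite /= ?ueps1 ?linear0.
have F2 (a b : 'I_N) q : Ufil 2 (utwist q (Fhat K (2 * m).+1 n a b)) /\
    symb 1 (rho (hv v)) (utwist q (Fhat K (2 * m).+1 n a b)) =
    (2 * rho (hv v) a a) *+ (a == b).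
  rewrite mxE signr_scale linearZ /= (utwist_uin _ (Fgen_homog K a b)) scalerA; split.
    by apply/UfilZ; rewrite -[uin _]mulr1; apply/Ufil_mulx/Ufil_one.
  rewrite -[symb 1 _ _]/(symbL 1 (rho (hv v)) _) linearZ /= /symbL.
  rewrite (symb_uin (cart_homog ch) (Fgen_homog K a b)).
  rewrite (strformC hh (mhom_Fmx K a b)) expr0 mul1r strform_Fmx; last exact: theta_osp_rho.
  have [<-|ab] := eqVneq a b; last by rewrite (cart_entry ch) 1?eq_sym // !mulr0.
  by rewrite addbb andbF; case: (pr a); rewrite /= ?expr0 ?expr1; ring.
split.
  rewrite /= mxE; apply: Ufil_sum => j _.
  by have := UfilM (proj1 (F2 i j (pr j (+) pr l))) (proj1 (IH j l)).
rewrite [tens_exp _ _ _]/= mxE -[symb k.+1 _ _]/(symbL k.+1 (rho (hv v)) _) linear_sum /=.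
rewrite (bigD1 i) //= big1 ?addr0 => [|j ji].
  have := symbM rho_hom rho_br hh (proj1 (F2 i i (pr i (+) pr l))) (proj1 (IH i l)).
  rewrite add1n /symbL => ->; rewrite (proj2 (F2 _ _ _)) (proj2 (IH _ _)) eqxx mulr1n.
  by rewrite mulrnAr -exprS.
have := symbM rho_hom rho_br hh (proj1 (F2 i j (pr j (+) pr l))) (proj1 (IH j l)).
by rewrite add1n /symbL => ->; rewrite (proj2 (F2 _ _ _)) eq_sym (negPf ji) mul0r.
Qed.

(** The exponent is even, so i and i' contribute equally, which turns 2^(2k) into 2^(2k+1); the
    middle index contributes 0 because k > 0. *)
Lemma str_symbol k v : (0 < k)%N ->
  symb (2 * k) (rho (hv v)) (str_Fhat_exp K (2 * m).+1 n (2 * k)) =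
  2 ^+ (2 * k).+1 * \sum_(a < r) (-1) ^+ (a < n)%N * v a ^+ (2 * k).
Proof.
move=> k0; rewrite /str_Fhat_exp /tens_str.
pose f i : K := (-1) ^+ pr i * (2 * rho (hv v) i i) ^+ (2 * k).
transitivity (\sum_i f i).
  rewrite -[symb _ _ _]/(symbL (2 * k) (rho (hv v)) _) linear_sum; apply: eq_bigr => i _.
  rewrite signr_scale linearZ /= /symbL (proj2 (tens_exp_symbol _ _ _ _)).
  by rewrite eqxx mulr1n.
have frev i : f (rev_ord i) = f i.
  by rewrite /f par_rev rho_rev mulrN exprM sqrrN -exprM.
rewrite (bigID (fun i => (i < r)%N)) /= [X in _ + X](bigD1 (mid m n)) /=; last by rewrite ltnn.
have -> : f (mid m n) = 0.
  by rewrite /f rho_mid mulr0 expr0n muln_eq0 /= eqn0Ngt k0 mulr0.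
have -> : \sum_(i < N | ~~ (i < r)%N && (i != mid m n)) f i = \sum_(i < N | (i < r)%N) f i.
  rewrite (reindex_inj rev_ord_inj) /=; apply: eq_big => [i|i _]; last exact: frev.
  rewrite -val_eqE /=; case: i => i /= hi; lia.
rewrite add0r -mulr2n (big_ord_narrow (ci_subproof m n)) /= exprS -mulrA mulr_natl; congr (_ *+ 2).
rewrite mulr_sumr; apply: eq_bigr => a _.
by rewrite /f -[widen_ord _ _]/(ci a) par_ci hv_ci exprMn mulrCA.
Qed.

End SymbolPolynomial.

(** * Lifting symbols and descending on the degree *)

Section Generation.
Variables (K : numFieldType) (m n : nat).
Local Notation N := ((2 * m).+1 + 2 * n)%N.
Local Notation r := (n + m)%N.
Local Notation L := (osp K (2 * m).+1 n).
Local Notation U := (Uenv L).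
Local Notation P := {mpoly K[r]}.
Local Notation rho := (@osp_rho K (2 * m).+1 n).
Local Notation symbL := (@symbL K m n).
Local Notation rho_hom := (@osp_rho_hom K (2 * m).+1 n).
Local Notation rho_br := (@osp_rho_br K (2 * m).+1 n).
Local Notation hv := (@hv K m n).
Implicit Types (u z w : U) (a b c : 'I_r) (v : 'I_r -> K) (d k : nat) (p q : P).

Definition str_power u := exists k, (1 <= k)%N /\ u = str_Fhat_exp K (2 * m).+1 n (2 * k).
Local Notation Q := (subalg_gen str_power).

Definition lifts d p := exists w, [/\ Q w, Ufil d.+1 w &
  forall v, symbL d (rho (hv v)) w = p.@[v]].

Lemma lifts0 d : lifts d 0.
Proof.
exists 0; split; [exact: subalg_zero|exact: Ufil_zero|move=> v].
by rewrite linear0 meval0.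
Qed.

Lemma lifts_lin d t p q : lifts d p -> lifts d q -> lifts d (t *: p + q).
Proof.
move=> [w [Qw Uw sw]] [w' [Qw' Uw' sw']]; exists (t *: w + w'); split.
- exact: subalg_lin.
- exact: Ufil_lin.
- by move=> v; rewrite linearP /= sw sw' mevalD mevalZ.
Qed.

Lemma lifts_sum d (I : Type) (s : seq I) (G : I -> P) :
  (forall i, lifts d (G i)) -> lifts d (\sum_(i <- s) G i).
Proof.
move=> h; elim/big_rec: _ => [|i p _ hp]; first exact: lifts0.
by rewrite -[G i]scale1r; exact: lifts_lin.
Qed.

Lemma lifts_mul d e p q : lifts d p -> lifts e q -> lifts (d + e) (p * q).
Proof.
move=> [w [Qw Uw sw]] [w' [Qw' Uw' sw']]; exists (w * w'); split.
- exact: subalg_mul.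
- by have := UfilM Uw Uw'; rewrite addSn addnS.
- move=> v; rewrite mevalM -sw -sw'.
  exact: (symbM rho_hom rho_br (rho_hom (cart_homog (cart_hv v)))).
Qed.

Lemma lifts_one : lifts 0 1.
Proof.
exists 1; split; [exact: subalg_one|exact: Ufil_one|move=> v].
by rewrite meval1 /symbL /symb /= fact0 invr1 mul1r ueps1.
Qed.

(** An expression of a homogeneous polynomial by power sums may pass through inhomogeneous ones,
    whereas a symbol has one degree; the induction therefore carries all homogeneous components. *)
Definition liftable p := forall d, lifts d (pihomog mdeg d p).

Lemma liftable_homog d p : p \is d.-homog -> lifts d p -> liftable p.
Proof.
move=> hp lp e; have [<-|de] := eqVneq d e; first by rewrite pihomog_dE.
by rewrite (pihomog_ne0 de hp); exact: lifts0.
Qed.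

Lemma liftable_mul p q : liftable p -> liftable q -> liftable (p * q).
Proof.
move=> hp hq e.
rewrite (pihomog_partitionE (leqnn (mmeasure mdeg p))).
rewrite (pihomog_partitionE (leqnn (mmeasure mdeg q))) mulr_suml linear_sum.
apply: lifts_sum => i; rewrite mulr_sumr linear_sum; apply: lifts_sum => j.
apply: (liftable_homog (d := i + j)); last exact: lifts_mul.
by apply: dhomogM; exact: pihomogP.
Qed.

(** The orthogonal coordinates, which the supertrace counts positively, take the role of the first
    set of variables. *)
Definition evens : {set 'I_r} := [set a : 'I_r | ~~ (a < n)%N].

Lemma psum_meval k v : (psum K evens (~: evens) k).@[v] =
  \sum_(a < r) (-1) ^+ (a < n)%N * v a ^+ k.
Proof.
rewrite (bigID (mem evens)) /= /psum mevalB !rmorph_sum /= -sumrN; congr (_ + _).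
  apply: eq_bigr => a; rewrite inE => /negPf->.
  by rewrite rmorphXn /= mevalXU mul1r.
apply: eq_big => [a|a]; rewrite !inE // negbK => ->.
by rewrite rmorphXn /= mevalXU mulN1r.
Qed.

Lemma Ufil_str k : Ufil k.+1 (str_Fhat_exp K (2 * m).+1 n k).
Proof.
apply: Ufil_sum => i _; rewrite signr_scale; apply: UfilZ.
exact: (proj1 (tens_exp_symbol _ (fun=> 0) _ _)).
Qed.

Lemma liftable_psum k : liftable (psum K evens (~: evens) (2 * k.+1)).
Proof.
apply: (liftable_homog (d := 2 * k.+1)).
  by apply: rpredB; apply: rpred_sum => a _; rewrite mpolyXn dhomogX /= mdegMn mdeg1 mul1n.
exists ((2 ^+ (2 * k.+1).+1)^-1 *: str_Fhat_exp K (2 * m).+1 n (2 * k.+1)); split.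
- by apply/subalg_scale/subalg_incl; exists k.+1.
- exact/UfilZ/Ufil_str.
- move=> v; rewrite linearZ /= /symbL str_symbol // psum_meval mulrA mulVf ?mul1r //.
  by rewrite expf_neq0 // pnatr_eq0.
Qed.

Lemma liftable_gen p :
  subalg_gen (fun q => exists k, q = psum K evens (~: evens) (2 * k.+1)) p -> liftable p.
Proof.
elim=> [_ [k ->]||t y q _ hy _ hq|y q _ hy _ hq].
- exact: liftable_psum.
- by apply: liftable_homog lifts_one; exact: dhomog1.
- by move=> d; rewrite linearP; exact: lifts_lin.
- exact: liftable_mul.
Qed.

Lemma meval_inj p q : (forall v, p.@[v] = q.@[v]) -> p = q.
Proof.
by move=> pq; apply/eqP; rewrite -subr_eq0; apply/eqP/meval_eq0 => v; rewrite mevalB pq subrr.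
Qed.

Definition symb_poly d u : P := d`!%:R^-1 *: symp d u.

Lemma symb_polyE d u v : (symb_poly d u).@[v] = symbL d (rho (hv v)) u.
Proof. by rewrite mevalZ symp_meval. Qed.

Lemma symb_poly_homog d u : symb_poly d u \is d.-homog.
Proof. exact/dhomogZ/symp_homog. Qed.

Lemma symb_poly_supersymmetric d z : supercenter z ->
  supersymmetric evens (~: evens) (symb_poly d z).
Proof.
move=> cz.
have tp a b : (a < n)%N = (b < n)%N -> rename (tperm a b) (symb_poly d z) = symb_poly d z.
  move=> ab; apply: meval_inj => v; rewrite subst_meval (meval_eq _ (fun c => mevalXU v (tperm a b c))).
  by rewrite !symb_polyE; exact: symb_tperm.
split=> a b; rewrite !inE ?negbK.
- by move=> /negPf ha /negPf hb; rewrite tp // ha hb.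
- by move=> ha hb; rewrite tp // ha hb.
move=> ha hb; have ab : a != b by apply: contraNneq ha => ->.
apply: meval_inj => v; rewrite !subst_meval !symb_polyE.
apply: (symb_cancel cz d (a := a) (b := b)).
- by rewrite (negPf ha) hb.
- by rewrite !mevalXU /collapse eqxx [b == a]eq_sym (negPf ab).
- by rewrite !eqxx orbT.
- by move=> c ca cb; rewrite /collapse (negPf ca) (negPf cb).
Qed.

Lemma symb_poly_flip d z a : supercenter z -> flip a (symb_poly d z) = symb_poly d z.
Proof.
move=> cz; apply: meval_inj => v.
rewrite subst_meval (@meval_eq _ _ _ (fun c => if c == a then - v c else v c)).
  by rewrite !symb_polyE; exact: symb_sign.
by move=> c; case: ifP => _; rewrite ?mevalN mevalXU.
Qed.

Lemma supercenter_gen z : supercenter z -> Q z.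
Proof.
have [d] := Ufil_total z.
elim: d z => [|d IH] z Uz cz; first by rewrite (Ufil0 Uz); exact: subalg_zero.
have Fgen : liftable (symb_poly d z).
  apply/liftable_gen/even_supersymmetric_gen => [|a]; first exact: symb_poly_supersymmetric.
  exact: symb_poly_flip.
(* The symbol is homogeneous, so its component of degree [d] is the whole of it, and [w] has the
   same symbol as [z]. *)
have := Fgen d; rewrite pihomog_dE ?symb_poly_homog // => -[w [Qw Uw sw]].
have cw : supercenter w.
  by apply: supercenter_subalg Qw => u [k [_ ->]]; exact: supercenter_str.
have czw : supercenter (z - w).
  apply: (@supercenter_subalg _ _ _ (fun u => u = z \/ u = w)).
    by move=> u [->|->].
  by apply: subalg_add; [|apply: subalg_opp]; apply: subalg_incl; [left|right].
rewrite -[z](subrK w); apply: subalg_add => //; apply: IH => //.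
apply: central_symbol0 => // [|v]; first exact: UfilB.
by rewrite -[LHS]/(symbL d (rho (hv v)) _) linearB /= sw symb_polyE subrr.
Qed.

Theorem supercenterE z : supercenter z <-> Q z.
Proof.
split; first exact: supercenter_gen.
by apply: supercenter_subalg => u [k [_ ->]]; exact: supercenter_str.
Qed.

End Generation.

Theorem corollary3p17 (R : realType) (m n : nat)
    (z : Uenv (osp R[i] (2 * m).+1 n)) :
  supercenter z <->
  subalg_gen (fun u : Uenv (osp R[i] (2 * m).+1 n) =>
    exists k : nat, (1 <= k)%N /\ u = str_Fhat_exp R[i] (2 * m).+1 n (2 * k)) z.
Proof. exact: supercenterE. Qed.
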